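(* Let $U=\{(z,c_2,c_4)\in\mathbb{H}\times(\mathbb{C}^2\setminus\{(0,0)\})\mid c_4z-c_2\ne0\}$. The map $u:U\to T$, $$u(z,c_2,c_4)=\left(g_1(z)(c_4z-c_2)^2+c_4(c_4z-c_2),\ g_2(z)(c_4z-c_2)^4,\ g_3(z)(c_4z-c_2)^6\right),$$ is a uniformization of the foliation $\mathcal{F}(\mathrm{Ra})$ restricted to $T$; that is, for each fixed $(c_2,c_4)\in\mathbb{C}^2\setminus\{(0,0)\}$ the image of $z\mapsto u(z,c_2,c_4)$ (defined for $z\in\mathbb{H}$ with $c_4z\neq c_2$) is a leaf of $\mathcal{F}(\mathrm{Ra})|_T$, and every leaf of $\mathcal{F}(\mathrm{Ra})|_T$ is obtained in this way.
   Context: $\mathbb{H}=\{z\in\mathbb{C}\mid\mathrm{Im}(z)>0\}$; $T=\mathbb{C}^3\setminus\{27t_3^2-t_2^3=0\}$. $\mathcal{F}(\mathrm{Ra})$ is the singular holomorphic foliation by curves of $\mathbb{C}^3$ induced by the vector field $$\mathrm{Ra}=\left(t_1^2-\tfrac1{12}t_2\right)\frac{\partial}{\partial t_1}+(4t_1t_2-6t_3)\frac{\partial}{\partial t_2}+\left(6t_1t_3-\tfrac13t_2^2\right)\frac{\partial}{\partial t_3}.$$ For $k=1,2,3$ and $z\in\mathbb{H}$, $$g_k(z)=a_k\left(1+(-1)^k\frac{4k}{B_k}\sum_{n\ge1}\sigma_{2k-1}(n)e^{2\pi i z n}\right),$$ with $B_1=\frac16,\ B_2=\frac1{30},\ B_3=\frac1{42}$,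 $\sigma_i(n)=\sum_{d\mid n}d^i$, and $(a_1,a_2,a_3)=\left(\frac{2\pi i}{12},12\left(\frac{2\pi i}{12}\right)^2,8\left(\frac{2\pi i}{12}\right)^3\right)$. *)

(* Defs.v *)
(* Stdlib reals with Coquelicot's complex numbers. *)
From Stdlib Require Export Reals List Relations.
From Coquelicot Require Export Coquelicot.

Open Scope C_scope.

Definition C3 : Type := (C * C * C)%type.
Definition pr1 (t : C3) : C := fst (fst t).
Definition pr2 (t : C3) : C := snd (fst t).
Definition pr3 (t : C3) : C := snd t.

(** * Foliations by curves of open subsets of C^3

    A holomorphic vector field [V] on an open set [W] induces a foliation by
    curves, regular outside the zeros of [V].  Only the complex line spanned by
    [V] matters, so curves tangent to the foliation may be parametrized with an
    arbitrary nonzero factor [h] in front of [V]. *)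

Definition regular (V : C3 -> C3) (W : C3 -> Prop) (t : C3) : Prop :=
  W t /\ V t <> (RtoC 0, RtoC 0, RtoC 0).

(** [gamma] is a holomorphic immersion of the disc of centre [s0] and radius [r]
    in the regular locus, everywhere tangent to [V]; derivatives are complex. *)
Definition tangent_disc (V : C3 -> C3) (W : C3 -> Prop)
    (s0 : C) (r : R) (gamma : C -> C3) : Prop :=
  forall s : C, (Cmod (s - s0) < r)%R ->
    regular V W (gamma s) /\
    exists h : C, h <> RtoC 0 /\
      @is_derive C_AbsRing C_NormedModule
        (fun w => pr1 (gamma w)) s (h * pr1 (V (gamma s))) /\
      @is_derive C_AbsRing C_NormedModule
        (fun w => pr2 (gamma w)) s (h * pr2 (V (gamma s))) /\
      @is_derive C_AbsRing C_NormedModule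
        (fun w => pr3 (gamma w)) s (h * pr3 (V (gamma s))).

Definition on_common_plaque (V : C3 -> C3) (W : C3 -> Prop) (p q : C3) : Prop :=
  exists (s0 : C) (r : R) (gamma : C -> C3) (s1 s2 : C),
    tangent_disc V W s0 r gamma /\
    (Cmod (s1 - s0) < r)%R /\ (Cmod (s2 - s0) < r)%R /\
    gamma s1 = p /\ gamma s2 = q.

(** Leaves are the classes of regular points for the relation "joined by a finite
    chain of plaques". *)
Definition same_leaf (V : C3 -> C3) (W : C3 -> Prop) : C3 -> C3 -> Prop :=
  clos_refl_sym_trans C3 (on_common_plaque V W).

Definition is_leaf (V : C3 -> C3) (W : C3 -> Prop) (L : C3 -> Prop) : Prop :=
  exists p : C3, regular V W p /\ forall q : C3, L q <-> same_leaf V W p q.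

Definition Ra (t : C3) : C3 :=
  let t1 := pr1 t in let t2 := pr2 t in let t3 := pr3 t in
  (t1 ^ 2 - / 12 * t2,
   4 * t1 * t2 - 6 * t3,
   6 * t1 * t3 - / 3 * t2 ^ 2).

Definition T (t : C3) : Prop := 27 * pr3 t ^ 2 - pr2 t ^ 3 <> RtoC 0.

Definition Cexp (z : C) : C := RtoC (exp (Re z)) * (cos (Im z), sin (Im z)).

(** Sum of a complex series; meaningful when real and imaginary parts converge. *)
Definition CSeries (a : nat -> C) : C :=
  (Series (fun n => Re (a n)), Series (fun n => Im (a n))).

(** Sum of the [i]-th powers of the positive divisors of [n], for [n > 0]. *)
Definition sigma (i n : nat) : nat :=
  list_sum (map (fun d => Nat.pow d i)
                (filter (fun d => Nat.eqb (Nat.modulo n d) 0) (seq 1 n))).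

(** All positive: the absolute values of the usual Bernoulli numbers
    [1/6], [-1/30], [1/42].  Only the indices 1, 2, 3 are used, here and in
    [acoef] and [g]. *)
Definition bern (k : nat) : R :=
  match k with
  | 1%nat => (1 / 6)%R
  | 2%nat => (1 / 30)%R
  | 3%nat => (1 / 42)%R
  | _ => 0%R
  end.

Definition acoef (k : nat) : C :=
  match k with
  | 1%nat => 2 * PI * Ci / 12
  | 2%nat => 12 * (2 * PI * Ci / 12) ^ 2
  | 3%nat => 8 * (2 * PI * Ci / 12) ^ 3
  | _ => RtoC 0
  end.

(** The summation index is shifted: [m] stands for [n - 1] with [n >= 1]. *)
Definition g (k : nat) (z : C) : C :=
  acoef k *
  (1 + RtoC ((-1) ^ k * (4 * INR k / bern k))%R *
       CSeries (fun m => RtoC (INR (sigma (2 * k - 1) (S m))) *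
                         Cexp (2 * PI * Ci * z * RtoC (INR (S m))))).

Definition UpperHalfPlane (z : C) : Prop := (0 < Im z)%R.

Definition U (z c2 c4 : C) : Prop :=
  UpperHalfPlane z /\ (c2, c4) <> (RtoC 0, RtoC 0) /\ c4 * z - c2 <> RtoC 0.

Definition u (z c2 c4 : C) : C3 :=
  (g 1 z * (c4 * z - c2) ^ 2 + c4 * (c4 * z - c2),
   g 2 z * (c4 * z - c2) ^ 4,
   g 3 z * (c4 * z - c2) ^ 6).

Definition u_image (c2 c4 : C) (t : C3) : Prop :=
  exists z : C, U z c2 c4 /\ t = u z c2 c4.

(* Main.v *)
From Stdlib Require Import Lra Lia Psatz ZArith ClassicalEpsilon Classical_Prop.
From mathcomp Require all_boot all_order all_algebra zify ring.
Require Import Defs.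

(** Write w = c4 z - c2, so that u (z, c2, c4) = (g1 w^2 + c4 w, g2 w^4, g3 w^6).  The last two
    coordinates depend on (z, w) only, and for given (z, w), with w nonzero, the first one
    determines c4 and hence c2.  So u is a parametrization by (z, w, c4), and a leaf should be
    what remains when c2 and c4 are frozen.

    Three analytic facts carry the proof.

    The functions g1, g2, g3 solve the differential system of Ra (Ramanujan).  Comparing
    coefficients of q-series, this is a list of convolution identities between divisor sums; they
    follow from one elementary identity of Liouville, proved by a step of the Euclidean algorithm
    on the solutions of a x + b y = n.  Consequently z -> u (z, c2, c4) has velocity Ra / w^2, and
    the discriminant D = 27 g3^2 - g2^3 satisfies D' = 12 g1 D; since D is equivalent to a nonzero
    multiple of q at the cusp, it never vanishes (Dg_neq_0), and u takes its values in T.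

    The modular group acts: u (z, c2, c4) is unchanged by (z, c2, c4) -> (z + 1, c2 + c4, c4) and
    by (z, c2, c4) -> (- 1 / z, - c4, c2).  The second invariance needs the transformation of the
    three functions under z -> - 1 / z.  For g2 it is read off a lattice sum truncated to squares,
    which is exactly covariant (box_S, box_lim).  For g1 and g3 nothing more has to be summed: the
    transformed triple solves the same system, and a solution is determined by its second component
    (solution_determined).

    The map u is onto T (u_surj).  It suffices that g2^3 / D takes every value on the upper half
    plane: the distance to a given value is minimized in the fundamental domain, which is compact
    away from the cusp, where the quotient is unbounded; and a positive minimum contradicts the
    local behaviour h^k (c + o(1)) of the quotient.

    It remains to compare the images with the leaves.  Any two points of an image lie on a
    common plaque (image_plaque), namely a disc in the upper half plane or, when w vanishes at
    a point p of it, a disc in the universal covering of the complement of p.  Conversely, along any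
    tangent disc membership in the image is locally constant (image_locally_constant): by
    compactness of the fundamental domain a limit of points of the image lifts to some (z0, w0),
    near which (z, w) -> (g2 w^4, g3 w^6) is a chart because D is nonzero, and the lift of an
    integral curve to this chart has constant c2 and c4 (lift).  Hence each image is a union
    of leaves contained in one leaf. *)

(** * Complex derivatives *)

Notation Cderiv f z l := (@is_derive C_AbsRing C_NormedModule f (z : C) (l : C)).

Definition near0 (P : C -> Prop) : Prop :=
  exists d : R, Rlt 0 d /\ forall h : C, Rlt (Cmod h) d -> P h.

Lemma near0_and (P Q : C -> Prop) :
  near0 P -> near0 Q -> near0 (fun h => P h /\ Q h).
Proof.
intros [d [Hd HP]] [e [He HQ]]. exists (Rmin d e).
split; [now apply Rmin_glb_lt|]. intros h Hh.
split; [apply HP|apply HQ]; (eapply Rlt_le_trans; [exact Hh|]);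
  [apply Rmin_l|apply Rmin_r].
Qed.

Lemma near0_imp (P Q : C -> Prop) :
  (forall h, P h -> Q h) -> near0 P -> near0 Q.
Proof. intros H [d [Hd HP]]. exists d. split; auto. Qed.

Lemma near0_lt (e : R) : Rlt 0 e -> near0 (fun h => Rlt (Cmod h) e).
Proof. intros He. now exists e. Qed.

Lemma near0_0 (P : C -> Prop) : near0 P -> P (RtoC 0).
Proof. intros [d [Hd HP]]. apply HP. now rewrite Cmod_0. Qed.

Lemma near0_comp (P : C -> Prop) (k : C -> C) :
  near0 P -> (forall e, Rlt 0 e -> near0 (fun h => Rlt (Cmod (k h)) e)) ->
  near0 (fun h => P (k h)).
Proof. intros [d [Hd HP]] Hk. apply (near0_imp _ _ (fun h H => HP _ H) (Hk d Hd)). Qed.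

(** The bridge between the filter-based derivative and all the estimates below. *)
Lemma Cderiv_eps (f : C -> C) (z l : C) :
  Cderiv f z l <->
  (forall eps : R, (0 < eps)%R -> 
     near0 (fun h => (Cmod (f (z + h)%C - f z - l * h) <= eps * Cmod h)%R)).
Proof.
split.
- intros [_ H] eps Heps.
  specialize (H z (fun P H => H) (mkposreal eps Heps)).
  destruct H as [d Hd].
  exists d; split; [apply cond_pos|].
  intros h Hh.
  assert (B : (Cmod (z + h - z) < d)%R) by (now replace (z + h - z) with h by ring).
  specialize (Hd (z + h) B).
  change (Cmod (f (z + h)%C - f z - (z + h - z) * l) <= eps * Cmod (z + h - z))%R in Hd.
  replace (z + h - z) with h in Hd by ring.
  now rewrite (Cmult_comm l h).
- intros H; split.
  + apply is_linear_scal_l.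
  + intros x Hx.
    assert (E : z = x) by (apply (@is_filter_lim_locally_unique C_AbsRing (AbsRing_NormedModule C_AbsRing)); exact Hx).
    subst x. clear Hx.
    intros eps. destruct (H eps (cond_pos eps)) as [d [Hd Hf]].
    exists (mkposreal d Hd).
    change (forall y : C, (Cmod (y - z) < d)%R ->
      (Cmod (f y - f z - (y - z) * l) <= eps * Cmod (y - z))%R).
    intros y Hy.
    specialize (Hf (y - z) Hy).
    replace (z + (y - z)) with y in Hf by ring.
    now rewrite (Cmult_comm (y - z) l).
Qed.

Lemma Cderiv_val (f : C -> C) (z l l' : C) : Cderiv f z l -> l = l' -> Cderiv f z l'.
Proof. now intros H <-. Qed.

Lemma Cderiv_const (c z : C) : Cderiv (fun _ => c) z (RtoC 0).
Proof. apply (@is_derive_const C_AbsRing C_NormedModule). Qed.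

Lemma Cderiv_id (z : C) : Cderiv (fun x => x) z (RtoC 1).
Proof.
apply Cderiv_eps. intros eps He. exists 1%R; split; [lra|].
intros h _. replace (z + h - z - 1 * h) with (RtoC 0) by ring.
rewrite Cmod_0. pose proof (Cmod_ge_0 h). nra.
Qed.

Lemma Cderiv_plus (f g : C -> C) (z a b : C) :
  Cderiv f z a -> Cderiv g z b -> Cderiv (fun x => f x + g x) z (a + b).
Proof. apply (@is_derive_plus C_AbsRing C_NormedModule). Qed.

Lemma Cderiv_opp (f : C -> C) (z a : C) : Cderiv f z a -> Cderiv (fun x => - f x) z (- a).
Proof. apply (@is_derive_opp C_AbsRing C_NormedModule). Qed.

Lemma Cderiv_minus (f g : C -> C) (z a b : C) :
  Cderiv f z a -> Cderiv g z b -> Cderiv (fun x => f x - g x) z (a - b).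
Proof. apply (@is_derive_minus C_AbsRing C_NormedModule). Qed.

Lemma Cmod_triangle_sub (x y : C) : (Cmod (x - y) <= Cmod x + Cmod y)%R.
Proof. unfold Cminus. rewrite <- (Cmod_opp y). apply Cmod_triangle. Qed.

Lemma Cderiv_lip (f : C -> C) (z l : C) :
  Cderiv f z l ->
  near0 (fun h => (Cmod (f (z + h)%C - f z) <= (Cmod l + 1) * Cmod h)%R).
Proof.
intros H. generalize (proj1 (Cderiv_eps f z l) H 1%R Rlt_0_1).
apply near0_imp. intros h Hf.
replace (f (z + h) - f z) with ((f (z + h) - f z - l * h) + l * h) by ring.
eapply Rle_trans; [apply Cmod_triangle|]. rewrite Cmod_mult.
lra.
Qed.

Lemma near0_small_lip (k : C -> C) (L : R) :
  near0 (fun h => (Cmod (k h) <= L * Cmod h)%R) ->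
  forall e, Rlt 0 e -> near0 (fun h => Rlt (Cmod (k h)) e).
Proof.
intros H e He.
assert (HL : (0 < e / (Rabs L + 1))%R).
{ pose proof (Rabs_pos L). apply Rdiv_lt_0_compat; lra. }
generalize (near0_and _ _ H (near0_lt _ HL)). apply near0_imp.
intros h [H1 H2]. pose proof (Rabs_pos L). pose proof (Rle_abs L).
pose proof (Cmod_ge_0 h).
assert (Cmod h * (Rabs L + 1) < e)%R.
{ apply Rmult_lt_compat_r with (r := (Rabs L + 1)%R) in H2; [|lra].
  unfold Rdiv in H2. rewrite Rmult_assoc, Rinv_l in H2; lra. }
nra.
Qed.

Lemma Cderiv_cont (f : C -> C) (z l : C) :
  Cderiv f z l ->
  forall e, Rlt 0 e -> near0 (fun h => Rlt (Cmod (f (z + h)%C - f z)) e).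
Proof. intros H. apply near0_small_lip with (L := (Cmod l + 1)%R), Cderiv_lip, H. Qed.

Lemma Cderiv_mult (f g : C -> C) (z a b : C) :
  Cderiv f z a -> Cderiv g z b -> Cderiv (fun x => f x * g x) z (a * g z + f z * b).
Proof.
intros Hf Hg. apply Cderiv_eps. intros eps He.
set (M := (Cmod (f z) + Cmod (g z) + 1)%R).
assert (HM : (0 < M)%R).
{ unfold M. pose proof (Cmod_ge_0 (f z)). pose proof (Cmod_ge_0 (g z)). lra. }
set (N := ((Cmod a + 1) * (Cmod b + 1))%R).
assert (HN : (0 < N)%R).
{ unfold N. pose proof (Cmod_ge_0 a). pose proof (Cmod_ge_0 b). nra. }
assert (He2 : (0 < eps / (2 * M))%R) by (apply Rdiv_lt_0_compat; lra).
assert (He3 : (0 < eps / (2 * N))%R) by (apply Rdiv_lt_0_compat; lra).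
generalize (near0_and _ _ (near0_and _ _ (Cderiv_lip f z a Hf) (Cderiv_lip g z b Hg))
  (near0_and _ _ (near0_and _ _ (proj1 (Cderiv_eps f z a) Hf _ He2)
     (proj1 (Cderiv_eps g z b) Hg _ He2)) (near0_lt _ He3))).
apply near0_imp. intros h [[Lf Lg] [[Ef Eg] Hh]].
set (e2 := (eps / (2 * M))%R) in *. set (e3 := (eps / (2 * N))%R) in *.
assert (E2 : (e2 * M = eps / 2)%R) by (unfold e2; field; lra).
assert (E3 : (e3 * N = eps / 2)%R) by (unfold e3; field; lra).
replace (f (z + h) * g (z + h) - f z * g z - (a * g z + f z * b) * h)
  with ((f (z + h) - f z) * (g (z + h) - g z) +
        ((f (z + h) - f z - a * h) * g z + f z * (g (z + h) - g z - b * h))) by ring.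
eapply Rle_trans; [apply Cmod_triangle|].
eapply Rle_trans; [apply Rplus_le_compat_l, Cmod_triangle|].
rewrite !Cmod_mult.
assert (P0 := Cmod_ge_0 h).
assert (A1 : (Cmod (f (z + h)%C - f z) * Cmod (g (z + h)%C - g z) <= eps / 2 * Cmod h)%R).
{ apply Rle_trans with (((Cmod a + 1) * Cmod h) * ((Cmod b + 1) * Cmod h))%R.
  - apply Rmult_le_compat; auto using Cmod_ge_0.
  - replace ((Cmod a + 1) * Cmod h * ((Cmod b + 1) * Cmod h))%R with (N * Cmod h * Cmod h)%R
      by (unfold N; ring).
    apply Rmult_le_compat_r; [exact P0|]. nra. }
assert (A2 : (Cmod (f (z + h)%C - f z - a * h) * Cmod (g z) <= e2 * Cmod h * Cmod (g z))%R)
  by (apply Rmult_le_compat_r; auto using Cmod_ge_0).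
assert (A3 : (Cmod (f z) * Cmod (g (z + h)%C - g z - b * h) <= Cmod (f z) * (e2 * Cmod h))%R)
  by (apply Rmult_le_compat_l; auto using Cmod_ge_0).
assert (A4 : (e2 * Cmod h * Cmod (g z) + Cmod (f z) * (e2 * Cmod h) <= e2 * M * Cmod h)%R).
{ unfold M. assert (0 <= e2 * Cmod h)%R by (apply Rmult_le_pos; lra). nra. }
rewrite E2 in A4. lra.
Qed.

Lemma Cderiv_comp (f g : C -> C) (z a b : C) :
  Cderiv f (g z) a -> Cderiv g z b -> Cderiv (fun x => f (g x)) z (a * b).
Proof.
intros Hf Hg. apply Cderiv_eps. intros eps He.
set (A := (Cmod a + 1)%R). set (B := (Cmod b + 1)%R).
assert (HA : (0 < A)%R) by (unfold A; pose proof (Cmod_ge_0 a); lra).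
assert (HB : (0 < B)%R) by (unfold B; pose proof (Cmod_ge_0 b); lra).
assert (He2 : (0 < eps / (2 * A))%R) by (apply Rdiv_lt_0_compat; lra).
assert (He3 : (0 < eps / (2 * B))%R) by (apply Rdiv_lt_0_compat; lra).
generalize (near0_and _ _ (near0_comp _ _ (proj1 (Cderiv_eps f (g z) a) Hf _ He3)
   (Cderiv_cont g z b Hg))
  (near0_and _ _ (Cderiv_lip g z b Hg) (proj1 (Cderiv_eps g z b) Hg _ He2))).
apply near0_imp. intros h [Ef [Lg Eg]].
set (e2 := (eps / (2 * A))%R) in *. set (e3 := (eps / (2 * B))%R) in *.
assert (E2 : (e2 * A = eps / 2)%R) by (unfold e2; field; lra).
assert (E3 : (e3 * B = eps / 2)%R) by (unfold e3; field; lra).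
replace (g z + (g (z + h) - g z)) with (g (z + h)) in Ef by ring.
replace (f (g (z + h)) - f (g z) - a * b * h) with
  ((f (g (z + h)) - f (g z) - a * (g (z + h) - g z)) + a * (g (z + h) - g z - b * h)) by ring.
eapply Rle_trans; [apply Cmod_triangle|]. rewrite Cmod_mult.
assert (P0 := Cmod_ge_0 h).
assert (A1 : (e3 * Cmod (g (z + h)%C - g z) <= e3 * (B * Cmod h))%R)
  by (apply Rmult_le_compat_l; [lra|exact Lg]).
assert (A2 : (Cmod a * Cmod (g (z + h)%C - g z - b * h) <= A * (e2 * Cmod h))%R).
{ apply Rmult_le_compat; auto using Cmod_ge_0. unfold A; lra. }
nra.
Qed.

Lemma Cderiv_inv (z : C) : z <> 0 -> Cderiv (fun x => / x) z (- / (z * z)).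
Proof.
intros Hz. apply Cderiv_eps. intros eps He.
assert (Hm : (0 < Cmod z)%R) by (now apply Cmod_gt_0).
assert (He2 : (0 < eps * (Cmod z) ^ 3 / 2)%R).
{ apply Rdiv_lt_0_compat; [|lra]. apply Rmult_lt_0_compat; [lra|]. now apply pow_lt. }
assert (He3 : (0 < Cmod z / 2)%R) by lra.
generalize (near0_and _ _ (near0_lt _ He2) (near0_lt _ He3)).
apply near0_imp. intros h [H1 H2].
assert (P0 := Cmod_ge_0 h).
assert (Hzh : (Cmod z / 2 <= Cmod (z + h))%R).
{ assert (T := Cmod_triangle (z + h) (- h)). replace (z + h + - h) with z in T by ring.
  rewrite Cmod_opp in T. lra. }
assert (Hzh0 : z + h <> 0) by (apply Cmod_gt_0; lra).
replace (/ (z + h) - / z - - / (z * z) * h) with (h * h * / (z * z * (z + h))) by (field; auto).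
rewrite !Cmod_mult, Cmod_inv by (repeat apply Cmult_neq_0; auto).
rewrite !Cmod_mult.
rewrite (Rmult_comm eps), Rmult_assoc. apply Rmult_le_compat_l; [exact P0|].
apply Rmult_le_reg_r with (Cmod z * Cmod z * Cmod (z + h))%R; [apply Rmult_lt_0_compat; nra|].
rewrite Rmult_assoc, Rinv_l, Rmult_1_r by (apply Rgt_not_eq, Rmult_lt_0_compat; nra).
apply Rle_trans with (eps * Cmod z ^ 3 / 2)%R; [lra|].
replace (eps * Cmod z ^ 3 / 2)%R with (eps * (Cmod z * Cmod z * (Cmod z / 2)))%R by field.
apply Rmult_le_compat_l; [lra|]. apply Rmult_le_compat_l; nra.
Qed.

Lemma Cderiv_div (f g : C -> C) (z a b : C) :
  Cderiv f z a -> Cderiv g z b -> g z <> 0 ->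
  Cderiv (fun x => f x / g x) z ((a * g z - f z * b) / (g z * g z)).
Proof.
intros Hf Hg H0.
eapply Cderiv_val.
- apply Cderiv_mult; [exact Hf|]. apply (Cderiv_comp (fun x => / x) g); [|exact Hg].
  now apply Cderiv_inv.
- cbv beta. now field.
Qed.

Lemma Cderiv_pow (f : C -> C) (z a : C) (n : nat) :
  Cderiv f z a -> Cderiv (fun x => f x ^ n) z (RtoC (INR n) * f z ^ pred n * a).
Proof.
intros Hf. induction n as [|n IH].
- simpl. eapply Cderiv_val; [apply Cderiv_const|ring].
- eapply Cderiv_val; [exact (Cderiv_mult _ _ _ _ _ Hf IH)|].
  rewrite S_INR, RtoC_plus. simpl pred. destruct n as [|n].
  + simpl. ring.
  + simpl. ring.
Qed.

Lemma Cderiv_ext (f g : C -> C) (z l : C) :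
  (forall x, f x = g x) -> Cderiv f z l -> Cderiv g z l.
Proof. intros H. apply is_derive_ext. exact H. Qed.

Lemma Cderiv_ext_near (f g : C -> C) (z l : C) :
  near0 (fun h => f (z + h) = g (z + h)) -> Cderiv f z l -> Cderiv g z l.
Proof.
intros H Hf. apply Cderiv_eps. intros eps He.
generalize (near0_and _ _ H (proj1 (Cderiv_eps f z l) Hf eps He)).
apply near0_imp. intros h [E Hh]. rewrite <- E.
apply near0_0 in H. rewrite Cplus_0_r in H. now rewrite <- H.
Qed.

Lemma Cderiv_unique (f : C -> C) (z a b : C) : Cderiv f z a -> Cderiv f z b -> a = b.
Proof.
intros Ha Hb.
destruct (Ceq_dec a b) as [E|E]; [exact E|exfalso].
assert (Hm : (0 < Cmod (a - b))%R).
{ apply Cmod_gt_0. intros E'. apply E. replace a with (a - b + b) by ring. rewrite E'. ring. }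
assert (He : (0 < Cmod (a - b) / 3)%R) by lra.
destruct (near0_and _ _ (proj1 (Cderiv_eps f z a) Ha _ He) (proj1 (Cderiv_eps f z b) Hb _ He))
  as [d [Hd H]].
destruct (H (RtoC (d / 2))) as [H1 H2].
{ rewrite Cmod_R, Rabs_pos_eq; lra. }
assert (T := Cmod_triangle_sub (f (z + RtoC (d / 2)) - f z - b * RtoC (d / 2))
   (f (z + RtoC (d / 2)) - f z - a * RtoC (d / 2))).
replace (f (z + RtoC (d / 2)) - f z - b * RtoC (d / 2) -
   (f (z + RtoC (d / 2)) - f z - a * RtoC (d / 2))) with ((a - b) * RtoC (d / 2)) in T by ring.
rewrite Cmod_mult in T. rewrite Cmod_R, Rabs_pos_eq in T, H1, H2 by lra.
nra.
Qed.

(** * Moduli *)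

Lemma Cmod_le_sum (z : C) : (Cmod z <= Rabs (Re z) + Rabs (Im z))%R.
Proof.
destruct z as [x y]. replace (x, y) with (RtoC x + Ci * RtoC y)
  by (apply injective_projections; simpl; ring).
eapply Rle_trans; [apply Cmod_triangle|].
rewrite Cmod_mult, !Cmod_R. simpl. 
replace (Cmod Ci) with 1%R; [apply Req_le; f_equal; [f_equal|rewrite Rmult_1_l; f_equal]; simpl; ring|].
unfold Cmod; simpl. replace (0 * (0 * 1) + 1 * (1 * 1))%R with 1%R by ring. now rewrite sqrt_1.
Qed.

Lemma Re_le_Cmod' (z : C) : (Rabs (Re z) <= Cmod z)%R.
Proof. destruct z as [x y]. eapply Rle_trans; [apply Rmax_l|]. apply (Rmax_Cmod (x, y)). Qed.

Lemma Im_le_Cmod' (z : C) : (Rabs (Im z) <= Cmod z)%R.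
Proof. destruct z as [x y]. eapply Rle_trans; [apply Rmax_r|]. apply (Rmax_Cmod (x, y)). Qed.

(** * The complex exponential *)

Lemma Cexp_plus (a b : C) : Cexp (a + b) = Cexp a * Cexp b.
Proof.
destruct a as [x y], b as [x' y']. unfold Cexp; simpl.
rewrite exp_plus, cos_plus, sin_plus. apply injective_projections; simpl; ring.
Qed.

Lemma Cexp_0 : Cexp 0 = 1.
Proof. unfold Cexp; simpl. rewrite exp_0, cos_0, sin_0. apply injective_projections; simpl; ring. Qed.

Lemma Cmod_Cexp (z : C) : Cmod (Cexp z) = exp (Re z).
Proof.
unfold Cexp. rewrite Cmod_mult, Cmod_R, Rabs_pos_eq by (apply Rlt_le, exp_pos).
unfold Cmod; simpl.
replace (cos (Im z) * (cos (Im z) * 1) + sin (Im z) * (sin (Im z) * 1))%R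
  with (Rsqr (sin (Im z)) + Rsqr (cos (Im z)))%R by (unfold Rsqr; ring).
rewrite sin2_cos2, sqrt_1. ring.
Qed.

Lemma Cexp_neq_0 (z : C) : Cexp z <> 0.
Proof. apply Cmod_gt_0. rewrite Cmod_Cexp. apply exp_pos. Qed.

Lemma Cexp_nat (z : C) (n : nat) : Cexp (z * RtoC (INR n)) = Cexp z ^ n.
Proof.
induction n as [|n IH].
- simpl. replace (z * 0) with (RtoC 0) by ring. apply Cexp_0.
- rewrite S_INR, RtoC_plus.
  replace (z * (INR n + 1)) with (z + z * INR n) by ring.
  now rewrite Cexp_plus, IH.
Qed.

(** Used with the projections Re and Im, to expand exp, cos and sin at 0. *)
Lemma real_small (f : R -> R) (l : R) (p : C -> R) :
  derivable_pt_lim f 0 l -> (forall h, Rabs (p h) <= Cmod h)%R ->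
  forall e, Rlt 0 e -> near0 (fun h => (Rabs (f (p h) - f 0 - l * p h) <= e * Rabs (p h))%R).
Proof.
intros H Hp e He. destruct (H e He) as [[d Hd] Hf]. simpl in Hf.
exists d; split; [exact Hd|]. intros h Hh.
destruct (Req_dec (p h) 0) as [E|E].
- rewrite E. replace (f 0 - f 0 - l * 0)%R with 0%R by ring. rewrite Rabs_R0. lra.
- specialize (Hf (p h) E (Rle_lt_trans _ _ _ (Hp h) Hh)).
  rewrite Rplus_0_l in Hf.
  replace (f (p h) - f 0 - l * p h)%R with (((f (p h) - f 0) / p h - l) * p h)%R by (field; exact E).
  rewrite Rabs_mult. apply Rmult_le_compat_r; [apply Rabs_pos|lra].
Qed.

Lemma Cderiv_Cexp_0 : Cderiv Cexp 0 1.
Proof.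
apply Cderiv_eps. intros eps He.
set (e := Rmin 1 (eps / 16)).
assert (He1 : (0 < e)%R) by (unfold e; apply Rmin_glb_lt; lra).
assert (He2 : (e <= 1)%R) by apply Rmin_l.
assert (He3 : (e <= eps / 16)%R) by apply Rmin_r.
assert (A := real_small exp 1 Re derivable_pt_lim_exp_0 Re_le_Cmod' e He1).
assert (C0 : derivable_pt_lim cos 0 0).
{ replace 0%R with (- sin 0)%R at 2 by (rewrite sin_0; ring). apply derivable_pt_lim_cos. }
assert (S0 : derivable_pt_lim sin 0 1).
{ rewrite <- cos_0 at 1. apply derivable_pt_lim_sin. }
assert (B := real_small cos 0 Im C0 Im_le_Cmod' e He1).
assert (D := real_small sin 1 Im S0 Im_le_Cmod' e He1).
generalize (near0_and _ _ (near0_and _ _ A (near0_lt _ He1)) (near0_and _ _ B D)).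
apply near0_imp. clear A B D. intros h [[A Hh] [B D]].
rewrite exp_0 in A. rewrite cos_0 in B. rewrite sin_0 in D.
rewrite Cplus_0_l, Cexp_0.
assert (Hr := Re_le_Cmod' h). assert (Hi := Im_le_Cmod' h).
destruct h as [x y]. simpl Re in *. simpl Im in *.
set (m := Cmod (x, y)) in *.
eapply Rle_trans; [apply Cmod_le_sum|].
unfold Cexp; simpl.
set (ex := exp x) in *. set (c := cos y) in *. set (s := sin y) in *.
assert (Q1 : (Rabs (ex - 1) <= 2 * m)%R).
{ replace (ex - 1)%R with ((ex - 1 - 1 * x) + x)%R by ring.
  eapply Rle_trans; [apply Rabs_triang|]. 
  assert (0 <= Rabs x)%R by apply Rabs_pos. nra. }
assert (Q2 : (Rabs (s - 0) <= 2 * m)%R).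
{ replace (s - 0)%R with ((s - 0 - 1 * y) + y)%R by ring.
  eapply Rle_trans; [apply Rabs_triang|]. 
  assert (0 <= Rabs y)%R by apply Rabs_pos. nra. }
assert (Q3 : (Rabs ex <= 3)%R).
{ replace ex with ((ex - 1) + 1)%R by ring.
  eapply Rle_trans; [apply Rabs_triang|]. rewrite Rabs_R1. lra. }
match goal with |- (Rabs ?u + Rabs ?v <= _)%R =>
  replace u with ((ex - 1 - 1 * x) + ex * (c - 1 - 0 * y))%R by ring;
  replace v with ((ex - 1) * (s - 0) + (s - 0 - 1 * y))%R by ring end.
assert (T1 := Rabs_triang (ex - 1 - 1 * x) (ex * (c - 1 - 0 * y))).
assert (T2 := Rabs_triang ((ex - 1) * (s - 0)) (s - 0 - 1 * y)).
rewrite Rabs_mult in T1, T2.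
assert (P1 : (Rabs ex * Rabs (c - 1 - 0 * y) <= 3 * (e * m))%R).
{ apply Rmult_le_compat; try apply Rabs_pos; auto. nra. }
assert (P2 : (Rabs (ex - 1) * Rabs (s - 0) <= (2 * e) * (2 * m))%R).
{ apply Rmult_le_compat; try apply Rabs_pos; auto. nra. }
assert (0 <= m)%R by apply Cmod_ge_0.
assert (e * m <= eps / 16 * m)%R by (apply Rmult_le_compat_r; lra).
assert (e * Rabs x <= e * m)%R by (apply Rmult_le_compat_l; lra).
assert (e * Rabs y <= e * m)%R by (apply Rmult_le_compat_l; lra).
assert (0 <= eps * m)%R by (apply Rmult_le_pos; lra). lra.
Qed.

Lemma Cderiv_Cexp (z : C) : Cderiv Cexp z (Cexp z).
Proof.
apply Cderiv_ext with (fun x => Cexp z * Cexp (x - z)).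
{ intros x. rewrite <- Cexp_plus. f_equal. ring. }
eapply Cderiv_val.
- apply Cderiv_mult; [apply Cderiv_const|].
  apply (Cderiv_comp Cexp (fun x => x - z) z 1 (1 - 0)).
  + replace (z - z) with (RtoC 0) by ring. apply Cderiv_Cexp_0.
  + apply Cderiv_minus; [apply Cderiv_id|apply Cderiv_const].
- cbv beta. ring.
Qed.

Lemma Cexp_surj (z : C) : z <> 0 -> exists s, Cexp s = z.
Proof.
intros Hz. assert (Hm := proj1 (Cmod_gt_0 z) Hz).
set (r := Cmod z) in *. 
assert (E : (Re z * Re z + Im z * Im z = r * r)%R).
{ unfold r, Cmod, Re, Im. rewrite sqrt_sqrt; [simpl; ring|]. nra. }
set (x := (Re z / r)%R). set (y := (Im z / r)%R).
assert (E2 : (x * x + y * y = 1)%R).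
{ unfold x, y. replace (Re z / r * (Re z / r) + Im z / r * (Im z / r))%R
   with ((Re z * Re z + Im z * Im z) / (r * r))%R by (field; lra).
  rewrite E. field. lra. }
assert (Hx : (-1 <= x <= 1)%R) by (split; nra).
assert (H : exists t, cos t = x /\ sin t = y).
{ destruct (Rle_dec 0 y) as [Hy|Hy].
  - exists (acos x). split; [now apply cos_acos|].
    rewrite sin_acos by exact Hx.
    replace (1 - x²)%R with (y * y)%R by (unfold Rsqr; lra). now apply sqrt_square.
  - exists (- acos x)%R. rewrite cos_neg, sin_neg. split; [now apply cos_acos|].
    rewrite sin_acos by exact Hx.
    replace (1 - x²)%R with ((-y) * (-y))%R by (unfold Rsqr; lra).
    rewrite sqrt_square; lra. }
destruct H as [t [Hc Hs]].
exists (ln r, t). unfold Cexp. simpl. rewrite exp_ln by exact Hm. rewrite Hc, Hs.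
unfold x, y. destruct z as [a b]. apply injective_projections; simpl; field; lra.
Qed.

Lemma Croot (z : C) (n : nat) : (0 < n)%nat -> z <> 0 -> exists w : C, w <> 0 /\ w ^ n = z.
Proof.
intros Hn Hz. destruct (Cexp_surj z Hz) as [s Hs].
exists (Cexp (s / RtoC (INR n))). split; [apply Cexp_neq_0|].
rewrite <- Cexp_nat, <- Hs. f_equal. field.
intros E. apply RtoC_inj in E. apply not_0_INR in E; [easy|lia].
Qed.

(** * Calculus along segments *)

Lemma Re_lin (A B M : C) (h : R) : Re (A - B - M * RtoC h) = (Re A - Re B - Re M * h)%R.
Proof. destruct A, B, M; simpl; ring. Qed.

Lemma Im_lin (A B M : C) (h : R) : Im (A - B - M * RtoC h) = (Im A - Im B - Im M * h)%R.
Proof. destruct A, B, M; simpl; ring. Qed.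

(** Restriction to a segment turns a complex derivative into two real ones, which is how the mean
    value theorem becomes available. *)
Lemma real_path (f : C -> C) (a b l : C) (t : R) :
  Cderiv f (a + RtoC t * (b - a)) l ->
  is_derive (fun t => Re (f (a + RtoC t * (b - a)))) t (Re (l * (b - a))) /\
  is_derive (fun t => Im (f (a + RtoC t * (b - a)))) t (Im (l * (b - a))).
Proof.
intros H.
assert (K : forall e, Rlt 0 e -> exists d, Rlt 0 d /\ forall h, Rlt (Rabs h) d ->
   (Cmod (f (a + RtoC (t + h) * (b - a))%C - f (a + RtoC t * (b - a))%C - l * (b - a) * RtoC h)
     <= e * Rabs h)%R).
{ intros e He. set (m := (Cmod (b - a) + 1)%R).
  assert (Hm : (0 < m)%R) by (unfold m; pose proof (Cmod_ge_0 (b - a)); lra).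
  destruct (proj1 (Cderiv_eps _ _ _) H (e / m)%R) as [d [Hd Hf]]; [apply Rdiv_lt_0_compat; lra|].
  exists (d / m)%R. split; [apply Rdiv_lt_0_compat; lra|]. intros h Hh.
  assert (Hs : (Cmod (RtoC h * (b - a)) < d)%R).
  { rewrite Cmod_mult, Cmod_R. apply Rle_lt_trans with (Rabs h * m)%R.
    - apply Rmult_le_compat_l; [apply Rabs_pos|unfold m; lra].
    - apply Rmult_lt_compat_r with (r := m) in Hh; [|lra].
      replace (d / m * m)%R with d in Hh by (field; lra). exact Hh. }
  specialize (Hf _ Hs).
  replace (a + RtoC t * (b - a) + RtoC h * (b - a)) with (a + RtoC (t + h) * (b - a)) in Hf
    by (rewrite RtoC_plus; ring).
  replace (l * (b - a) * RtoC h) with (l * (RtoC h * (b - a))) by ring.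
  eapply Rle_trans; [exact Hf|]. rewrite Cmod_mult, Cmod_R.
  apply Rle_trans with (e / m * (Rabs h * m))%R.
  - apply Rmult_le_compat_l; [apply Rlt_le, Rdiv_lt_0_compat; lra|].
    apply Rmult_le_compat_l; [apply Rabs_pos|unfold m; lra].
  - apply Req_le. field. lra. }
split; apply is_derive_Reals; intros e He;
  destruct (K (e / 2)%R) as [d [Hd Hf]]; try lra;
  exists (mkposreal d Hd); intros h Hh Hd'; simpl in Hd'; specialize (Hf h Hd');
  apply Rle_lt_trans with (e / 2)%R; try lra;
  (match goal with |- (Rabs ?u <= _)%R => apply Rmult_le_reg_r with (Rabs h);
     [now apply Rabs_pos_lt|rewrite <- Rabs_mult] end);
  (eapply Rle_trans; [|exact Hf]).
- eapply Rle_trans; [|apply Re_le_Cmod']. apply Req_le. f_equal.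
  rewrite Re_lin. field. exact Hh.
- eapply Rle_trans; [|apply Im_le_Cmod']. apply Req_le. f_equal.
  rewrite Im_lin. field. exact Hh.
Qed.

Notation seg a b t := (Cplus a (Cmult (RtoC t) (Cminus b a))).

(** The real mean value theorem is applied to the two parts of f - l z separately, hence the
    factor 2. *)
Lemma segment_mvt (f df : C -> C) (a b l : C) (K : R) :
  (forall t : R, (0 <= t <= 1)%R -> Cderiv f (seg a b t) (df (seg a b t))) ->
  (forall t : R, (0 <= t <= 1)%R -> (Cmod (df (seg a b t) - l) <= K)%R) ->
  (Cmod (f b - f a - l * (b - a)) <= 2 * K * Cmod (b - a))%R.
Proof.
intros Hd HK.
set (F := fun z => f z - l * z).
assert (HF : forall t : R, (0 <= t <= 1)%R ->
   Cderiv F (seg a b t) (df (seg a b t) - l)).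
{ intros t Ht. unfold F. eapply Cderiv_val.
  - apply Cderiv_minus; [apply Hd, Ht|]. apply Cderiv_mult; [apply Cderiv_const|apply Cderiv_id].
  - cbv beta. ring. }
assert (E0 : a + RtoC 0 * (b - a) = a) by ring.
assert (E1 : a + RtoC 1 * (b - a) = b) by ring.
assert (G : forall p : C -> R, (forall z, Rabs (p z) <= Cmod z)%R ->
  (forall x y, p (x - y)%C = p x - p y)%R ->
  (forall t l, Cderiv F (seg a b t) l ->
    is_derive (fun t => p (F (seg a b t))) t (p (l * (b - a))%C)) ->
  (Rabs (p (F b - F a)%C) <= K * Cmod (b - a))%R).
{ intros p Hp Hs Hder.
  destruct (MVT_gen (fun t => p (F (seg a b t))) 0 1
     (fun t => p ((df (seg a b t) - l) * (b - a)))) as [c [Hc E]].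
  - intros x Hx. rewrite Rmin_left, Rmax_right in Hx by lra. apply Hder, HF. lra.
  - intros x Hx. rewrite Rmin_left, Rmax_right in Hx by lra.
    apply continuity_pt_filterlim. apply (@ex_derive_continuous _ R_NormedModule).
    eexists. apply Hder, HF. lra.
  - rewrite Rmin_left, Rmax_right in Hc by lra. rewrite E0, E1 in E.
    rewrite Hs, E, Rminus_0_r, Rmult_1_r. eapply Rle_trans; [apply Hp|].
    rewrite Cmod_mult. apply Rmult_le_compat_r; [apply Cmod_ge_0|]. now apply HK. }
replace (f b - f a - l * (b - a)) with (F b - F a) by (unfold F; ring).
eapply Rle_trans; [apply Cmod_le_sum|].
assert (GR := G Re Re_le_Cmod' (fun x y => eq_refl) (fun t l H => proj1 (real_path F a b l t H))).
assert (GI := G Im Im_le_Cmod' (fun x y => eq_refl) (fun t l H => proj2 (real_path F a b l t H))).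
lra.
Qed.

(** The squared modulus N of f along the segment satisfies N' <= L N with L = 2 K |b - a|, so that
    N exp (- L t) does not increase. *)
Lemma linear_ode_zero (f c : C -> C) (a b : C) (K : R) :
  (forall t : R, (0 <= t <= 1)%R ->
     Cderiv f (seg a b t) (c (seg a b t) * f (seg a b t))) ->
  (forall t : R, (0 <= t <= 1)%R -> (Cmod (c (seg a b t)) <= K)%R) ->
  f a = 0 -> f b = 0.
Proof.
intros Hd HK Ha.
set (z := fun t : R => seg a b t).
set (L := (2 * (K * Cmod (b - a)))%R).
set (N := fun t => (Re (f (z t)) * Re (f (z t)) + Im (f (z t)) * Im (f (z t)))%R).
set (dN := fun t => (2 * (Re (f (z t)) * Re (c (z t) * f (z t) * (b - a)) +
   Im (f (z t)) * Im (c (z t) * f (z t) * (b - a))))%R).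
assert (DN : forall t, (0 <= t <= 1)%R -> is_derive N t (dN t)).
{ intros t Ht. destruct (real_path f a b _ t (Hd t Ht)) as [H1 H2].
  unfold N, dN. evar_last.
  - apply (@is_derive_plus R_AbsRing R_NormedModule).
    + apply (@is_derive_mult R_AbsRing); [exact H1|exact H1|intros; apply Rmult_comm].
    + apply (@is_derive_mult R_AbsRing); [exact H2|exact H2|intros; apply Rmult_comm].
  - unfold plus, mult; simpl. unfold z. ring. }
assert (BN : forall t, (0 <= t <= 1)%R -> (dN t <= L * N t)%R).
{ intros t Ht. unfold dN, L, N. specialize (HK t Ht). fold (z t) in HK.
  set (F := f (z t)) in *. set (G := c (z t) * F * (b - a)).
  assert (HG : (Cmod G <= (K * Cmod (b - a)) * Cmod F)%R).
  { unfold G. rewrite !Cmod_mult. pose proof (Cmod_ge_0 F). pose proof (Cmod_ge_0 (b - a)).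
    pose proof (Rmult_le_pos _ _ H H0). nra. }
  assert (HR : (Re F * Re G + Im F * Im G <= Cmod F * Cmod G)%R).
  { rewrite <- (Cmod_conj G), <- Cmod_mult. eapply Rle_trans; [|apply Rle_trans with (1 := Rle_abs _); apply Re_le_Cmod'].
    destruct F, G; simpl. lra. }
  assert (HF : (Re F * Re F + Im F * Im F = Cmod F * Cmod F)%R).
  { unfold Cmod. rewrite sqrt_sqrt; [destruct F; simpl; ring|destruct F; simpl; nra]. }
  rewrite HF. pose proof (Cmod_ge_0 F). nra. }
assert (DE : forall t : R, is_derive (fun t : R => exp (- L * t)) t (- L * exp (- L * t))%R).
{ intros t. auto_derive; [easy|ring]. }
destruct (MVT_gen (fun t => (N t * exp (- L * t))%R) 0 1
   (fun t => ((dN t - L * N t) * exp (- L * t))%R)) as [t [Ht E]].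
- intros t Ht. rewrite Rmin_left, Rmax_right in Ht by lra. evar_last.
  + exact (Derive.is_derive_mult N (fun t : R => exp (- L * t)) t _ _ (DN t ltac:(lra)) (DE t)).
  + cbv beta. ring.
- intros t Ht. rewrite Rmin_left, Rmax_right in Ht by lra.
  apply continuity_pt_filterlim.
  apply (@ex_derive_continuous R_AbsRing R_NormedModule (fun t : R => N t * exp (- L * t))%R).
  eexists. exact (Derive.is_derive_mult N (fun t : R => exp (- L * t)) t _ _ (DN t ltac:(lra)) (DE t)).
- rewrite Rmin_left, Rmax_right in Ht by lra.
  assert (E0 : z 0%R = a) by (unfold z; ring).
  assert (E1 : z 1%R = b) by (unfold z; ring).
  assert (N0 : N 0%R = 0%R) by (unfold N; rewrite E0, Ha; simpl; ring).
  rewrite N0 in E. specialize (BN t Ht).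
  assert (X := exp_pos (- L * t)). assert (Y := exp_pos (- L * 1)).
  assert (N1 : (N 1 <= 0)%R) by nra.
  unfold N in N1. rewrite E1 in N1.
  destruct (f b) as [x y]. simpl in N1. apply injective_projections; simpl; nra.
Qed.

Lemma disc_constant (f : C -> C) (a : C) (r : R) :
  (forall z, (Cmod (z - a) < r)%R -> Cderiv f z 0) ->
  forall z, (Cmod (z - a) < r)%R -> f z = f a.
Proof.
intros H z Hz.
assert (B := segment_mvt f (fun _ => 0) a z 0 0).
assert (Hs : forall t : R, (0 <= t <= 1)%R -> (Cmod (seg a z t - a) < r)%R).
{ intros t Ht. replace (a + RtoC t * (z - a) - a) with (RtoC t * (z - a)) by ring.
  rewrite Cmod_mult, Cmod_R, Rabs_pos_eq by lra. pose proof (Cmod_ge_0 (z - a)). nra. }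
assert (E : (Cmod (f z - f a - 0 * (z - a)) <= 0)%R).
{ eapply Rle_trans; [apply B|].
  - intros t Ht. apply H, Hs, Ht.
  - intros t Ht. replace (0 - 0) with (RtoC 0) by ring. rewrite Cmod_0. lra.
  - apply Req_le. ring. }
assert (E2 : f z - f a - 0 * (z - a) = 0).
{ apply Cmod_eq_0. pose proof (Cmod_ge_0 (f z - f a - 0 * (z - a))). lra. }
replace (f z) with (f z - f a - 0 * (z - a) + f a) by ring. rewrite E2. ring.
Qed.

(** * Sequences of complex numbers *)

Definition Clim (v : nat -> C) (l : C) : Prop :=
  forall e : R, Rlt 0 e -> exists N : nat, forall n, (N <= n)%nat -> Rlt (Cmod (v n - l)) e.

Definition extraction (phi : nat -> nat) : Prop := forall n, (phi n < phi (S n))%nat.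

Lemma extraction_ge phi : extraction phi -> forall n, (n <= phi n)%nat.
Proof. intros H n. induction n as [|n IH]; [lia|]. specialize (H n). lia. Qed.

Lemma extraction_mono phi : extraction phi -> forall m n, (m < n)%nat -> (phi m < phi n)%nat.
Proof.
intros H m n L. induction L as [|n L IH]; [apply H|]. specialize (H n). lia.
Qed.

Lemma extraction_comp phi psi :
  extraction phi -> extraction psi -> extraction (fun n => phi (psi n)).
Proof. intros H1 H2 n. apply extraction_mono; auto. Qed.

Lemma Clim_sub v l phi : Clim v l -> extraction phi -> Clim (fun n => v (phi n)) l.
Proof.
intros H Hp e He. destruct (H e He) as [N HN]. exists N. intros n Hn.
apply HN. pose proof (extraction_ge phi Hp n). lia.
Qed.

(** An accumulation point l exists by compactness; the extraction picks, one after the other, later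
    and later indices n with |v n - l| < 1 / (k + 1). *)
Lemma real_BW (v : nat -> R) (M : R) :
  (forall n, (Rabs (v n) <= M)%R) ->
  exists (phi : nat -> nat) (l : R), extraction phi /\
    forall e, Rlt 0 e -> exists N : nat, forall n, (N <= n)%nat -> Rlt (Rabs (v (phi n) - l)) e.
Proof.
intros HM.
destruct (Bolzano_Weierstrass v (fun c => -M <= c <= M)%R (compact_P3 (-M)%R M)) as [l Hl].
{ intros n. specialize (HM n). now apply Rabs_le_between in HM. }
assert (H : forall N k : nat, exists p, (N <= p)%nat /\ (Rabs (v p - l) < / INR (S k))%R).
{ intros N k. assert (Hk : (0 < / INR (S k))%R) by (apply Rinv_0_lt_compat, lt_0_INR; lia).
  destruct (Hl (disc l (mkposreal _ Hk)) N) as [p [Hp Hd]].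
  - exists (mkposreal _ Hk). intros y Hy. exact Hy.
  - exists p. split; [exact Hp|]. exact Hd. }
set (pick := fun N k => proj1_sig (constructive_indefinite_description _ (H N k))).
assert (Hpick : forall N k, (N <= pick N k)%nat /\ (Rabs (v (pick N k) - l) < / INR (S k))%R).
{ intros N k. unfold pick. now destruct (constructive_indefinite_description _ (H N k)). }
set (phi := fix phi n := match n with O => pick O O | S m => pick (S (phi m)) (S m) end).
assert (Hphi : forall n, (Rabs (v (phi n) - l) < / INR (S n))%R).
{ intros [|n]; simpl phi; apply Hpick. }
exists phi, l. split.
- intros n. change (phi (S n)) with (pick (S (phi n)) (S n)).
  destruct (Hpick (S (phi n)) (S n)). lia.
- intros e He. destruct (archimed_cor1 e He) as [N [HN HN0]].
  exists N. intros n Hn. eapply Rlt_trans; [apply Hphi|].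
  eapply Rle_lt_trans; [|exact HN]. apply Rinv_le_contravar; [now apply lt_0_INR|].
  apply le_INR. lia.
Qed.

Lemma Clim_parts (v : nat -> C) (x y : R) :
  (forall e, Rlt 0 e -> exists N : nat, forall n, (N <= n)%nat -> Rlt (Rabs (Re (v n) - x)) e) ->
  (forall e, Rlt 0 e -> exists N : nat, forall n, (N <= n)%nat -> Rlt (Rabs (Im (v n) - y)) e) ->
  Clim v (x, y).
Proof.
intros Hx Hy e He. destruct (Hx (e / 2)%R) as [N1 H1]; [lra|].
destruct (Hy (e / 2)%R) as [N2 H2]; [lra|].
exists (max N1 N2). intros n Hn. eapply Rle_lt_trans; [apply Cmod_le_sum|].
specialize (H1 n ltac:(lia)). specialize (H2 n ltac:(lia)).
replace (Re (v n - (x, y))) with (Re (v n) - x)%R by (destruct (v n); reflexivity).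
replace (Im (v n - (x, y))) with (Im (v n) - y)%R by (destruct (v n); reflexivity).
lra.
Qed.

Lemma Clim_im (v : nat -> C) (l : C) :
  Clim v l -> forall e, Rlt 0 e -> exists N : nat, forall n, (N <= n)%nat -> Rlt (Rabs (Im (v n) - Im l)) e.
Proof.
intros H e He. destruct (H e He) as [N HN]. exists N. intros n Hn.
eapply Rle_lt_trans; [|apply (HN n Hn)]. apply (Im_le_Cmod' (v n - l)).
Qed.

Lemma complex_BW (v : nat -> C) (M : R) :
  (forall n, (Cmod (v n) <= M)%R) ->
  exists (phi : nat -> nat) (l : C), extraction phi /\ Clim (fun n => v (phi n)) l.
Proof.
intros HM.
destruct (real_BW (fun n => Re (v n)) M) as [phi [x [Hphi Hx]]].
{ intros n. eapply Rle_trans; [apply Re_le_Cmod'|apply HM]. }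
destruct (real_BW (fun n => Im (v (phi n))) M) as [psi [y [Hpsi Hy]]].
{ intros n. eapply Rle_trans; [apply Im_le_Cmod'|apply HM]. }
exists (fun n => phi (psi n)), (x, y). split; [now apply extraction_comp|].
apply Clim_parts; [|exact Hy].
intros e He. destruct (Hx e He) as [N HN]. exists N. intros n Hn.
apply HN. pose proof (extraction_ge psi Hpsi n). lia.
Qed.

Lemma Clim_unique v l l' : Clim v l -> Clim v l' -> l = l'.
Proof.
intros H H'. destruct (Ceq_dec l l') as [E|E]; [exact E|exfalso].
assert (Hm : (0 < Cmod (l - l'))%R).
{ apply Cmod_gt_0. intros E'. apply E. replace l with (l - l' + l') by ring. rewrite E'. ring. }
destruct (H (Cmod (l - l') / 2)%R) as [N HN]; [lra|].
destruct (H' (Cmod (l - l') / 2)%R) as [N' HN']; [lra|].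
specialize (HN (max N N') ltac:(lia)). specialize (HN' (max N N') ltac:(lia)).
assert (T := Cmod_triangle_sub (v (max N N') - l') (v (max N N') - l)).
replace (v (max N N') - l' - (v (max N N') - l)) with (l - l') in T by ring. lra.
Qed.

Lemma Clim_deriv (f : C -> C) (z l : C) (v : nat -> C) :
  Cderiv f z l -> Clim v z -> Clim (fun n => f (v n)) (f z).
Proof.
intros Hf Hv e He. destruct (Cderiv_cont f z l Hf e He) as [d [Hd H]].
destruct (Hv d Hd) as [N HN]. exists N. intros n Hn.
specialize (H _ (HN n Hn)). now replace (z + (v n - z)) with (v n) in H by ring.
Qed.

Lemma Clim_ext v w l : (forall n, v n = w n) -> Clim v l -> Clim w l.
Proof.
intros E H e He. destruct (H e He) as [N HN]. exists N. intros n Hn. rewrite <- E. now apply HN.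
Qed.

(** * Convolutions of divisor sums *)

Module DivisorSums.
Import all_boot all_order all_algebra zify.zify ring.
Set Implicit Arguments. Unset Strict Implicit. Unset Printing Implicit Defensive.
Import GRing.Theory.
Local Open Scope ring_scope.

Lemma sum_bij (S T : eqType) (A : seq S) (B : seq T) (h : S -> T) (k : T -> S)
    (f : T -> int) :
  uniq A -> uniq B ->
  {in A, forall p, h p \in B /\ k (h p) = p} ->
  {in B, forall q, k q \in A /\ h (k q) = q} ->
  \sum_(p <- A) f (h p) = \sum_(q <- B) f q.
Proof.
move=> uA uB hA hB; rewrite -(big_map h xpredT f); apply: perm_big.
apply: uniq_perm => //.
  rewrite map_inj_in_uniq // => p q /hA [_ Ep] /hA [_ Eq] E.
  by rewrite -Ep -Eq E.
move=> q; apply/mapP/idP => [[p /hA [pB _] ->]|qB] //.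
by have [kA E] := hB q qB; exists (k q).
Qed.

(** Sorting the terms of a sum by the value of h. *)
Lemma sum_fibers (S T : eqType) (A : seq S) (B : seq T) (h : S -> T) (f : S -> int) :
  uniq B -> {in A, forall p, h p \in B} ->
  \sum_(p <- A) f p = \sum_(q <- B) \sum_(p <- [seq p <- A | h p == q]) f p.
Proof.
move=> uB hA; under [RHS]eq_bigr => q _ do rewrite big_filter.
rewrite (exchange_big_dep xpredT) //=.
rewrite big_seq [RHS]big_seq; apply: eq_bigr => p pA.
rewrite -big_filter (_ : [seq i <- B | h p == i] = [:: h p]) ?big_seq1 //.
have -> : [seq i <- B | h p == i] = [seq i <- B | pred1 (h p) i].
  by apply: eq_filter => i; rewrite /= eq_sym.
by rewrite filter_pred1_uniq ?hA.
Qed.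

Definition grid (n : nat) : seq (nat * nat) := [seq (a, b) | a <- iota 1 n, b <- iota 1 n].

Lemma grid_uniq n : uniq (grid n).
Proof. by apply: allpairs_uniq; rewrite ?iota_uniq // => -[a b] [c d] _ _ [-> ->]. Qed.

Lemma mem_grid n a b : ((a, b) \in grid n) = [&& 0 < a, a <= n, 0 < b & b <= n]%N.
Proof.
apply/allpairsP/idP => [[[c d] /= [+ + [-> ->]]]|H].
  by rewrite !mem_iota; lia.
by exists (a, b); split => //=; rewrite mem_iota; lia.
Qed.

Definition factors (n : nat) : seq (nat * nat) := [seq p <- grid n | p.1 * p.2 == n]%N.

Lemma factors_uniq n : uniq (factors n).
Proof. by rewrite filter_uniq ?grid_uniq. Qed.

Lemma mem_factors n d m :
  ((d, m) \in factors n) = [&& 0 < d, 0 < m & d * m == n]%N.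
Proof. by rewrite mem_filter mem_grid /=; apply/idP/idP; nia. Qed.

(** Solutions ((a, x), (b, y)) of a x + b y = n in positive integers. *)
Definition quads (n : nat) : seq ((nat * nat) * (nat * nat)) :=
  [seq r <- [seq (p, q) | p <- grid n, q <- grid n] |
    r.1.1 * r.1.2 + r.2.1 * r.2.2 == n]%N.

Lemma quads_uniq n : uniq (quads n).
Proof.
rewrite filter_uniq //; apply: allpairs_uniq; rewrite ?grid_uniq //.
by move=> [a b] [c d] _ _ [-> ->].
Qed.

Lemma mem_quads n a x b y :
  (((a, x), (b, y)) \in quads n) =
  [&& 0 < a, 0 < x, 0 < b, 0 < y & a * x + b * y == n]%N.
Proof.
rewrite mem_filter /=; apply/andP/idP => [[E /allpairsP [[[c z] [d t]] /= [+ + [Ea Ex Eb Ey]]]]|H].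
  by move: E; rewrite !mem_grid Ea Ex Eb Ey; lia.
split; first by lia.
by apply: allpairs_f; rewrite mem_grid; nia.
Qed.

Lemma mem_filter_quads (P : pred _) n r :
  (r \in [seq r <- quads n | P r]) = P r && (r \in quads n).
Proof. exact: mem_filter. Qed.

Section Liouville.
Variables (F : int -> int -> int) (n : nat).
Hypothesis Fsym : forall a b, F a b = F b a.
Hypothesis Feven : forall a b, F (- a) (- b) = F a b.
Hypothesis Fcyc : forall a b, F a (- a - b) = F a b.

Let Fq (r : (nat * nat) * (nat * nat)) : int := F r.1.1%:Z r.2.1%:Z.
Let Fm (r : (nat * nat) * (nat * nat)) : int := F r.1.1%:Z (- r.2.1%:Z).
Let alt (r : (nat * nat) * (nat * nat)) : bool := (r.1.1 < r.2.1)%N.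
Let agt (r : (nat * nat) * (nat * nat)) : bool := (r.2.1 < r.1.1)%N.
Let aeq (r : (nat * nat) * (nat * nat)) : bool := (r.1.1 == r.2.1)%N.
Let xlt (r : (nat * nat) * (nat * nat)) : bool := (r.1.2 < r.2.2)%N.
Let xgt (r : (nat * nat) * (nat * nat)) : bool := (r.2.2 < r.1.2)%N.
Let xeq (r : (nat * nat) * (nat * nat)) : bool := (r.1.2 == r.2.2)%N.
Notation "'sumq' P G" := (\sum_(r <- [seq r <- quads n | P r]) G r)
  (at level 10, P at level 9, G at level 9).

Lemma sum_trichotomy (G : (nat * nat) * (nat * nat) -> int) (lt gt eq : pred _) :
  (forall r, gt r = ~~ lt r && ~~ eq r) -> (forall r, eq r -> ~~ lt r) ->
  \sum_(r <- quads n) G r = sumq lt G + sumq gt G + sumq eq G.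
Proof.
move=> Hgt Heq; rewrite !(big_filter (quads n)) [LHS](bigID lt) /= -addrA; congr (_ + _).
rewrite [LHS](bigID eq) /= [LHS]addrC; congr (_ + _); apply: eq_bigl => r.
  by rewrite Hgt.
by case: (boolP (eq r)) => [/Heq ->|_]; rewrite ?andbF.
Qed.

Let swapq (r : (nat * nat) * (nat * nat)) := (r.2, r.1).

Lemma sum_swap (G : (nat * nat) * (nat * nat) -> int) (P Q : pred _) :
  (forall r, P (swapq r) = Q r) -> (forall r, Q (swapq r) = P r) ->
  (forall r, G (swapq r) = G r) ->
  sumq P G = sumq Q G.
Proof.
move=> PQ QP GG; rewrite -(@sum_bij _ _ [seq r <- quads n | P r] [seq r <- quads n | Q r] swapq swapq).
- by apply: eq_bigr => r _; rewrite GG.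
- by rewrite filter_uniq ?quads_uniq.
- by rewrite filter_uniq ?quads_uniq.
- move=> [[a x] [b y]]; rewrite !mem_filter_quads QP /swapq /= => /andP [-> H]; split => //=.
by move: H; rewrite !mem_quads; lia.
- move=> [[a x] [b y]]; rewrite !mem_filter_quads PQ /swapq /= => /andP [-> H]; split => //=.
  by move: H; rewrite !mem_quads; lia.
Qed.

(** One step of the Euclidean algorithm: (a, x, b, y) with b < a corresponds to
    (a - b, x, b, x + y), a solution whose second and fourth entries are increasing; and
    F (a, - b) = F (a - b, b), the three variables being a - b, b and - a. *)
Lemma sum_euclid : sumq agt Fm = sumq xlt Fq.
Proof.
rewrite -(@sum_bij _ _ [seq r <- quads n | agt r] [seq r <- quads n | xlt r]
  (fun r => ((r.1.1 - r.2.1, r.1.2), (r.2.1, r.1.2 + r.2.2))%N)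
  (fun r => ((r.1.1 + r.2.1, r.1.2), (r.2.1, r.2.2 - r.1.2))%N)).
- rewrite big_seq [RHS]big_seq; apply: eq_bigr => -[[a x] [b y]].
  rewrite mem_filter_quads /Fq /Fm /agt /= => /andP [ba _].
  rewrite -subzn ?(ltnW ba) //.
  rewrite -[LHS]Feven opprK [LHS]Fsym -[LHS]Fcyc [RHS]Fsym; congr (F _ _); ring.
- by rewrite filter_uniq ?quads_uniq.
- by rewrite filter_uniq ?quads_uniq.
- move=> [[a x] [b y]]; rewrite !mem_filter_quads /agt /xlt /= !mem_quads => H; split; first nia.
  by congr (_, _, (_, _)); lia.
- move=> [[a x] [b y]]; rewrite !mem_filter_quads /agt /xlt /= !mem_quads => H; split; first nia.
  by congr (_, _, (_, _)); lia.
Qed.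

(** Liouville's identity.  The conditions on F say that it is an even and symmetric function of
    three variables of sum zero.  By the exchange of (a, x) and (b, y), the terms F (a, - b)
    with a < b have the same sum as those with a > b, and the terms F (a, b) with x > y as those
    with x < y.  A Euclidean step cancels the one against the other, and only the diagonals a = b
    and x = y survive. *)
Lemma liouville :
  \sum_(r <- quads n) (Fm r - Fq r) =
  \sum_(r <- [seq r <- quads n | r.1.1 == r.2.1]) Fm r -
  \sum_(r <- [seq r <- quads n | r.1.2 == r.2.2]) Fq r.
Proof.
have FqS r : Fq (swapq r) = Fq r by rewrite /Fq Fsym.
have FmS r : Fm (swapq r) = Fm r by rewrite /Fm /= Fsym -Feven opprK.
rewrite sumrB.
rewrite (@sum_trichotomy Fm alt agt aeq); first last.
- by move=> r; rewrite /aeq /alt; lia.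
- by move=> r; rewrite /agt /aeq /alt; lia.
rewrite (@sum_swap Fm alt agt) // sum_euclid.
rewrite (@sum_trichotomy Fq xlt xgt xeq); first last.
- by move=> r; rewrite /xeq /xlt; lia.
- by move=> r; rewrite /xgt /xeq /xlt; lia.
rewrite (@sum_swap Fq xgt xlt) // /aeq /xeq; ring.
Qed.
End Liouville.

Definition divsum (k n : nat) : int := \sum_(p <- factors n) p.1%:Z ^+ k.
Definition conv (i j n : nat) : int := \sum_(1 <= k < n) divsum i k * divsum j (n - k)%N.

Lemma sum_quads i j n :
  \sum_(r <- quads n) r.1.1%:Z ^+ i * r.2.1%:Z ^+ j = conv i j n.
Proof.
rewrite (@sum_fibers _ _ _ (index_iota 1 n) (fun r => r.1.1 * r.1.2)%N) ?iota_uniq //; last first.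
  by move=> [[a x] [b y]]; rewrite mem_quads mem_index_iota /=; nia.
rewrite /conv big_seq [RHS]big_seq; apply: eq_bigr => k; rewrite mem_index_iota => kn.
rewrite /divsum big_distrlr /= -(big_allpairs (F := fun r => r.1.1%:Z ^+ i * r.2.1%:Z ^+ j)).
apply: (@sum_bij _ _ _ _ id id) => //.
- by rewrite filter_uniq ?quads_uniq.
- apply: allpairs_uniq; rewrite ?factors_uniq //.
  by move=> [a b] [c d] _ _ [-> ->].
- move=> [[a x] [b y]]; rewrite mem_filter_quads /= mem_quads => H; split=> //.
  by apply: allpairs_f; rewrite mem_factors; lia.
- move=> r /allpairsP [[[a x] [b y]] /= [+ + ->]].
  by rewrite !mem_factors mem_filter_quads mem_quads /= => H1 H2; split=> //; lia.
Qed.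

(** The solutions with a = b are d (x + y) = n: for a factorization n = d m there are m - 1 of
    them. *)
Lemma sum_diagonal (f : int -> int) n :
  \sum_(r <- [seq r <- quads n | r.1.1 == r.2.1]) f r.1.1%:Z =
  \sum_(p <- factors n) (p.2%:Z - 1) * f p.1%:Z.
Proof.
rewrite (@sum_fibers _ _ _ (factors n) (fun r => (r.1.1, r.1.2 + r.2.2)%N)) ?factors_uniq //;
  last first.
  by move=> [[a x] [b y]]; rewrite mem_filter_quads mem_quads mem_factors /=; nia.
rewrite big_seq [RHS]big_seq; apply: eq_bigr => -[d m]; rewrite mem_factors => dm.
have -> : (m%:Z - 1) * f d%:Z = \sum_(x <- index_iota 1 m) f d%:Z.
  by rewrite sumr_const_nat -mulr_natl natz -subzn //; lia.
rewrite -(@sum_bij _ _ [seq p <- [seq r <- quads n | r.1.1 == r.2.1] | (p.1.1, (p.1.2 + p.2.2)%N) == (d, m)]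
   (index_iota 1 m) (fun r => r.1.2) (fun x => ((d, x), (d, m - x)%N))).
- rewrite big_seq [RHS]big_seq; apply: eq_bigr => -[[a x] [b y]].
  by rewrite mem_filter /= => /andP [/eqP [-> _] _].
- by apply: filter_uniq; apply: filter_uniq; apply: quads_uniq.
- by rewrite iota_uniq.
- move=> [[a x] [b y]]; rewrite mem_filter mem_filter_quads mem_quads mem_index_iota /=.
  move=> /andP [/eqP [-> <-]] H; split; first lia.
  by congr (_, _, (_, _)); lia.
- move=> x; rewrite mem_index_iota mem_filter mem_filter_quads mem_quads /= => H; split=> //.
  apply/andP; split; first by apply/eqP; congr (_, _); lia.
  by nia.
Qed.

(** The solutions with x = y are (a + b) x = n. *)
Lemma sum_antidiagonal (G : int -> int -> int) n :
  \sum_(r <- [seq r <- quads n | r.1.2 == r.2.2]) G r.1.1%:Z r.2.1%:Z =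
  \sum_(p <- factors n) \sum_(1 <= c < p.1) G c%:Z (p.1%:Z - c%:Z).
Proof.
rewrite (@sum_fibers _ _ _ (factors n) (fun r => (r.1.1 + r.2.1, r.1.2)%N)) ?factors_uniq //;
  last first.
  by move=> [[a x] [b y]]; rewrite mem_filter_quads mem_quads mem_factors /=; nia.
rewrite big_seq [RHS]big_seq; apply: eq_bigr => -[d m]; rewrite mem_factors => dm.
rewrite -(@sum_bij _ _ [seq p <- [seq r <- quads n | r.1.2 == r.2.2] | ((p.1.1 + p.2.1)%N, p.1.2) == (d, m)]
   (index_iota 1 d) (fun r => r.1.1) (fun c => ((c, m), (d - c, m)%N))).
- rewrite big_seq [RHS]big_seq; apply: eq_bigr => -[[a x] [b y]].
  rewrite mem_filter /= => /andP [/eqP [<- _] _]; congr (G _ _).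
  by rewrite PoszD; ring.
- by apply: filter_uniq; apply: filter_uniq; apply: quads_uniq.
- by rewrite iota_uniq.
- move=> [[a x] [b y]]; rewrite mem_filter mem_filter_quads mem_quads mem_index_iota /=.
  move=> /andP [/eqP [<- <-]] H; split; first lia.
  by congr (_, _, (_, _)); lia.
- move=> x; rewrite mem_index_iota mem_filter mem_filter_quads mem_quads /= => H; split=> //.
  apply/andP; split; first by apply/eqP; congr (_, _); lia.
  by nia.
Qed.

Lemma conv_sym i j n : conv i j n = conv j i n.
Proof.
rewrite -!sum_quads.
rewrite -(@sum_bij _ _ (quads n) (quads n) (fun r => (r.2, r.1)) (fun r => (r.2, r.1))) ?quads_uniq //.
- by apply: eq_bigr => r _; rewrite mulrC.
- by move=> [[a x] [b y]]; rewrite !mem_quads /= => H; split=> //; lia.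
- by move=> [[a x] [b y]]; rewrite !mem_quads /= => H; split=> //; lia.
Qed.

(** The formulas of Faulhaber up to exponent 6, over the common denominator 420. *)
Lemma sum_poly (c0 c1 c2 c3 c4 c5 c6 : int) (f : int -> int) (d : nat) :
  (forall a, f a = c0 + c1 * a + c2 * a ^+ 2 + c3 * a ^+ 3 + c4 * a ^+ 4 + c5 * a ^+ 5 + c6 * a ^+ 6) ->
  (0 < d)%N ->
  let m := d%:Z - 1 in
  420 * \sum_(1 <= c < d) f c%:Z =
  420 * c0 * m + 210 * c1 * m * (m + 1) + 70 * c2 * m * (m + 1) * (2 * m + 1) +
  105 * c3 * m ^+ 2 * (m + 1) ^+ 2 +
  14 * c4 * m * (m + 1) * (2 * m + 1) * (3 * m ^+ 2 + 3 * m - 1) +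
  35 * c5 * m ^+ 2 * (m + 1) ^+ 2 * (2 * m ^+ 2 + 2 * m - 1) +
  10 * c6 * m * (m + 1) * (2 * m + 1) * (3 * m ^+ 4 + 6 * m ^+ 3 - 3 * m + 1).
Proof.
move=> Hf d0; case: d d0 => // e _ /=; rewrite (_ : e.+1%:Z - 1 = e%:Z); last by lia.
elim: e => [|e IH]; first by rewrite big_geq //; ring.
rewrite big_nat_recr //= mulrDr IH Hf (_ : e.+1%:Z = e%:Z + 1); last by lia.
ring.
Qed.

Lemma liouville_factors (F : int -> int -> int) (n : nat) :
  (forall a b, F a b = F b a) -> (forall a b, F (- a) (- b) = F a b) ->
  (forall a b, F a (- a - b) = F a b) ->
  \sum_(r <- quads n) (F r.1.1%:Z (- r.2.1%:Z) - F r.1.1%:Z r.2.1%:Z) =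
  \sum_(p <- factors n) ((p.2%:Z - 1) * F p.1%:Z (- p.1%:Z) -
     \sum_(1 <= c < p.1) F c%:Z (p.1%:Z - c%:Z)).
Proof.
move=> Fsym Feven Fcyc; rewrite (liouville n Fsym Feven Fcyc) sumrB sum_antidiagonal.
congr (_ - _); rewrite -(sum_diagonal (fun a => F a (- a))) big_seq [RHS]big_seq.
by apply: eq_bigr => -[[a x] [b y]]; rewrite mem_filter_quads /= => /andP [/eqP -> _].
Qed.

Lemma sum_factors4 (c1 c2 c3 c4 : int) (i1 i2 i3 i4 n : nat) :
  \sum_(p <- factors n) (c1 * p.1%:Z ^+ i1 + c2 * p.1%:Z ^+ i2 + c3 * p.1%:Z ^+ i3 + c4 * p.1%:Z ^+ i4) =
  c1 * divsum i1 n + c2 * divsum i2 n + c3 * divsum i3 n + c4 * divsum i4 n.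
Proof. by rewrite !big_split -!mulr_sumr. Qed.

(** The choice of F: the even symmetric polynomials in three variables x, y, - x - y are the
    polynomials in x^2 + x y + y^2 and (x y (x + y))^2.  The degrees 2, 4 and 6 give the convolutions of total
    weight 4, 6 and 8. *)
Lemma conv11 n : 12 * conv 1 1 n = 5 * divsum 3 n + divsum 1 n - 6 * n%:Z * divsum 1 n.
Proof.
have L := @liouville_factors (fun a b => a ^+ 2 + a * b + b ^+ 2) n
  (fun a b => ltac:(ring)) (fun a b => ltac:(ring)) (fun a b => ltac:(ring)).
rewrite (eq_bigr (fun r => -2 * (r.1.1%:Z ^+ 1 * r.2.1%:Z ^+ 1))) in L; last first.
  by move=> r _ /=; ring.
rewrite -mulr_sumr sum_quads in L.
have E : 420 * (-2 * conv 1 1 n) =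
   -350 * divsum 3 n + 420 * n%:Z * divsum 1 n + -70 * divsum 1 n + 0 * divsum 0 n.
  rewrite L -sum_factors4 mulr_sumr big_seq [RHS]big_seq; apply: eq_bigr => -[d m] /=.
  rewrite mem_factors => /and3P [d0 m0 /eqP <-].
  rewrite mulrBr (@sum_poly (d%:Z ^+ 2) (- d%:Z) 1 0 0 0 0 (fun c => c ^+ 2 + c * (d%:Z - c) + (d%:Z - c) ^+ 2)) //.
    by rewrite PoszM; ring.
  by move=> a; ring.
lia.
Qed.

Lemma conv13 n : 240 * conv 1 3 n = 21 * divsum 5 n + 10 * divsum 3 n - 30 * n%:Z * divsum 3 n - divsum 1 n.
Proof.
have L := @liouville_factors (fun a b => (a ^+ 2 + a * b + b ^+ 2) ^+ 2) n
  (fun a b => ltac:(ring)) (fun a b => ltac:(ring)) (fun a b => ltac:(ring)).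
rewrite (eq_bigr (fun r => -4 * (r.1.1%:Z ^+ 1 * r.2.1%:Z ^+ 3) + -4 * (r.1.1%:Z ^+ 3 * r.2.1%:Z ^+ 1))) in L; last first.
  by move=> r _ /=; ring.
rewrite big_split -!mulr_sumr !sum_quads (conv_sym 3) in L.
have E : 420 * (-4 * conv 1 3 n + -4 * conv 1 3 n) =
   -294 * divsum 5 n + 420 * n%:Z * divsum 3 n + -140 * divsum 3 n + 14 * divsum 1 n.
  rewrite L -sum_factors4 mulr_sumr big_seq [RHS]big_seq; apply: eq_bigr => -[d m] /=.
  rewrite mem_factors => /and3P [d0 m0 /eqP <-].
  rewrite mulrBr (@sum_poly (d%:Z ^+ 4) (- 2 * d%:Z ^+ 3) (3 * d%:Z ^+ 2) (- 2 * d%:Z) 1 0 0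
    (fun c => (c ^+ 2 + c * (d%:Z - c) + (d%:Z - c) ^+ 2) ^+ 2)) //.
    by rewrite PoszM; ring.
  by move=> a; ring.
lia.
Qed.

Lemma conv33 n : 120 * conv 3 3 n = divsum 7 n - divsum 3 n.
Proof.
have L := @liouville_factors (fun a b => (a * b * (a + b)) ^+ 2) n
  (fun a b => ltac:(ring)) (fun a b => ltac:(ring)) (fun a b => ltac:(ring)).
rewrite (eq_bigr (fun r => -4 * (r.1.1%:Z ^+ 3 * r.2.1%:Z ^+ 3))) in L; last first.
  by move=> r _ /=; ring.
rewrite -!mulr_sumr !sum_quads in L.
have E : 420 * (-4 * conv 3 3 n) =
   -14 * divsum 7 n + 14 * divsum 3 n + 0 * divsum 0 n + 0 * divsum 0 n.
  rewrite L -sum_factors4 mulr_sumr big_seq [RHS]big_seq; apply: eq_bigr => -[d m] /=.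
  rewrite mem_factors => /and3P [d0 m0 /eqP _].
  rewrite mulrBr (@sum_poly 0 0 (d%:Z ^+ 4) (- 2 * d%:Z ^+ 3) (d%:Z ^+ 2) 0 0
    (fun c => (c * (d%:Z - c) * (c + (d%:Z - c))) ^+ 2)) //.
    by ring.
  by move=> a; ring.
lia.
Qed.

(** The cube of x^2 + x y + y^2 also produces terms a^3 b^3, which conv33 removes. *)
Lemma conv15 n : 504 * conv 1 5 n = 20 * divsum 7 n + 21 * divsum 5 n - 42 * n%:Z * divsum 5 n + divsum 1 n.
Proof.
have L := @liouville_factors (fun a b => (a ^+ 2 + a * b + b ^+ 2) ^+ 3) n
  (fun a b => ltac:(ring)) (fun a b => ltac:(ring)) (fun a b => ltac:(ring)).
rewrite (eq_bigr (fun r => -6 * (r.1.1%:Z ^+ 1 * r.2.1%:Z ^+ 5) + -6 * (r.1.1%:Z ^+ 5 * r.2.1%:Z ^+ 1)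
   + -14 * (r.1.1%:Z ^+ 3 * r.2.1%:Z ^+ 3))) in L; last first.
  by move=> r _ /=; ring.
rewrite [LHS]big_split /= [X in X + _ = _]big_split /= in L.
rewrite -!mulr_sumr !sum_quads (conv_sym 5) in L.
have E : 420 * (-6 * conv 1 5 n + -6 * conv 1 5 n + -14 * conv 3 3 n) =
   (-249 * divsum 7 n + 420 * n%:Z * divsum 5 n + -210 * divsum 5 n + 49 * divsum 3 n) - 10 * divsum 1 n.
  have -> : 10 * divsum 1 n = \sum_(p <- factors n) 10 * p.1%:Z ^+ 1 by rewrite /divsum mulr_sumr.
  rewrite L -sum_factors4 mulr_sumr -sumrB.
  rewrite big_seq [RHS]big_seq; apply: eq_bigr => -[d m] /=.
  rewrite mem_factors => /and3P [d0 m0 /eqP <-].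
  rewrite mulrBr (@sum_poly (d%:Z ^+ 6) (- 3 * d%:Z ^+ 5) (6 * d%:Z ^+ 4) (- 7 * d%:Z ^+ 3) (6 * d%:Z ^+ 2)
     (- 3 * d%:Z) 1
    (fun c => (c ^+ 2 + c * (d%:Z - c) + (d%:Z - c) ^+ 2) ^+ 3)) //.
    by rewrite PoszM; ring.
  by move=> a; ring.
have := conv33 n; lia.
Qed.

Lemma pow_expn d i : Nat.pow d i = (d ^ i)%N.
Proof. by elim: i => //= i ->; rewrite expnS. Qed.

Lemma list_sum_big (l : seq nat) : List.list_sum l = (\sum_(x <- l) x)%N.
Proof. by elim: l => [|x l IH] /=; rewrite ?big_nil ?big_cons // -IH. Qed.

Lemma dvdn_modulo d n : (d %| n)%N = Nat.eqb (Nat.modulo n d) 0.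
Proof.
have [->|d0] := posnP d; first by rewrite dvd0n; case: n.
have d0' : d <> 0%N by move=> E; rewrite E in d0.
have E := PeanoNat.Nat.div_mod n d d0'.
have /ltP L := PeanoNat.Nat.mod_upper_bound n d d0'.
rewrite multE plusE mulnC in E.
by rewrite /dvdn {1}E modnMDl modn_small.
Qed.

Lemma sigma_divsum i n : Posz (Defs.sigma i n) = divsum i n.
Proof.
rewrite /Defs.sigma list_sum_big /divsum.
transitivity (\sum_(d <- iota 1 n | (d %| n)%N) d%:Z ^+ i).
  rewrite -[RHS]big_filter.
  have -> : [seq d <- iota 1 n | (d %| n)%N] =
      List.filter (fun d => Nat.eqb (Nat.modulo n d) 0) (List.seq 1 n).
    have -> : List.seq 1 n = iota 1 n by elim: n 1%N => //= n IH m; rewrite IH.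
    elim: (iota 1 n) => //= d l ->.
    by rewrite dvdn_modulo.
  elim: (List.filter _ _) => [|d l IH] /=; first by rewrite !big_nil.
  by rewrite !big_cons PoszD IH pow_expn -[Posz (d ^ i)]natz natrX natz.
rewrite -big_filter.
rewrite -(@sum_bij _ _ (factors n) [seq d <- iota 1 n | (d %| n)%N]
  (fun p => p.1) (fun d => (d, n %/ d)%N) (fun d => d%:Z ^+ i)) //.
- exact: factors_uniq.
- by rewrite filter_uniq ?iota_uniq.
- move=> [d m]; rewrite mem_factors mem_filter mem_iota /= => /and3P [d0 m0 /eqP <-].
  by rewrite dvdn_mulr // mulKn //; split=> //; nia.
- move=> d; rewrite mem_factors mem_filter mem_iota /= => /andP [dn] /andP [d0 dn1].
  by split=> //; rewrite d0 muln_divA // mulKn // eqxx andbT divn_gt0 // dvdn_leq //; lia.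
Qed.

(** Summation over the codivisor n / d instead of d; this is the form in which the coefficients of
    a Lambert series appear. *)
Lemma sigma_codiv i n : Defs.sigma i n =
  List.list_sum (List.map (fun d => if Nat.eqb (Nat.modulo n d) 0 then Nat.pow (Nat.div n d) i else 0%N)
    (List.seq 1 n)).
Proof.
apply: (can_inj absz_nat); rewrite list_sum_big sigma_divsum.
transitivity (\sum_(d <- iota 1 n | (d %| n)%N) (n %/ d)%N%:Z ^+ i); last first.
  have -> : List.seq 1 n = iota 1 n by elim: n 1%N => //= n IH m; rewrite IH.
  rewrite big_mkcond /=; elim: (iota 1 n) => [|d l IH] /=; first by rewrite !big_nil.
  rewrite !big_cons PoszD -IH -dvdn_modulo; congr (_ + _).
  case: ifP => // dn; rewrite pow_expn -[Posz (_ ^ i)]natz natrX natz; congr (Posz _ ^+ _).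
  have [d0|d0] := posnP d; first by rewrite d0 divn0.
  have d0' : d <> 0%N by move=> E; rewrite E in d0.
  have E := PeanoNat.Nat.div_mod n d d0'.
  have /ltP L := PeanoNat.Nat.mod_upper_bound n d d0'.
  rewrite multE plusE mulnC in E.
  by rewrite {1}E divnMDl // divn_small // addn0.
rewrite /divsum -[RHS]big_filter.
rewrite -(@sum_bij _ _ (factors n) [seq d <- iota 1 n | (d %| n)%N]
  (fun p => p.2) (fun d => (n %/ d, d)%N) (fun d => (n %/ d)%N%:Z ^+ i)) //.
- rewrite big_seq [RHS]big_seq; apply: eq_bigr => -[d m]; rewrite mem_factors => /and3P [d0 m0 /eqP <-].
  by rewrite mulnK.
- exact: factors_uniq.
- by rewrite filter_uniq ?iota_uniq.
- move=> [d m]; rewrite mem_factors mem_filter mem_iota /= => /and3P [d0 m0 /eqP <-].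
  by rewrite dvdn_mull // mulnK //; split=> //; nia.
- move=> d; rewrite mem_factors mem_filter mem_iota /= => /andP [dn] /andP [d0 dn1].
  by split=> //; rewrite d0 divnK // eqxx andbT divn_gt0 // dvdn_leq //; lia.
Qed.

(** The shifts by one are those of the coefficients of series indexed from 1, so that convN is a
    coefficient of their Cauchy product. *)
Definition convN (i j N : nat) : nat :=
  List.list_sum (List.map (fun k => Nat.mul (Defs.sigma i k.+1) (Defs.sigma j (Nat.sub N k).+1))
    (List.seq 0 N.+1)).

Lemma convN_conv i j N : Posz (convN i j N) = conv i j N.+2.
Proof.
rewrite /convN list_sum_big.
have -> : List.seq 0 N.+1 = iota 0 N.+1 by elim: N.+1 0%N => //= n IH m; rewrite IH.
transitivity (\sum_(k <- iota 0 N.+1) Posz (Defs.sigma i k.+1 * Defs.sigma j (N - k).+1)).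
  by elim: (iota 0 N.+1) => [|d l IH]; rewrite /= ?big_nil // !big_cons PoszD IH.
rewrite /conv big_add1 [N.+2.-1]/= /index_iota subn0.
rewrite big_seq [RHS]big_seq; apply: eq_bigr => k; rewrite mem_iota => /andP [_ kN].
by rewrite PoszM !sigma_divsum subSS subSn //; lia.
Qed.

Lemma convN11 N : Nat.add (Nat.mul 12 (convN 1 1 N)) (Nat.mul (Nat.mul 6 N.+2) (Defs.sigma 1 N.+2)) =
  Nat.add (Nat.mul 5 (Defs.sigma 3 N.+2)) (Defs.sigma 1 N.+2).
Proof. have := conv11 N.+2; rewrite -!sigma_divsum -convN_conv; nia. Qed.

Lemma convN13 N : Nat.add (Nat.add (Nat.mul 240 (convN 1 3 N)) (Nat.mul (Nat.mul 30 N.+2) (Defs.sigma 3 N.+2)))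
   (Defs.sigma 1 N.+2) =
  Nat.add (Nat.mul 21 (Defs.sigma 5 N.+2)) (Nat.mul 10 (Defs.sigma 3 N.+2)).
Proof. have := conv13 N.+2; rewrite -!sigma_divsum -convN_conv; nia. Qed.

Lemma convN15 N : Nat.add (Nat.mul 504 (convN 1 5 N)) (Nat.mul (Nat.mul 42 N.+2) (Defs.sigma 5 N.+2)) =
  Nat.add (Nat.add (Nat.mul 20 (Defs.sigma 7 N.+2)) (Nat.mul 21 (Defs.sigma 5 N.+2))) (Defs.sigma 1 N.+2).
Proof. have := conv15 N.+2; rewrite -!sigma_divsum -convN_conv; nia. Qed.

Lemma convN33 N : Nat.add (Nat.mul 120 (convN 3 3 N)) (Defs.sigma 3 N.+2) = Defs.sigma 7 N.+2.
Proof. have := conv33 N.+2; rewrite -!sigma_divsum -convN_conv; nia. Qed.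

End DivisorSums.

(** * Absolutely convergent complex series *)

Definition Cabs_conv (a : nat -> C) : Prop := ex_series (fun n => Cmod (a n)).

Lemma Cabs_conv_le (a : nat -> C) (b : nat -> R) :
  (forall n, (Cmod (a n) <= b n)%R) -> ex_series b -> Cabs_conv a.
Proof.
intros H Hb. apply (@ex_series_le R_AbsRing R_CompleteNormedModule _ b); [|exact Hb].
intros n. unfold norm; simpl. unfold abs; simpl.
rewrite Rabs_pos_eq by apply Cmod_ge_0. apply H.
Qed.

Lemma Cabs_conv_Re a : Cabs_conv a -> ex_series (fun n => Rabs (Re (a n))).
Proof.
apply (@ex_series_le R_AbsRing R_CompleteNormedModule).
intros n. unfold norm; simpl. unfold abs; simpl. rewrite Rabs_Rabsolu. apply Re_le_Cmod'.
Qed.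

Lemma Cabs_conv_Im a : Cabs_conv a -> ex_series (fun n => Rabs (Im (a n))).
Proof.
apply (@ex_series_le R_AbsRing R_CompleteNormedModule).
intros n. unfold norm; simpl. unfold abs; simpl. rewrite Rabs_Rabsolu. apply Im_le_Cmod'.
Qed.

Lemma CSeries_ext (a b : nat -> C) : (forall n, a n = b n) -> CSeries a = CSeries b.
Proof.
intros H. unfold CSeries. f_equal; apply Series_ext; intros n; now rewrite H.
Qed.

Lemma CSeries_plus (a b : nat -> C) :
  Cabs_conv a -> Cabs_conv b -> CSeries (fun n => a n + b n) = CSeries a + CSeries b.
Proof.
intros Ha Hb. unfold CSeries. apply injective_projections; simpl.
- rewrite <- Series_plus; [easy| |]; apply ex_series_Rabs; now apply Cabs_conv_Re.
- rewrite <- Series_plus; [easy| |]; apply ex_series_Rabs; now apply Cabs_conv_Im.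
Qed.

Lemma CSeries_scal (c : C) (a : nat -> C) :
  Cabs_conv a -> CSeries (fun n => c * a n) = c * CSeries a.
Proof.
intros Ha.
assert (HR := ex_series_Rabs _ (Cabs_conv_Re _ Ha)).
assert (HI := ex_series_Rabs _ (Cabs_conv_Im _ Ha)).
unfold CSeries. apply injective_projections; simpl.
- rewrite <- !Series_scal_l, <- Series_minus; [easy| |]; now apply (@ex_series_scal R_AbsRing R_NormedModule).
- rewrite <- !Series_scal_l, <- Series_plus; [easy| |]; now apply (@ex_series_scal R_AbsRing R_NormedModule).
Qed.

Lemma Cabs_conv_plus (a b : nat -> C) :
  Cabs_conv a -> Cabs_conv b -> Cabs_conv (fun n => a n + b n).
Proof.
intros Ha Hb. apply Cabs_conv_le with (fun n => (Cmod (a n) + Cmod (b n))%R).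
- intros n. apply Cmod_triangle.
- apply (@ex_series_plus R_AbsRing R_NormedModule _ _ Ha Hb).
Qed.

Lemma Cabs_conv_scal (c : C) (a : nat -> C) :
  Cabs_conv a -> Cabs_conv (fun n => c * a n).
Proof.
intros Ha. apply Cabs_conv_le with (fun n => (Cmod c * Cmod (a n))%R).
- intros n. rewrite Cmod_mult. apply Rle_refl.
- apply (@ex_series_scal R_AbsRing R_NormedModule _ _ Ha).
Qed.

Lemma CSeries_bound (a : nat -> C) :
  Cabs_conv a -> (Cmod (CSeries a) <= 2 * Series (fun n => Cmod (a n)))%R.
Proof.
intros Ha. eapply Rle_trans; [apply Cmod_le_sum|]. unfold CSeries; simpl.
assert (HR : (Rabs (Series (fun n => Re (a n))) <= Series (fun n => Cmod (a n)))%R).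
{ eapply Rle_trans; [apply Series_Rabs, Cabs_conv_Re, Ha|].
  apply Series_le; [|exact Ha]. intros n. split; [apply Rabs_pos|apply Re_le_Cmod']. }
assert (HI : (Rabs (Series (fun n => Im (a n))) <= Series (fun n => Cmod (a n)))%R).
{ eapply Rle_trans; [apply Series_Rabs, Cabs_conv_Im, Ha|].
  apply Series_le; [|exact Ha]. intros n. split; [apply Rabs_pos|apply Im_le_Cmod']. }
lra.
Qed.

Lemma Series_pos (b : nat -> R) : (forall n, (0 <= b n)%R) -> ex_series b -> (0 <= Series b)%R.
Proof.
intros H Hb. replace 0%R with (Series (fun n => (0 * b n)%R)) by (rewrite Series_scal_l; ring).
apply Series_le; [|exact Hb]. intros n. specialize (H n). lra.
Qed.

Lemma CSeries_bound_by (a : nat -> C) (b : nat -> R) :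
  (forall n, (Cmod (a n) <= b n)%R) -> ex_series b -> (Cmod (CSeries a) <= 2 * Series b)%R.
Proof.
intros H Hb. eapply Rle_trans; [apply CSeries_bound, (Cabs_conv_le _ _ H Hb)|].
apply Rmult_le_compat_l; [lra|]. apply Series_le; [|exact Hb].
intros n. split; [apply Cmod_ge_0|apply H].
Qed.

Lemma CSeries_incr (a : nat -> C) :
  Cabs_conv a -> CSeries a = a O + CSeries (fun n => a (S n)).
Proof.
intros Ha. unfold CSeries. apply injective_projections; simpl; apply Series_incr_1;
  apply ex_series_Rabs; [now apply Cabs_conv_Re|now apply Cabs_conv_Im].
Qed.

Fixpoint Csum (a : nat -> C) (n : nat) : C :=
  match n with O => a O | S m => Csum a m + a (S m) end.

Lemma Csum_Re a n : Re (Csum a n) = sum_f_R0 (fun k => Re (a k)) n.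
Proof. induction n as [|n IH]; simpl; [easy|]. now rewrite <- IH. Qed.

Lemma Csum_Im a n : Im (Csum a n) = sum_f_R0 (fun k => Im (a k)) n.
Proof. induction n as [|n IH]; simpl; [easy|]. now rewrite <- IH. Qed.

Lemma sum_f_R0_minus f g n :
  sum_f_R0 (fun k => (f k - g k)%R) n = (sum_f_R0 f n - sum_f_R0 g n)%R.
Proof. induction n as [|n IH]; simpl; [easy|]. rewrite IH. ring. Qed.

(** The Cauchy product theorem for the four products of real and imaginary parts. *)
Lemma CSeries_mult (a b : nat -> C) :
  Cabs_conv a -> Cabs_conv b ->
  CSeries a * CSeries b = CSeries (fun n => Csum (fun k => a k * b (n - k)%nat) n).
Proof.
intros Ha Hb.
assert (M : forall f h : nat -> R, ex_series (fun n => Rabs (f n)) ->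
  ex_series (fun n => Rabs (h n)) ->
  is_series (fun n => sum_f_R0 (fun k => (f k * h (n - k)%nat)%R) n) (Series f * Series h)%R).
{ intros f h Hf Hh. apply is_series_mult; auto; apply Series_correct; now apply ex_series_Rabs. }
assert (aR := Cabs_conv_Re _ Ha). assert (aI := Cabs_conv_Im _ Ha).
assert (bR := Cabs_conv_Re _ Hb). assert (bI := Cabs_conv_Im _ Hb).
unfold CSeries. apply injective_projections; simpl; symmetry; apply is_series_unique.
- eapply is_series_ext; [|exact (@is_series_minus R_AbsRing R_NormedModule _ _ _ _ (M _ _ aR bR) (M _ _ aI bI))].
  intros n. rewrite Csum_Re. unfold plus, opp; simpl.
  change (sum_f_R0 (fun k => (Re (a k) * Re (b (n - k)%nat))%R) n - 
    sum_f_R0 (fun k => (Im (a k) * Im (b (n - k)%nat))%R) n =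
    sum_f_R0 (fun k => Re (a k * b (n - k)%nat)) n)%R.
  rewrite <- sum_f_R0_minus. apply sum_eq. intros; reflexivity.
- eapply is_series_ext; [|exact (@is_series_plus R_AbsRing R_NormedModule _ _ _ _ (M _ _ aR bI) (M _ _ aI bR))].
  intros n. rewrite Csum_Im.
  change (sum_f_R0 (fun k => (Re (a k) * Im (b (n - k)%nat))%R) n + 
    sum_f_R0 (fun k => (Im (a k) * Re (b (n - k)%nat))%R) n =
    sum_f_R0 (fun k => Im (a k * b (n - k)%nat)) n)%R.
  rewrite <- plus_sum. apply sum_eq. intros; reflexivity.
Qed.

(** * Power series with coefficients of polynomial growth *)

Definition poly_growth (a : nat -> R) : Prop :=
  exists (K : R) (p : nat), forall n, (Rabs (a n) <= K * INR (S n) ^ p)%R.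

Lemma INR_S_ge1 n : (1 <= INR (S n))%R.
Proof. rewrite S_INR. pose proof (pos_INR n). lra. Qed.

Lemma poly_growth_K (a : nat -> R) : poly_growth a -> exists (K : R) (p : nat), (0 <= K)%R /\
   forall n, (Rabs (a n) <= K * INR (S n) ^ p)%R.
Proof.
intros [K [p H]]. exists K, p. split; [|exact H].
specialize (H O). simpl in H. rewrite pow1 in H. pose proof (Rabs_pos (a O)). lra.
Qed.

Lemma poly_growth_plus a b : poly_growth a -> poly_growth b -> poly_growth (fun n => (a n + b n)%R).
Proof.
intros Ha Hb. destruct (poly_growth_K _ Ha) as [K [p [K0 H]]].
destruct (poly_growth_K _ Hb) as [L [r [L0 H']]].
exists (K + L)%R, (p + r)%nat. intros n. eapply Rle_trans; [apply Rabs_triang|].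
specialize (H n). specialize (H' n). pose proof (INR_S_ge1 n) as G.
assert (G1 := pow_R1_Rle _ p G). assert (G2 := pow_R1_Rle _ r G).
rewrite pow_add. set (x := (INR (S n) ^ p)%R) in *. set (y := (INR (S n) ^ r)%R) in *.
assert (K * x <= K * (x * y))%R by (apply Rmult_le_compat_l; nra).
assert (L * y <= L * (x * y))%R by (apply Rmult_le_compat_l; nra).
lra.
Qed.

Lemma poly_growth_scal c a : poly_growth a -> poly_growth (fun n => (c * a n)%R).
Proof.
intros [K [p H]]. exists (Rabs c * K)%R, p. intros n. rewrite Rabs_mult, Rmult_assoc.
apply Rmult_le_compat_l; [apply Rabs_pos|apply H].
Qed.

Lemma poly_growth_mulS a : poly_growth a -> poly_growth (fun n => (INR (S n) * a n)%R).
Proof.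
intros [K [p H]]. exists K, (S p). intros n. rewrite Rabs_mult, Rabs_pos_eq by apply pos_INR.
replace (K * INR (S n) ^ S p)%R with (INR (S n) * (K * INR (S n) ^ p))%R by (simpl; ring).
apply Rmult_le_compat_l; [apply pos_INR|apply H].
Qed.

Lemma ex_series_pow_geom (p : nat) (r : R) :
  (0 <= r < 1)%R -> ex_series (fun n => (INR (S n) ^ p * r ^ S n)%R).
Proof.
intros [Hr0 Hr1].
destruct (Req_dec r 0) as [->|Hr].
{ apply ex_series_ext with (fun _ => 0%R); [intros n; simpl; ring|].
  exists 0%R.
  apply filterlim_ext with (fun _ => 0%R); [|apply filterlim_const].
  intros n. symmetry. rewrite sum_n_const. ring. }
apply (ex_series_ext (fun n => Rabs (INR (S n) ^ p * r ^ S n))).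
{ intros n. apply Rabs_pos_eq. apply Rmult_le_pos; apply pow_le; [apply pos_INR|lra]. }
apply ex_series_DAlembert with r; [lra| |].
- intros n. apply Rmult_integral_contrapositive_currified; apply pow_nonzero; [|lra].
  apply not_0_INR. lia.
- apply is_lim_seq_ext with (fun n => ((1 + / INR (S n)) ^ p * r)%R).
  + intros n. assert (0 < INR (S n))%R by (apply lt_0_INR; lia).
    assert (E : (INR (S (S n)) = INR (S n) * (1 + / INR (S n)))%R).
    { rewrite (S_INR (S n)). field. lra. }
    rewrite E, Rpow_mult_distr.
    assert (0 < / INR (S n))%R by (now apply Rinv_0_lt_compat).
    replace (r ^ S (S n))%R with (r ^ S n * r)%R by (simpl; ring).
    assert (INR (S n) ^ p <> 0)%R by (apply pow_nonzero; lra).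
    assert (r ^ S n <> 0)%R by (apply pow_nonzero; lra).
    rewrite Rabs_pos_eq; [field; auto|].
    replace (INR (S n) ^ p * (1 + / INR (S n)) ^ p * (r ^ S n * r) / (INR (S n) ^ p * r ^ S n))%R
      with ((1 + / INR (S n)) ^ p * r)%R by (field; auto).
    apply Rmult_le_pos; [|lra]. apply pow_le. lra.
  + replace (Finite r) with (Finite ((1 + 0) ^ p * r)%R) by (rewrite Rplus_0_r, pow1; f_equal; ring).
    apply is_lim_seq_mult'; [|apply is_lim_seq_const].
    assert (L : is_lim_seq (fun n => (1 + / INR (S n))%R) (1 + 0)%R).
    { apply is_lim_seq_plus'; [apply is_lim_seq_const|].
      apply (is_lim_seq_incr_1 (fun n => (/ INR n)%R)).
      replace (Finite 0) with (Rbar_inv p_infty) by reflexivity.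
      apply is_lim_seq_inv; [apply is_lim_seq_INR|easy]. }
    clear - L. induction p as [|p IH]; simpl; [apply is_lim_seq_const|].
    now apply is_lim_seq_mult'.
Qed.

(** A q-series without constant term: the coefficient of index m belongs to q^(m + 1), as in the
    definition of g. *)
Definition qs (a : nat -> R) (q : C) : C := CSeries (fun m => RtoC (a m) * q ^ S m).

Lemma qs_conv_bound a r : poly_growth a -> (0 <= r < 1)%R ->
  ex_series (fun m => (Rabs (a m) * r ^ S m)%R).
Proof.
intros [K [p H]] Hr.
apply (@ex_series_le R_AbsRing R_CompleteNormedModule _ (fun m => (K * (INR (S m) ^ p * r ^ S m))%R)).
- intros n. unfold norm; simpl norm. unfold abs; simpl abs.
  assert (0 <= r ^ S n)%R by (apply pow_le; lra).
  rewrite Rabs_mult, Rabs_Rabsolu, (Rabs_pos_eq (r ^ S n)) by assumption.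
  rewrite <- Rmult_assoc. now apply Rmult_le_compat_r.
- apply (@ex_series_scal R_AbsRing R_NormedModule). now apply ex_series_pow_geom.
Qed.

Lemma qs_conv a q : poly_growth a -> (Cmod q < 1)%R -> Cabs_conv (fun m => RtoC (a m) * q ^ S m).
Proof.
intros Ha Hq. apply Cabs_conv_le with (fun m => (Rabs (a m) * Cmod q ^ S m)%R).
- intros n. rewrite Cmod_mult, Cmod_R, Cmod_pow. apply Rle_refl.
- apply qs_conv_bound; [exact Ha|]. split; [apply Cmod_ge_0|exact Hq].
Qed.

Lemma qs_plus a b q : poly_growth a -> poly_growth b -> (Cmod q < 1)%R ->
  qs (fun n => (a n + b n)%R) q = qs a q + qs b q.
Proof.
intros Ha Hb Hq. unfold qs. rewrite <- CSeries_plus by now apply qs_conv.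
apply CSeries_ext. intros n. rewrite RtoC_plus. ring.
Qed.

Lemma qs_scal c a q : poly_growth a -> (Cmod q < 1)%R ->
  qs (fun n => (c * a n)%R) q = RtoC c * qs a q.
Proof.
intros Ha Hq. unfold qs. rewrite <- CSeries_scal by now apply qs_conv.
apply CSeries_ext. intros n. rewrite RtoC_mult. ring.
Qed.

Lemma qs_ext a b q : (forall n, a n = b n) -> qs a q = qs b q.
Proof. intros H. unfold qs. apply CSeries_ext. intros n. now rewrite H. Qed.

(** The factor rho^2 stands on the left to avoid the exponent n - 1 on the right. *)
Lemma pow_taylor (q h : C) (rho : R) (n : nat) :
  (0 < rho)%R -> (Cmod q <= rho)%R -> (Cmod (q + h) <= rho)%R ->
  (Cmod ((q + h) ^ S n - q ^ S n - RtoC (INR (S n)) * q ^ n * h) * rho ^ 2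
    <= INR (S n) ^ 2 * rho ^ S n * Cmod h ^ 2)%R.
Proof.
intros H0 Hq Hqh. pose proof (Cmod_ge_0 h) as Hh.
induction n as [|n IH].
- simpl (INR 1). replace ((q + h) ^ 1 - q ^ 1 - 1 * q ^ 0 * h) with (RtoC 0) by (simpl; ring).
  rewrite Cmod_0, Rmult_0_l. simpl. apply Rmult_le_pos; nra.
- replace ((q + h) ^ S (S n) - q ^ S (S n) - RtoC (INR (S (S n))) * q ^ S n * h)
   with ((q + h) * ((q + h) ^ S n - q ^ S n - RtoC (INR (S n)) * q ^ n * h)
     + RtoC (INR (S n)) * q ^ n * h * h).
  2:{ rewrite (S_INR (S n)), RtoC_plus. simpl. ring. }
  set (E := (q + h) ^ S n - q ^ S n - RtoC (INR (S n)) * q ^ n * h) in *.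
  apply Rle_trans with ((Cmod (q + h) * Cmod E + Cmod (RtoC (INR (S n)) * q ^ n * h * h)) * rho ^ 2)%R.
  { apply Rmult_le_compat_r; [nra|]. rewrite <- Cmod_mult. apply Cmod_triangle. }
  rewrite !Cmod_mult, Cmod_R, Cmod_pow, Rabs_pos_eq by apply pos_INR.
  assert (A : (Cmod (q + h) * Cmod E * rho ^ 2 <= rho * (INR (S n) ^ 2 * rho ^ S n * Cmod h ^ 2))%R).
  { rewrite Rmult_assoc. apply Rmult_le_compat; auto using Cmod_ge_0.
    apply Rmult_le_pos; [apply Cmod_ge_0|nra]. }
  assert (B : (Cmod q ^ n <= rho ^ n)%R) by (apply pow_incr; split; [apply Cmod_ge_0|lra]).
  assert (P : (0 <= rho ^ n)%R) by (apply pow_le; lra).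
  assert (B2 : (INR (S n) * Cmod q ^ n * Cmod h * Cmod h * rho ^ 2 <=
     INR (S n) * (rho ^ n * rho ^ 2) * Cmod h ^ 2)%R).
  { replace (INR (S n) * Cmod q ^ n * Cmod h * Cmod h * rho ^ 2)%R with
      ((INR (S n) * rho ^ 2 * Cmod h ^ 2) * Cmod q ^ n)%R by ring.
    replace (INR (S n) * (rho ^ n * rho ^ 2) * Cmod h ^ 2)%R with
      ((INR (S n) * rho ^ 2 * Cmod h ^ 2) * rho ^ n)%R by ring.
    apply Rmult_le_compat_l; [|exact B].
    apply Rmult_le_pos; [apply Rmult_le_pos; [apply pos_INR|nra]|nra]. }
  rewrite Rmult_plus_distr_r. eapply Rle_trans; [apply Rplus_le_compat; [exact A|exact B2]|].
  rewrite (S_INR (S n)). set (N := INR (S n)).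
  assert (HN : (0 <= N)%R) by apply pos_INR.
  replace (rho * (N ^ 2 * rho ^ S n * Cmod h ^ 2) + N * (rho ^ n * rho ^ 2) * Cmod h ^ 2)%R
    with ((rho ^ S (S n) * Cmod h ^ 2) * (N ^ 2 + N))%R by (simpl; ring).
  replace ((N + 1) ^ 2 * rho ^ S (S n) * Cmod h ^ 2)%R
    with ((rho ^ S (S n) * Cmod h ^ 2) * (N + 1) ^ 2)%R by ring.
  apply Rmult_le_compat_l; [|nra].
  apply Rmult_le_pos; [apply pow_le; lra|nra].
Qed.

(** Termwise differentiation: the sum of the second order remainders is dominated by |h|^2 times a
    convergent series, taken at a radius rho between |q| and 1. *)
Lemma Cderiv_qs a q : poly_growth a -> (Cmod q < 1)%R ->
  Cderiv (qs a) q (CSeries (fun m => RtoC (INR (S m) * a m) * q ^ m)).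
Proof.
intros Ha Hq. set (rho := ((1 + Cmod q) / 2)%R). pose proof (Cmod_ge_0 q) as Hq0.
assert (Hr : (0 < rho < 1)%R) by (unfold rho; lra).
set (b := fun m => (Rabs (INR (S m) * (INR (S m) * a m)) * rho ^ S m)%R).
assert (Hb : ex_series b).
{ apply qs_conv_bound; [|lra]. now do 2 apply poly_growth_mulS. }
set (B := (2 * Series b / rho ^ 2)%R).
assert (HB : (0 <= B)%R).
{ unfold B. apply Rmult_le_pos; [|apply Rlt_le, Rinv_0_lt_compat; nra].
  apply Rmult_le_pos; [lra|].
  apply Series_pos; [|exact Hb]. intros n. unfold b.
  apply Rmult_le_pos; [apply Rabs_pos|apply pow_le; lra]. }
assert (HD : Cabs_conv (fun m => RtoC (INR (S m) * a m) * q ^ m)).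
{ apply Cabs_conv_le with (fun m => (Rabs (INR (S m) * a m) * rho ^ S m * / rho)%R).
  - intros n. rewrite Cmod_mult, Cmod_R, Cmod_pow.
    replace (Rabs (INR (S n) * a n) * rho ^ S n * / rho)%R with (Rabs (INR (S n) * a n) * rho ^ n)%R
      by (simpl; field; lra).
    apply Rmult_le_compat_l; [apply Rabs_pos|]. apply pow_incr. unfold rho; lra.
  - eapply ex_series_ext; [|apply (@ex_series_scal R_AbsRing R_NormedModule (/ rho)%R);
      apply (qs_conv_bound (fun m => (INR (S m) * a m)%R) rho); [now apply poly_growth_mulS|lra]].
    intros n. unfold scal; simpl. unfold mult; simpl. ring. }
apply Cderiv_eps. intros eps He.
assert (Hd : (0 < rho - Cmod q)%R) by (unfold rho; lra).
assert (He' : (0 < eps / (B + 1))%R) by (apply Rdiv_lt_0_compat; lra).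
generalize (near0_and _ _ (near0_lt _ Hd) (near0_lt _ He')). apply near0_imp.
intros h [H1 H2].
assert (Hqh : (Cmod (q + h) <= rho)%R) by (pose proof (Cmod_triangle q h); lra).
unfold qs. set (D := fun m => RtoC (INR (S m) * a m) * q ^ m).
replace (CSeries (fun m => RtoC (a m) * (q + h) ^ S m) - CSeries (fun m => RtoC (a m) * q ^ S m) - CSeries D * h)
  with (CSeries (fun m => RtoC (a m) * ((q + h) ^ S m - q ^ S m - RtoC (INR (S m)) * q ^ m * h))).
2:{ assert (C1 : Cabs_conv (fun m => RtoC (a m) * (q + h) ^ S m)) by (apply qs_conv; [exact Ha|lra]).
  assert (C2 : Cabs_conv (fun m => RtoC (a m) * q ^ S m)) by (apply qs_conv; [exact Ha|lra]).
  replace (CSeries (fun m => RtoC (a m) * (q + h) ^ S m) - CSeries (fun m => RtoC (a m) * q ^ S m) - CSeries D * h)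
   with (CSeries (fun m => RtoC (a m) * (q + h) ^ S m) + ((- (1)) * CSeries (fun m => RtoC (a m) * q ^ S m) + (- h) * CSeries D))
   by ring.
  rewrite <- !CSeries_scal by assumption. rewrite <- !CSeries_plus; auto using Cabs_conv_plus, Cabs_conv_scal.
  apply CSeries_ext. intros n. unfold D. rewrite RtoC_mult. ring. }
assert (Bd : (Cmod (CSeries (fun m => RtoC (a m) * ((q + h) ^ S m - q ^ S m - RtoC (INR (S m)) * q ^ m * h))%C)
  <= 2 * Series (fun m => Cmod h ^ 2 / rho ^ 2 * b m))%R).
{ apply CSeries_bound_by.
  - intros n. rewrite Cmod_mult, Cmod_R. unfold b. rewrite Rabs_mult, Rabs_mult.
    rewrite !(Rabs_pos_eq (INR (S n))) by apply pos_INR.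
    assert (T := pow_taylor q h rho n (proj1 Hr) ltac:(unfold rho; lra) Hqh).
    set (E := Cmod ((q + h) ^ S n - q ^ S n - RtoC (INR (S n)) * q ^ n * h)) in *.
    assert (P2 : (0 < rho ^ 2)%R) by nra.
    apply Rmult_le_reg_r with (rho ^ 2)%R; [exact P2|].
    replace (Cmod h ^ 2 / rho ^ 2 * (INR (S n) * (INR (S n) * Rabs (a n)) * rho ^ S n) * rho ^ 2)%R
      with (Rabs (a n) * (INR (S n) ^ 2 * rho ^ S n * Cmod h ^ 2))%R by (field; lra).
    rewrite Rmult_assoc. apply Rmult_le_compat_l; [apply Rabs_pos|exact T].
  - apply (@ex_series_scal R_AbsRing R_NormedModule). exact Hb. }
rewrite Series_scal_l in Bd.
replace (2 * (Cmod h ^ 2 / rho ^ 2 * Series b))%R with (B * Cmod h * Cmod h)%R in Bd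
  by (unfold B; field; lra).
eapply Rle_trans; [exact Bd|]. apply Rmult_le_compat_r; [apply Cmod_ge_0|].
assert (P := Cmod_ge_0 h).
apply Rmult_lt_compat_r with (r := (B + 1)%R) in H2; [|lra].
replace (eps / (B + 1) * (B + 1))%R with eps in H2 by (field; lra). nra.
Qed.

Lemma Csum_S a n : Csum a (S n) = Csum a n + a (S n).
Proof. reflexivity. Qed.

Lemma qs_mult (a b c : nat -> R) (q : C) :
  poly_growth a -> poly_growth b -> poly_growth c -> (Cmod q < 1)%R ->
  c O = 0%R ->
  (forall n, c (S n) = sum_f_R0 (fun k => (a k * b (n - k)%nat)%R) n) ->
  qs a q * qs b q = qs c q.
Proof.
intros Ha Hb Hc Hq H0 HS. unfold qs.
rewrite CSeries_mult by now apply qs_conv.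
rewrite (CSeries_incr (fun m => RtoC (c m) * q ^ S m)) by now apply qs_conv.
rewrite H0. replace (RtoC 0 * q ^ 1) with (RtoC 0) by ring. rewrite Cplus_0_l.
apply CSeries_ext. intros n. rewrite HS.
assert (G : forall N, (N <= n)%nat ->
  Csum (fun k => RtoC (a k) * q ^ S k * (RtoC (b (n - k)%nat) * q ^ S (n - k))) N =
  RtoC (sum_f_R0 (fun k => (a k * b (n - k)%nat)%R) N) * q ^ S (S n)).
{ intros N. induction N as [|N IH]; intros HN.
  - simpl sum_f_R0. simpl Csum. rewrite Nat.sub_0_r, RtoC_mult. simpl. ring.
  - rewrite Csum_S, IH by lia. rewrite tech5. rewrite RtoC_plus, RtoC_mult.
    replace (q ^ S (S n)) with (q ^ (S (S N)) * q ^ S (n - S N))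
      by (rewrite <- Cpow_add_r; f_equal; lia).
    simpl. ring. }
apply G. lia.
Qed.

Lemma qs_bound (a : nat -> R) (r : R) :
  poly_growth a -> (0 < r < 1)%R -> exists M : R, (0 <= M)%R /\
    forall q : C, (Cmod q <= r)%R -> (Cmod (qs a q) <= M * Cmod q)%R.
Proof.
intros Ha Hr. assert (H := qs_conv_bound a r Ha ltac:(lra)).
exists (2 * Series (fun m => Rabs (a m) * r ^ S m) / r)%R. split.
- apply Rmult_le_pos; [|apply Rlt_le, Rinv_0_lt_compat; lra].
  apply Rmult_le_pos; [lra|]. apply Series_pos; [|exact H].
  intros n. apply Rmult_le_pos; [apply Rabs_pos|apply pow_le; lra].
- intros q Hq. pose proof (Cmod_ge_0 q).
  eapply Rle_trans.
  { unfold qs. apply (CSeries_bound_by _ (fun m => Cmod q / r * (Rabs (a m) * r ^ S m)))%R.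
    - intros n. rewrite Cmod_mult, Cmod_R, Cmod_pow.
      replace (Cmod q / r * (Rabs (a n) * r ^ S n))%R with (Rabs (a n) * (Cmod q * r ^ n))%R
        by (simpl; field; lra).
      apply Rmult_le_compat_l; [apply Rabs_pos|]. simpl.
      apply Rmult_le_compat_l; [exact H0|]. apply pow_incr. lra.
    - apply (@ex_series_scal R_AbsRing R_NormedModule). exact H. }
  rewrite Series_scal_l. apply Req_le. field. lra.
Qed.

Lemma qs_first (a : nat -> R) (q : C) :
  poly_growth a -> (Cmod q < 1)%R ->
  qs a q = RtoC (a O) * q + q * qs (fun n => a (S n)) q.
Proof.
intros Ha Hq. unfold qs. rewrite CSeries_incr by now apply qs_conv.
f_equal; [simpl; ring|].
rewrite <- CSeries_scal.
- apply CSeries_ext. intros n. simpl. ring.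
- apply qs_conv; [|exact Hq]. destruct (poly_growth_K _ Ha) as [K [p [K0 H]]].
  exists (K * 2 ^ p)%R, p. intros n. eapply Rle_trans; [apply H|].
  rewrite Rmult_assoc, <- Rpow_mult_distr.
  apply Rmult_le_compat_l; [exact K0|]. apply pow_incr. split; [apply pos_INR|].
  rewrite (S_INR (S n)). pose proof (INR_S_ge1 n). lra.
Qed.

(** * Divisor sums *)

(** Divisor sums as coefficients of [qs]. *)
Definition sigma_seq (i : nat) : nat -> R := fun m => INR (sigma i (S m)).

Lemma sigma_le i n : (sigma i n <= n * n ^ i)%nat.
Proof.
unfold sigma.
assert (H : forall l, (forall d, In d l -> (d <= n)%nat) ->
   (list_sum (map (fun d => d ^ i) l) <= length l * n ^ i)%nat).
{ induction l as [|d l IH]; intros Hl; simpl; [lia|].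
  assert (d ^ i <= n ^ i)%nat by (apply Nat.pow_le_mono_l, Hl; now left).
  assert (list_sum (map (fun d => d ^ i) l) <= length l * n ^ i)%nat
    by (apply IH; intros; apply Hl; now right).
  lia. }
eapply Nat.le_trans; [apply H|].
- intros d Hd. apply filter_In in Hd. destruct Hd as [Hd _]. apply in_seq in Hd. lia.
- apply Nat.mul_le_mono_r. eapply Nat.le_trans; [apply filter_length_le|].
  now rewrite length_seq.
Qed.

Lemma sigma_seq_growth i : poly_growth (sigma_seq i).
Proof.
exists 1%R, (S i). intros n. unfold sigma_seq. rewrite Rabs_pos_eq by apply pos_INR.
rewrite Rmult_1_l, <- pow_INR. apply le_INR. simpl. apply (sigma_le i (S n)).
Qed.

Lemma sigma_seq_0 i : sigma_seq i O = 1%R.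
Proof. unfold sigma_seq, sigma. simpl. rewrite Nat.pow_1_l. reflexivity. Qed.

Definition n_sigma_seq (i : nat) : nat -> R := fun m => (INR (S m) * sigma_seq i m)%R.

Lemma n_sigma_seq_growth i : poly_growth (n_sigma_seq i).
Proof. apply poly_growth_mulS, sigma_seq_growth. Qed.

(** The Cauchy product of two series without constant term starts at q^2, whence the value 0 at
    index 0. *)
Definition sigma_conv (i j m : nat) : R := match m with O => 0%R | S N => INR (DivisorSums.convN i j N) end.

Lemma sigma_conv_S i j n : sigma_conv i j (S n) = sum_f_R0 (fun k => (sigma_seq i k * sigma_seq j (n - k)%nat)%R) n.
Proof.
unfold sigma_conv, DivisorSums.convN, sigma_seq.
assert (G : forall N, INR (list_sum (map (fun k => (sigma i (S k) * sigma j (S (n - k)))%nat) (seq 0 (S N))))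
  = sum_f_R0 (fun k => (INR (sigma i (S k)) * INR (sigma j (S (n - k))))%R) N).
{ induction N as [|N IH].
  - simpl. now rewrite Nat.add_0_r, mult_INR.
  - rewrite seq_S, map_app, list_sum_app, plus_INR, IH. simpl.
    now rewrite Nat.add_0_r, mult_INR. }
apply G.
Qed.

Lemma sigma_conv11 m : sigma_conv 1 1 m = (5 / 12 * sigma_seq 3 m + (1 / 12 * sigma_seq 1 m + - (1 / 2) * n_sigma_seq 1 m))%R.
Proof.
unfold n_sigma_seq. destruct m as [|N].
- rewrite !sigma_seq_0. simpl. field.
- assert (H := DivisorSums.convN11 N). apply (f_equal INR) in H.
  rewrite !plus_INR, !mult_INR in H. unfold sigma_conv, sigma_seq in *.
  rewrite (INR_IZR_INZ 12), (INR_IZR_INZ 6), (INR_IZR_INZ 5) in H. simpl IZR in H. lra.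
Qed.

Lemma sigma_conv13 m : sigma_conv 1 3 m =
  (21 / 240 * sigma_seq 5 m + (10 / 240 * sigma_seq 3 m + (- (1 / 240) * sigma_seq 1 m + - (30 / 240) * n_sigma_seq 3 m)))%R.
Proof.
unfold n_sigma_seq. destruct m as [|N].
- rewrite !sigma_seq_0. simpl. field.
- assert (H := DivisorSums.convN13 N). apply (f_equal INR) in H.
  rewrite !plus_INR, !mult_INR in H. unfold sigma_conv, sigma_seq in *.
  rewrite (INR_IZR_INZ 240), (INR_IZR_INZ 30), (INR_IZR_INZ 21), (INR_IZR_INZ 10) in H. simpl IZR in H. lra.
Qed.

Lemma sigma_conv15 m : sigma_conv 1 5 m =
  (20 / 504 * sigma_seq 7 m + (21 / 504 * sigma_seq 5 m + (1 / 504 * sigma_seq 1 m + - (42 / 504) * n_sigma_seq 5 m)))%R.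
Proof.
unfold n_sigma_seq. destruct m as [|N].
- rewrite !sigma_seq_0. simpl. field.
- assert (H := DivisorSums.convN15 N). apply (f_equal INR) in H.
  rewrite !plus_INR, !mult_INR in H. unfold sigma_conv, sigma_seq in *.
  rewrite (INR_IZR_INZ 504), (INR_IZR_INZ 42), (INR_IZR_INZ 21), (INR_IZR_INZ 20) in H. simpl IZR in H. lra.
Qed.

Lemma sigma_conv33 m : sigma_conv 3 3 m = (1 / 120 * sigma_seq 7 m + - (1 / 120) * sigma_seq 3 m)%R.
Proof.
destruct m as [|N].
- rewrite !sigma_seq_0. simpl. field.
- assert (H := DivisorSums.convN33 N). apply (f_equal INR) in H.
  rewrite !plus_INR, !mult_INR in H. unfold sigma_conv, sigma_seq in *.
  rewrite (INR_IZR_INZ 120) in H. simpl IZR in H. lra.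
Qed.

Lemma qs_sigma_prod i j c q : (Cmod q < 1)%R -> (forall m, sigma_conv i j m = c m) -> poly_growth c ->
  qs (sigma_seq i) q * qs (sigma_seq j) q = qs c q.
Proof.
intros Hq H Hc. apply qs_mult; auto using sigma_seq_growth.
- now rewrite <- H.
- intros n. rewrite <- H. apply sigma_conv_S.
Qed.

Ltac growth := repeat first [apply poly_growth_plus | apply poly_growth_scal | apply sigma_seq_growth | apply n_sigma_seq_growth].
Ltac expand_qs := repeat (first [rewrite qs_plus; [|growth; fail|growth; fail|assumption]
  | rewrite qs_scal; [|growth; fail|assumption]]).

Ltac Cnz := repeat split; try (apply Rgt_not_eq; lra); try (let E := fresh in intros E; apply RtoC_inj in E; lra).

Lemma qs_sigma_prod11 q : (Cmod q < 1)%R ->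
  12 * (qs (sigma_seq 1) q * qs (sigma_seq 1) q) = 5 * qs (sigma_seq 3) q + qs (sigma_seq 1) q - 6 * qs (n_sigma_seq 1) q.
Proof.
intros Hq. rewrite (qs_sigma_prod 1 1 _ q Hq sigma_conv11) by growth. expand_qs.
rewrite !RtoC_opp, !RtoC_div. field; Cnz. all: Cnz.
Qed.

Lemma qs_sigma_prod13 q : (Cmod q < 1)%R ->
  240 * (qs (sigma_seq 1) q * qs (sigma_seq 3) q) = 21 * qs (sigma_seq 5) q + 10 * qs (sigma_seq 3) q - qs (sigma_seq 1) q
    - 30 * qs (n_sigma_seq 3) q.
Proof.
intros Hq. rewrite (qs_sigma_prod 1 3 _ q Hq sigma_conv13) by growth. expand_qs.
rewrite !RtoC_opp, !RtoC_div. field; Cnz. all: Cnz.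
Qed.

Lemma qs_sigma_prod15 q : (Cmod q < 1)%R ->
  504 * (qs (sigma_seq 1) q * qs (sigma_seq 5) q) = 20 * qs (sigma_seq 7) q + 21 * qs (sigma_seq 5) q + qs (sigma_seq 1) q
    - 42 * qs (n_sigma_seq 5) q.
Proof.
intros Hq. rewrite (qs_sigma_prod 1 5 _ q Hq sigma_conv15) by growth. expand_qs.
rewrite !RtoC_opp, !RtoC_div. field; Cnz. all: Cnz.
Qed.

Lemma qs_sigma_prod33 q : (Cmod q < 1)%R ->
  120 * (qs (sigma_seq 3) q * qs (sigma_seq 3) q) = qs (sigma_seq 7) q - qs (sigma_seq 3) q.
Proof.
intros Hq. rewrite (qs_sigma_prod 3 3 _ q Hq sigma_conv33) by growth. expand_qs.
rewrite !RtoC_opp, !RtoC_div. field; Cnz. all: Cnz.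
Qed.

(** * The functions g_k and Ramanujan's differential equations *)

Definition nome (z : C) : C := Cexp (2 * PI * Ci * z).

Lemma Cmod_nome z : Cmod (nome z) = exp (- (2 * PI * Im z)).
Proof.
unfold nome. rewrite Cmod_Cexp. f_equal. destruct z as [x y]. simpl. ring.
Qed.

Lemma nome_lt_1 z : UpperHalfPlane z -> (Cmod (nome z) < 1)%R.
Proof.
intros Hz. rewrite Cmod_nome, <- exp_0. apply exp_increasing.
unfold UpperHalfPlane in Hz. pose proof PI_RGT_0. nra.
Qed.

Lemma Cderiv_nome z : Cderiv nome z (2 * PI * Ci * nome z).
Proof.
unfold nome. eapply Cderiv_val.
- apply (Cderiv_comp Cexp (fun z => 2 * PI * Ci * z)); [apply Cderiv_Cexp|].
  apply Cderiv_mult; [apply Cderiv_const|apply Cderiv_id].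
- cbv beta. ring.
Qed.

(** The constant a_1 of the three g_k; the other two are 12 A0^2 and 8 A0^3, and derivation with
    respect to z is 12 A0 times q d/dq. *)
Definition A0 : C := 2 * PI * Ci / 12.

Lemma A0_neq_0 : A0 <> 0.
Proof.
unfold A0. intros E. apply (f_equal Im) in E. simpl in E. pose proof PI_RGT_0.
field_simplify in E. lra.
Qed.

Lemma Cderiv_qs_nome a z : poly_growth a -> UpperHalfPlane z ->
  Cderiv (fun z => qs a (nome z)) z (12 * A0 * qs (fun m => (INR (S m) * a m)%R) (nome z)).
Proof.
intros Ha Hz. assert (Hq := nome_lt_1 z Hz). eapply Cderiv_val.
- apply (Cderiv_comp (qs a) nome); [now apply Cderiv_qs|apply Cderiv_nome].
- unfold qs. set (q := nome z) in *.
  assert (E : CSeries (fun m => RtoC (INR (S m) * a m) * q ^ S m) =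
     q * CSeries (fun m => RtoC (INR (S m) * a m) * q ^ m)).
  { rewrite <- CSeries_scal.
    - apply CSeries_ext. intros n. simpl. ring.
    - destruct (Ceq_dec q 0) as [Eq|Nq].
      + rewrite Eq. exfalso. now apply (Cexp_neq_0 (2 * PI * Ci * z)).
      + assert (X : Cabs_conv (fun m => / q * (RtoC (INR (S m) * a m) * q ^ S m))).
        { apply Cabs_conv_scal, (qs_conv (fun m => (INR (S m) * a m)%R)); [now apply poly_growth_mulS|exact Hq]. }
        eapply ex_series_ext; [|exact X]. intros n. cbv beta. f_equal. change (q ^ S n) with (q * q ^ n). field. exact Nq. }
  rewrite E. unfold A0. field.
Qed.

Lemma g_series i z : CSeries (fun m => RtoC (INR (sigma i (S m))) * Cexp (2 * PI * Ci * z * RtoC (INR (S m))))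
  = qs (sigma_seq i) (nome z).
Proof. unfold qs, nome, sigma_seq. apply CSeries_ext. intros n. now rewrite Cexp_nat. Qed.

Lemma g1_eq z : g 1 z = A0 * (1 - 24 * qs (sigma_seq 1) (nome z)).
Proof.
unfold g. rewrite g_series. unfold acoef, bern. fold A0.
replace ((-1) ^ 1 * (4 * INR 1 / (1 / 6)))%R with (Ropp 24) by (simpl; field).
simpl (2 * 1 - 1)%nat. rewrite RtoC_opp. ring.
Qed.

Lemma g2_eq z : g 2 z = 12 * A0 ^ 2 * (1 + 240 * qs (sigma_seq 3) (nome z)).
Proof.
unfold g. rewrite g_series. unfold acoef, bern. fold A0.
replace ((-1) ^ 2 * (4 * INR 2 / (1 / 30)))%R with 240%R by (simpl; field).
reflexivity.
Qed.

Lemma g3_eq z : g 3 z = 8 * A0 ^ 3 * (1 - 504 * qs (sigma_seq 5) (nome z)).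
Proof.
unfold g. rewrite g_series. unfold acoef, bern. fold A0.
replace ((-1) ^ 3 * (4 * INR 3 / (1 / 42)))%R with (Ropp 504) by (simpl; field).
simpl (2 * 3 - 1)%nat. rewrite RtoC_opp. ring.
Qed.

Lemma Cderiv_affine_qs (g : C -> C) (k c : C) i z :
  (forall z, g z = k * (1 + c * qs (sigma_seq i) (nome z))) -> UpperHalfPlane z ->
  Cderiv g z (k * c * 12 * A0 * qs (n_sigma_seq i) (nome z)).
Proof.
intros E Hz. apply Cderiv_ext with (1 := fun z => eq_sym (E z)).
eapply Cderiv_val.
- apply Cderiv_mult; [apply Cderiv_const|]. apply Cderiv_plus; [apply Cderiv_const|].
  apply Cderiv_mult; [apply Cderiv_const|]. apply Cderiv_qs_nome; [apply sigma_seq_growth|exact Hz].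
- cbv beta. unfold n_sigma_seq. ring.
Qed.

(** Ramanujan's differential equations are the convolution identities for the pairs (1, 1),
    (1, 3) and, for the last one, both (1, 5) and (3, 3). *)
Lemma Cderiv_g1 z : UpperHalfPlane z -> Cderiv (g 1) z (g 1 z ^ 2 - / 12 * g 2 z).
Proof.
intros Hz. eapply Cderiv_val.
- apply (Cderiv_affine_qs (g 1) A0 (- (24)) 1); [|exact Hz].
  intros x. rewrite g1_eq. ring.
- rewrite g1_eq, g2_eq. assert (P := qs_sigma_prod11 _ (nome_lt_1 z Hz)).
  set (s1 := qs (sigma_seq 1) (nome z)) in *. set (s3 := qs (sigma_seq 3) (nome z)) in *.
  set (n1 := qs (n_sigma_seq 1) (nome z)) in *.
  replace ((A0 * (1 - 24 * s1)) ^ 2 - / 12 * (12 * A0 ^ 2 * (1 + 240 * s3)))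
    with (A0 ^ 2 * (- (48) * s1 + 48 * (12 * (s1 * s1)) - 240 * s3)) by (field; Cnz).
  rewrite P. ring.
Qed.

Lemma Cderiv_g2 z : UpperHalfPlane z -> Cderiv (g 2) z (4 * g 1 z * g 2 z - 6 * g 3 z).
Proof.
intros Hz. eapply Cderiv_val.
- apply (Cderiv_affine_qs (g 2) (12 * A0 ^ 2) 240 3); [|exact Hz].
  intros x. apply g2_eq.
- rewrite g1_eq, g2_eq, g3_eq. assert (P := qs_sigma_prod13 _ (nome_lt_1 z Hz)).
  set (s1 := qs (sigma_seq 1) (nome z)) in *. set (s3 := qs (sigma_seq 3) (nome z)) in *.
  set (s5 := qs (sigma_seq 5) (nome z)) in *. set (n3 := qs (n_sigma_seq 3) (nome z)) in *.
  replace (4 * (A0 * (1 - 24 * s1)) * (12 * A0 ^ 2 * (1 + 240 * s3)) -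
    6 * (8 * A0 ^ 3 * (1 - 504 * s5)))
    with (48 * A0 ^ 3 * (- (24) * s1 + 240 * s3 - 24 * (240 * (s1 * s3)) + 504 * s5)) by ring.
  rewrite P. ring.
Qed.

Lemma Cderiv_g3 z : UpperHalfPlane z -> Cderiv (g 3) z (6 * g 1 z * g 3 z - / 3 * g 2 z ^ 2).
Proof.
intros Hz. eapply Cderiv_val.
- apply (Cderiv_affine_qs (g 3) (8 * A0 ^ 3) (- (504)) 5); [|exact Hz].
  intros x. rewrite g3_eq. ring.
- rewrite g1_eq, g2_eq, g3_eq. assert (P := qs_sigma_prod15 _ (nome_lt_1 z Hz)).
  assert (P' := qs_sigma_prod33 _ (nome_lt_1 z Hz)).
  set (s1 := qs (sigma_seq 1) (nome z)) in *. set (s3 := qs (sigma_seq 3) (nome z)) in *.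
  set (s5 := qs (sigma_seq 5) (nome z)) in *. set (s7 := qs (sigma_seq 7) (nome z)) in *.
  set (n5 := qs (n_sigma_seq 5) (nome z)) in *.
  replace (6 * (A0 * (1 - 24 * s1)) * (8 * A0 ^ 3 * (1 - 504 * s5)) -
     / 3 * (12 * A0 ^ 2 * (1 + 240 * s3)) ^ 2)
    with (48 * A0 ^ 4 * (- (24) * s1 - 504 * s5 + 24 * (504 * (s1 * s5)) - 480 * s3
      - 480 * (120 * (s3 * s3)))) by (field; Cnz).
  rewrite P, P'. ring.
Qed.

(** * The discriminant *)

Definition Dg (z : C) : C := 27 * g 3 z ^ 2 - g 2 z ^ 3.

Lemma Cderiv_Dg z : UpperHalfPlane z -> Cderiv Dg z (12 * g 1 z * Dg z).
Proof.
intros Hz. unfold Dg. eapply Cderiv_val.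
- apply Cderiv_minus.
  + apply Cderiv_mult; [apply Cderiv_const|]. apply Cderiv_pow, Cderiv_g3, Hz.
  + apply Cderiv_pow, Cderiv_g2, Hz.
- cbv beta. simpl INR. simpl pred.
  replace (RtoC (1 + 1 + 1)) with (RtoC 3) by (f_equal; ring).
  replace (RtoC (1 + 1)) with (RtoC 2) by (f_equal; ring).
  field; Cnz. all: Cnz.
Qed.

Lemma Dg_eq z : Dg z = 1728 * A0 ^ 6 *
  ((1 - 504 * qs (sigma_seq 5) (nome z)) ^ 2 - (1 + 240 * qs (sigma_seq 3) (nome z)) ^ 3).
Proof. unfold Dg. rewrite g2_eq, g3_eq. ring. Qed.

Lemma Cmod_real (x : R) : (0 <= x)%R -> Cmod (RtoC x) = x.
Proof. intros H. rewrite Cmod_R. now apply Rabs_pos_eq. Qed.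

Lemma Cmod_1r : Cmod 1 = 1%R.
Proof. apply Cmod_real. lra. Qed.

Lemma shift_growth a : poly_growth a -> poly_growth (fun n => a (S n)).
Proof.
intros Ha. destruct (poly_growth_K _ Ha) as [K [p [K0 H]]].
exists (K * 2 ^ p)%R, p. intros n. eapply Rle_trans; [apply H|].
rewrite Rmult_assoc, <- Rpow_mult_distr.
apply Rmult_le_compat_l; [exact K0|]. apply pow_incr. split; [apply pos_INR|].
rewrite (S_INR (S n)). pose proof (INR_S_ge1 n). lra.
Qed.

Lemma Cmod_triangle5 (a b c d e : C) :
  (Cmod (a + b + c + d + e) <= Cmod a + Cmod b + Cmod c + Cmod d + Cmod e)%R.
Proof.
eapply Rle_trans; [apply Cmod_triangle|]. apply Rplus_le_compat_r.
eapply Rle_trans; [apply Cmod_triangle|]. apply Rplus_le_compat_r.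
eapply Rle_trans; [apply Cmod_triangle|]. apply Rplus_le_compat_r.
apply Cmod_triangle.
Qed.

(** The constant terms of g_2^3 and 27 g_3^2 are equal, so that the discriminant starts with
    the linear term - 2 * 504 q - 3 * 240 q = - 1728 q, up to the factor 1728 A0^6; the remainder collects the other products. *)
Lemma Dg_cusp : exists M : R, (0 <= M)%R /\ forall z, (Cmod (nome z) <= / 2)%R ->
  (Cmod (Dg z - 1728 * A0 ^ 6 * (- (1728) * nome z)) <= M * Cmod (nome z) ^ 2)%R.
Proof.
destruct (qs_bound (sigma_seq 3) (/ 2)) as [M3 [H3 B3]]; [apply sigma_seq_growth|lra|].
destruct (qs_bound (sigma_seq 5) (/ 2)) as [M5 [H5 B5]]; [apply sigma_seq_growth|lra|].
destruct (qs_bound (fun n => sigma_seq 3 (S n)) (/ 2)) as [N3 [K3 C3]]; [apply shift_growth, sigma_seq_growth|lra|].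
destruct (qs_bound (fun n => sigma_seq 5 (S n)) (/ 2)) as [N5 [K5 C5]]; [apply shift_growth, sigma_seq_growth|lra|].
set (a := Cmod (1728 * A0 ^ 6)).
assert (Ha : (0 <= a)%R) by apply Cmod_ge_0.
exists (a * (1008 * N5 + 720 * N3 + 254016 * (M5 * M5) + 172800 * (M3 * M3) + 13824000 * (M3 * M3 * M3)))%R.
split.
{ apply Rmult_le_pos; [exact Ha|].
  assert (0 <= M5 * M5)%R by nra. assert (0 <= M3 * M3)%R by nra. assert (0 <= M3 * M3 * M3)%R by nra. lra. }
intros z Hz. rewrite Dg_eq.
set (q := nome z) in *.
assert (Hq1 : (Cmod q < 1)%R) by lra.
assert (E3 := qs_first (sigma_seq 3) q (sigma_seq_growth 3) Hq1).
assert (E5 := qs_first (sigma_seq 5) q (sigma_seq_growth 5) Hq1).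
rewrite sigma_seq_0 in E3, E5.
specialize (B3 q Hz). specialize (B5 q Hz). specialize (C3 q Hz). specialize (C5 q Hz).
set (s3 := qs (sigma_seq 3) q) in *. set (s5 := qs (sigma_seq 5) q) in *.
set (t3 := qs (fun n => sigma_seq 3 (S n)) q) in *. set (t5 := qs (fun n => sigma_seq 5 (S n)) q) in *.
replace (1728 * A0 ^ 6 * ((1 - 504 * s5) ^ 2 - (1 + 240 * s3) ^ 3) - 1728 * A0 ^ 6 * (- (1728) * q))
  with (1728 * A0 ^ 6 * (- (1008) * (q * t5) + - (720) * (q * t3) + 254016 * (s5 * s5)
     + - (172800) * (s3 * s3) + - (13824000) * (s3 * s3 * s3))).
2:{ transitivity (1728 * A0 ^ 6 * (1728 * q - 1008 * (1 * q + q * t5) - 720 * (1 * q + q * t3) + 254016 * (s5 * s5)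
     - 172800 * (s3 * s3) - 13824000 * (s3 * s3 * s3))); [ring|].
    rewrite <- E3, <- E5. ring. }
rewrite Cmod_mult. fold a. rewrite Rmult_assoc. apply Rmult_le_compat_l; [exact Ha|].
eapply Rle_trans; [apply Cmod_triangle5|].
assert (Q0 := Cmod_ge_0 q).
set (x := Cmod q) in *.
assert (P1 : (Cmod (- (1008) * (q * t5)) <= 1008 * N5 * x ^ 2)%R).
{ rewrite Cmod_mult, Cmod_opp, Cmod_real, Cmod_mult by lra. fold x.
  assert (x * Cmod t5 <= x * (N5 * x))%R by (apply Rmult_le_compat_l; lra). nra. }
assert (P2 : (Cmod (- (720) * (q * t3)) <= 720 * N3 * x ^ 2)%R).
{ rewrite Cmod_mult, Cmod_opp, Cmod_real, Cmod_mult by lra. fold x.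
  assert (x * Cmod t3 <= x * (N3 * x))%R by (apply Rmult_le_compat_l; lra). nra. }
assert (S5 : (Cmod s5 * Cmod s5 <= (M5 * x) * (M5 * x))%R)
  by (apply Rmult_le_compat; auto using Cmod_ge_0).
assert (S3 : (Cmod s3 * Cmod s3 <= (M3 * x) * (M3 * x))%R)
  by (apply Rmult_le_compat; auto using Cmod_ge_0).
assert (P3 : (Cmod (254016 * (s5 * s5)) <= 254016 * (M5 * M5) * x ^ 2)%R).
{ rewrite Cmod_mult, Cmod_real, Cmod_mult by lra. nra. }
assert (P4 : (Cmod (- (172800) * (s3 * s3)) <= 172800 * (M3 * M3) * x ^ 2)%R).
{ rewrite Cmod_mult, Cmod_opp, Cmod_real, Cmod_mult by lra. nra. }
assert (P5 : (Cmod (- (13824000) * (s3 * s3 * s3)) <= 13824000 * (M3 * M3 * M3) * x ^ 2)%R).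
{ rewrite !Cmod_mult, Cmod_opp, Cmod_real by lra.
  rewrite (Rmult_assoc 13824000). apply Rmult_le_compat_l; [lra|].
  apply Rle_trans with ((M3 * x) * (M3 * x) * (M3 * x))%R.
  - apply Rmult_le_compat; auto using Cmod_ge_0. rewrite <- Cmod_mult. apply Cmod_ge_0.
  - replace (M3 * x * (M3 * x) * (M3 * x))%R with ((M3 * M3 * M3) * x ^ 2 * x)%R by ring.
    assert (0 <= M3 * M3 * M3)%R by (apply Rmult_le_pos; nra).
    assert (0 <= (M3 * M3 * M3) * x ^ 2)%R by (apply Rmult_le_pos; nra).
    nra. }
lra.
Qed.

Lemma A0_pow_neq_0 n : A0 ^ n <> 0.
Proof. apply Cpow_nz, A0_neq_0. Qed.

Lemma nome_shift_small (z : C) (e : R) : (0 < e)%R ->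
  exists t : R, (0 < t)%R /\ (Cmod (nome (z + RtoC t * Ci)) < e)%R.
Proof.
intros He. pose proof PI_RGT_0 as HP.
set (t := (Rmax 1 ((1 - ln e) / (2 * PI) - Im z))%R).
exists t. split; [eapply Rlt_le_trans; [apply Rlt_0_1|apply Rmax_l]|].
rewrite Cmod_nome. replace e with (exp (ln e)) at 1 by (now apply exp_ln).
apply exp_increasing.
assert (Ht : ((1 - ln e) / (2 * PI) - Im z <= t)%R) by apply Rmax_r.
replace (Im (z + RtoC t * Ci)) with (Im z + t)%R by (destruct z; simpl; ring).
assert (H1 : ((1 - ln e) / (2 * PI) <= Im z + t)%R) by lra.
apply Rmult_le_compat_r with (r := (2 * PI)%R) in H1; [|lra].
unfold Rdiv in H1. rewrite Rmult_assoc, Rinv_l, Rmult_1_r in H1; lra.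
Qed.

Lemma g1_bounded (r : R) : (0 < r < 1)%R -> exists M : R, forall z, (Cmod (nome z) <= r)%R -> (Cmod (g 1 z) <= M)%R.
Proof.
intros Hr. destruct (qs_bound (sigma_seq 1) r) as [M [HM B]]; [apply sigma_seq_growth|lra|].
exists (Cmod A0 * (1 + 24 * M))%R. intros z Hz. rewrite g1_eq, Cmod_mult.
apply Rmult_le_compat_l; [apply Cmod_ge_0|].
eapply Rle_trans; [apply Cmod_triangle_sub|]. rewrite Cmod_1r, Cmod_mult, Cmod_real by lra.
specialize (B _ Hz). pose proof (Cmod_ge_0 (nome z)).
assert (M * Cmod (nome z) <= M * 1)%R by (apply Rmult_le_compat_l; lra). lra.
Qed.

(** The linear equation D' = 12 g_1 D propagates a zero vertically up to the cusp, where it would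
    contradict D ~ - 1728^2 A0^6 q. *)
Lemma Dg_neq_0 z : UpperHalfPlane z -> Dg z <> 0.
Proof.
intros Hz H0. destruct Dg_cusp as [M [HM B]].
set (a := Cmod (1728 * A0 ^ 6)).
assert (Ha : (0 < a)%R).
{ apply Cmod_gt_0. apply Cmult_neq_0; [intros E; apply RtoC_inj in E; lra|apply A0_pow_neq_0]. }
set (e := Rmin (/ 2) (a / (M + 1))).
assert (He : (0 < e)%R) by (apply Rmin_glb_lt; [lra|apply Rdiv_lt_0_compat; lra]).
destruct (nome_shift_small z e He) as [t [Ht Hq]].
set (w := z + RtoC t * Ci) in *.
assert (Hseg : forall s : R, (0 <= s <= 1)%R -> (Im z <= Im (seg z w s))%R).
{ intros s Hs. unfold w. destruct z as [x y]; simpl. nra. }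
assert (Hr := nome_lt_1 z Hz).
assert (Hr0 : (0 < Cmod (nome z))%R) by (rewrite Cmod_nome; apply exp_pos).
destruct (g1_bounded (Cmod (nome z)) (conj Hr0 Hr)) as [K HK].
assert (W : Dg w = 0).
{ apply (linear_ode_zero Dg (fun z => 12 * g 1 z) z w (12 * K)); [| |exact H0].
  - intros s Hs. apply Cderiv_Dg. unfold UpperHalfPlane in *. specialize (Hseg s Hs). lra.
  - intros s Hs. rewrite Cmod_mult, Cmod_real by lra. apply Rmult_le_compat_l; [lra|].
    apply HK. rewrite !Cmod_nome. specialize (Hseg s Hs).
    pose proof PI_RGT_0. apply Rge_le, Rle_ge.
    destruct (Req_dec (Im z) (Im (seg z w s))) as [E|E]; [rewrite E; lra|].
    apply Rlt_le, exp_increasing. nra. }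
assert (Hq1 : (Cmod (nome w) <= / 2)%R) by (apply Rlt_le, Rlt_le_trans with (1 := Hq), Rmin_l).
assert (Hq2 : (Cmod (nome w) < a / (M + 1))%R) by (apply Rlt_le_trans with (1 := Hq), Rmin_r).
specialize (B w Hq1). rewrite W in B.
replace (0 - 1728 * A0 ^ 6 * (- (1728) * nome w)) with (1728 * A0 ^ 6 * (1728 * nome w)) in B by ring.
rewrite !(Cmod_mult (1728 * A0 ^ 6)), (Cmod_mult 1728 (nome w)), (Cmod_real 1728) in B by lra.
fold a in B.
assert (Hq0 : (0 < Cmod (nome w))%R) by (rewrite Cmod_nome; apply exp_pos).
set (x := Cmod (nome w)) in *.
apply Rmult_lt_compat_r with (r := (M + 1)%R) in Hq2; [|lra].
replace (a / (M + 1) * (M + 1))%R with a in Hq2 by (field; lra).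
nra.
Qed.

(** At the cusp g_2 tends to a nonzero limit and the discriminant to 0, so that a bound on the
    quotient g_2^3 / D is a bound on the height. *)
Lemma cusp_bound (B : R) : exists Y : R, forall z, UpperHalfPlane z ->
  (Cmod (g 2 z) ^ 3 <= B * Cmod (Dg z))%R -> (Im z <= Y)%R.
Proof.
destruct Dg_cusp as [M [HM HB]].
destruct (qs_bound (sigma_seq 3) (/ 2)) as [M3 [H3 B3]]; [apply sigma_seq_growth|lra|].
set (a := Cmod (12 * A0 ^ 2)).
set (b := Cmod (1728 * A0 ^ 6)).
assert (Ha : (0 < a)%R).
{ apply Cmod_gt_0. apply Cmult_neq_0; [intros E; apply RtoC_inj in E; lra|apply A0_pow_neq_0]. }
assert (Hb : (0 <= b)%R) by apply Cmod_ge_0.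
set (N := (Rabs B * (b * 1728 + M))%R).
assert (HN : (0 <= N)%R).
{ apply Rmult_le_pos; [apply Rabs_pos|]. nra. }
set (c := Rmin (/ 2) (Rmin (/ (480 * (M3 + 1))) ((a / 2) ^ 3 / (N + 1)))).
assert (Hc : (0 < c)%R).
{ assert (0 < (a / 2) ^ 3)%R by (apply pow_lt; lra).
  repeat apply Rmin_glb_lt; try lra; [apply Rinv_0_lt_compat; lra|apply Rdiv_lt_0_compat; lra]. }
exists (- ln c / (2 * PI))%R. intros z Hz Hg.
pose proof PI_RGT_0 as HP.
assert (Hcz : (c <= Cmod (nome z))%R).
{ apply Rnot_lt_le. intros Hq.
  assert (Hq1 : (Cmod (nome z) < / 2)%R) by (apply Rlt_le_trans with (1 := Hq), Rmin_l).
  assert (Hq2 : (Cmod (nome z) < / (480 * (M3 + 1)))%R).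
  { apply Rlt_le_trans with (1 := Hq). eapply Rle_trans; [apply Rmin_r|apply Rmin_l]. }
  assert (Hq3 : (Cmod (nome z) < (a / 2) ^ 3 / (N + 1))%R).
  { apply Rlt_le_trans with (1 := Hq). eapply Rle_trans; [apply Rmin_r|apply Rmin_r]. }
  assert (Hq0 := Cmod_ge_0 (nome z)).
  specialize (HB z ltac:(lra)). specialize (B3 (nome z) ltac:(lra)).
  assert (G2 : (a / 2 <= Cmod (g 2 z))%R).
  { rewrite g2_eq, Cmod_mult. fold a.
    assert (T := Cmod_triangle_sub (1 + 240 * qs (sigma_seq 3) (nome z)) (240 * qs (sigma_seq 3) (nome z))).
    replace (1 + 240 * qs (sigma_seq 3) (nome z) - 240 * qs (sigma_seq 3) (nome z)) with (RtoC 1) in T by ring.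
    rewrite Cmod_1r, (Cmod_mult 240), Cmod_real in T by lra.
    apply Rmult_lt_compat_r with (r := (480 * (M3 + 1))%R) in Hq2; [|lra].
    rewrite Rinv_l in Hq2 by lra.
    assert (240 * Cmod (qs (sigma_seq 3) (nome z)) <= / 2)%R by nra.
    unfold Rdiv. apply Rmult_le_compat_l; lra. }
  assert (D : (Cmod (Dg z) <= (b * 1728 + M) * Cmod (nome z))%R).
  { replace (Dg z) with ((Dg z - 1728 * A0 ^ 6 * (- (1728) * nome z)) + 1728 * A0 ^ 6 * (- (1728) * nome z)) by ring.
    eapply Rle_trans; [apply Cmod_triangle|].
    rewrite (Cmod_mult (1728 * A0 ^ 6)), (Cmod_mult (- (1728))), Cmod_opp, (Cmod_real 1728) by lra.
    fold b. set (x := Cmod (nome z)) in *.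
    assert (M * x ^ 2 <= M * x)%R by (apply Rmult_le_compat_l; [lra|nra]).
    apply Rle_trans with (M * x ^ 2 + b * (1728 * x))%R; [apply Rplus_le_compat_r, HB|].
    lra. }
  assert (G3 : ((a / 2) ^ 3 <= Cmod (g 2 z) ^ 3)%R) by (apply pow_incr; lra).
  assert (F : ((a / 2) ^ 3 <= N * Cmod (nome z))%R).
  { eapply Rle_trans; [exact G3|]. eapply Rle_trans; [exact Hg|].
    apply Rle_trans with (Rabs B * Cmod (Dg z))%R.
    - apply Rmult_le_compat_r; [apply Cmod_ge_0|apply Rle_abs].
    - unfold N. rewrite Rmult_assoc. apply Rmult_le_compat_l; [apply Rabs_pos|exact D]. }
  apply Rmult_lt_compat_r with (r := (N + 1)%R) in Hq3; [|lra].
  replace ((a / 2) ^ 3 / (N + 1) * (N + 1))%R with ((a / 2) ^ 3)%R in Hq3 by (field; lra).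
  nra. }
rewrite Cmod_nome in Hcz.
assert (L : (ln c <= - (2 * PI * Im z))%R).
{ rewrite <- (ln_exp (- (2 * PI * Im z))).
  destruct (Rle_lt_or_eq_dec _ _ Hcz) as [Hl|He]; [apply Rlt_le, ln_increasing; auto|rewrite He; lra]. }
apply Rmult_le_reg_r with (2 * PI)%R; [lra|].
replace (- ln c / (2 * PI) * (2 * PI))%R with (- ln c)%R by (field; lra). lra.
Qed.

(** * Estimates for the exponential near 0 *)

Lemma Cexp_sub1_le (h : C) (A : R) : (Rabs (Re h) <= A)%R ->
  (Cmod (Cexp h - 1) <= 2 * exp A * Cmod h)%R /\
  (Cmod (Cexp h - 1 - h) <= 4 * exp A * Cmod h ^ 2)%R.
Proof.
intros HA.
assert (B : forall k, (Rabs (Re k) <= A)%R -> (Cmod (Cexp k - 1) <= 2 * exp A * Cmod k)%R).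
{ intros k Hk. assert (M := segment_mvt Cexp Cexp 0 k 0 (exp A)).
  rewrite Cexp_0 in M.
  replace (Cexp k - 1) with (Cexp k - 1 - 0 * (k - 0)) by ring.
  replace (Cmod k) with (Cmod (k - 0)) by (f_equal; ring). apply M.
  - intros t _. apply Cderiv_Cexp.
  - intros t Ht. replace (Cexp (seg 0 k t) - 0) with (Cexp (seg 0 k t)) by ring.
    rewrite Cmod_Cexp. replace (Re (seg 0 k t)) with (t * Re k)%R by (destruct k; simpl; ring).
    assert (t * Re k <= A)%R.
    { apply Rle_trans with (Rabs (t * Re k)); [apply Rle_abs|]. rewrite Rabs_mult, Rabs_pos_eq by lra.
      pose proof (Rabs_pos (Re k)). nra. }
    destruct (Rle_lt_or_eq_dec _ _ H) as [L|E]; [apply Rlt_le, exp_increasing, L|rewrite E; lra]. }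
split; [now apply B|].
assert (M := segment_mvt Cexp Cexp 0 h 1 (2 * exp A * Cmod h)).
rewrite Cexp_0 in M.
replace (Cexp h - 1 - h) with (Cexp h - 1 - 1 * (h - 0)) by ring.
replace (4 * exp A * Cmod h ^ 2)%R with (2 * (2 * exp A * Cmod h) * Cmod (h - 0))%R
  by (replace (h - 0) with h by ring; ring).
apply M.
- intros t _. apply Cderiv_Cexp.
- intros t Ht. set (k := seg 0 h t).
  assert (Ek : k = RtoC t * h) by (unfold k; ring).
  eapply Rle_trans; [apply B|].
  + rewrite Ek. replace (Re (RtoC t * h)) with (t * Re h)%R by (destruct h; simpl; ring).
    rewrite Rabs_mult, Rabs_pos_eq by lra. pose proof (Rabs_pos (Re h)). nra.
  + apply Rmult_le_compat_l; [pose proof (exp_pos A); lra|].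
    rewrite Ek, Cmod_mult, Cmod_real by lra. pose proof (Cmod_ge_0 h). nra.
Qed.

(** The alternating Taylor bound of order 7 suffices up to 5 / 2, which covers half of the
    imaginary parts met below. *)
Lemma sin_lower (t : R) : (Rabs t <= 5 / 2)%R -> (t ^ 2 / 25 <= sin t ^ 2)%R.
Proof.
assert (G : forall t, (0 <= t <= 5 / 2)%R -> (t / 5 <= sin t)%R).
{ clear t. intros t Ht. pose proof PI2_3_2.
  destruct (SIN t) as [L _]; [lra|unfold PI2 in *; lra|].
  eapply Rle_trans; [|exact L].
  unfold sin_lb, sin_approx, sum_f_R0, sin_term. simpl. 
  assert (0 <= t ^ 2 <= 25 / 4)%R by nra.
  set (s := (t ^ 2)%R) in *.
  match goal with |- (_ <= ?e)%R => replace e with (t * (1 - s / 6 + s ^ 2 / 120 - s ^ 3 / 5040))%R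
    by (unfold s; simpl; field) end.
  assert (s ^ 3 <= 25 / 4 * s ^ 2)%R by (simpl; nra).
  assert (0 <= (25 / 4 - s) * (25 / 4 - s))%R by nra.
  assert (1 / 5 <= 1 - s / 6 + s ^ 2 / 120 - s ^ 3 / 5040)%R by (simpl in *; nra).
  nra. }
intros Ht. destruct (Rle_dec 0 t) as [P|P].
- rewrite Rabs_pos_eq in Ht by lra. specialize (G t ltac:(lra)). nra.
- rewrite Rabs_left in Ht by lra. specialize (G (- t)%R ltac:(lra)). rewrite sin_neg in G. nra.
Qed.

(** |e^h - 1|^2 = (e^a - 1)^2 + 4 e^a sin^2 (b / 2) for h = a + i b.  The bound 5 on b is below
    the period, so that 0 is the only zero in the region. *)
Lemma Cexp_sub1_ge (h : C) (A : R) : (0 <= A)%R -> (Rabs (Re h) <= A)%R -> (Rabs (Im h) <= 5)%R ->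
  (exp (- A) / 5 * Cmod h <= Cmod (Cexp h - 1))%R.
Proof.
intros HA Ha Hb. 
assert (EA : (0 < exp (- A) <= 1)%R).
{ split; [apply exp_pos|]. rewrite <- exp_0. destruct (Req_dec A 0) as [->|N]; [rewrite Ropp_0; lra|].
  apply Rlt_le, exp_increasing. lra. }
destruct h as [a b]. simpl in Ha, Hb.
assert (E1 : (exp (- A) * Rabs a <= Rabs (exp a - 1))%R).
{ destruct (Rle_dec 0 a) as [P|P].
  - rewrite !Rabs_pos_eq.
    + pose proof (exp_ineq1_le a). nra.
    + pose proof (exp_ineq1_le a). lra.
    + exact P.
  - rewrite (Rabs_left a) in * by lra.
    assert (X := exp_ineq1_le (- a)).
    assert (Y : (exp a * exp (- a) = 1)%R) by (rewrite <- exp_plus, Rplus_opp_r; apply exp_0).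
    assert (Z : (exp (- A) <= exp a)%R).
    { destruct (Req_dec (- A) a) as [->|N]; [lra|]. apply Rlt_le, exp_increasing. lra. }
    pose proof (exp_pos a).
    rewrite Rabs_left1 by nra. nra. }
assert (E2 : (exp (- A) <= exp a)%R).
{ destruct (Req_dec (- A) a) as [->|N]; [lra|]. apply Rlt_le, exp_increasing.
  apply Rabs_le_between in Ha. lra. }
assert (S : (b ^ 2 / 100 <= sin (b / 2) ^ 2)%R).
{ eapply Rle_trans; [|apply sin_lower]; [lra|].
  unfold Rdiv. rewrite Rabs_mult, (Rabs_pos_eq (/ 2)); lra. }
assert (C2 : (cos b = 1 - 2 * sin (b / 2) ^ 2)%R).
{ replace b with (2 * (b / 2))%R at 1 by field. rewrite cos_2a_sin. ring. }
apply Rsqr_incr_0_var; [|apply Cmod_ge_0].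
unfold Rsqr. 
assert (N1 : (Cmod (Cexp (a, b) - 1) * Cmod (Cexp (a, b) - 1) = (exp a - 1) ^ 2 + 4 * exp a * sin (b / 2) ^ 2)%R).
{ unfold Cmod. rewrite sqrt_sqrt by nra. unfold Cexp; simpl.
  assert (X := sin2_cos2 b). unfold Rsqr in X.
  transitivity ((exp a * exp a) * (sin b * sin b + cos b * cos b) - 2 * exp a * cos b + 1)%R; [ring|].
  rewrite X, C2. ring. }
assert (N2 : (Cmod (a, b) * Cmod (a, b) = a ^ 2 + b ^ 2)%R).
{ unfold Cmod. rewrite sqrt_sqrt by (simpl; nra). simpl. ring. }
rewrite N1. replace (exp (- A) / 5 * Cmod (a, b) * (exp (- A) / 5 * Cmod (a, b)))%R
  with (exp (- A) ^ 2 / 25 * (Cmod (a, b) * Cmod (a, b)))%R by field.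
rewrite N2.
assert (Q1 : (exp (- A) ^ 2 * a ^ 2 <= (exp a - 1) ^ 2)%R).
{ rewrite <- (pow2_abs a), <- (pow2_abs (exp a - 1)), <- Rpow_mult_distr. apply pow_incr.
  split; [apply Rmult_le_pos; [lra|apply Rabs_pos]|exact E1]. }
assert (Q2 : (exp (- A) ^ 2 / 25 * b ^ 2 <= 4 * exp a * sin (b / 2) ^ 2)%R).
{ apply Rle_trans with (4 * exp a * (b ^ 2 / 100))%R.
  - assert (0 <= b ^ 2)%R by nra. assert (exp (- A) ^ 2 <= exp a)%R by nra. nra.
  - apply Rmult_le_compat_l; [lra|exact S]. }
assert (0 <= exp (- A) ^ 2 * a ^ 2)%R by (apply Rmult_le_pos; nra).
lra.
Qed.

(** * The kernel sum_r r^3 t^r and the distribution relation *)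

(** Closed form of the sum of r^3 t^r over r > 0; see qs_cubes. *)
Definition cube_series (t : C) : C := t * (1 + 4 * t + t ^ 2) / (1 - t) ^ 4.

(** The sum of (y + n)^(-4) over all integers n, in closed form; see full_row_lipschitz. *)
Definition full_row (y : C) : C := 8 / 3 * RtoC PI ^ 4 * cube_series (nome y).

(** For |p| < 1 this says that the odd terms of the two series on the right cancel, leaving
    2 * 8 times the cubes of the even indices. *)
Lemma cube_series_double (p : C) : p <> 1 -> p <> - (1) -> 16 * cube_series (p * p) = cube_series p + cube_series (- p).
Proof.
intros H1 H2. unfold cube_series.
assert (N1 : 1 - p <> 0) by (intros E; apply H1; replace p with (1 - (1 - p)) by ring; rewrite E; ring).
assert (N2 : 1 - - p <> 0).
{ intros E; apply H2; replace p with ((1 - - p) - 1) by ring; rewrite E; ring. }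
assert (N3 : 1 - p * p <> 0).
{ replace (1 - p * p) with ((1 - p) * (1 - - p)) by ring. now apply Cmult_neq_0. }
assert (N2' : 1 + p <> 0) by (replace (1 + p) with (1 - - p) by ring; exact N2).
field. auto.
Qed.

(** The pole at 0 has order 4 and leading coefficient 1.  The rectangle contains no other pole, and
    for large M it contains the arguments (w + n) / M, with |n| <= M / 2, of the distribution
    relation. *)
Lemma full_row_pole : exists K : R, (0 <= K)%R /\ forall y : C, y <> 0 ->
  (Rabs (Re y) <= 5 / 8)%R -> (Rabs (Im y) <= 1)%R ->
  (Cmod (y ^ 4 * full_row y - 1) <= K * Cmod y)%R.
Proof.
set (E := exp 8). set (c := (exp (- (8)) / 5)%R).
assert (HE : (0 < E)%R) by apply exp_pos.
assert (Hc : (0 < c)%R) by (unfold c; pose proof (exp_pos (- (8))); lra).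
set (V := (1 + 64 * E / c)%R).
exists (8 * ((2 * E) * (E ^ 2 + 5 * E + 6) / 6 * V ^ 4 + (4 * E / c) * (V ^ 3 + V ^ 2 + V + 1)))%R.
assert (HV : (1 <= V)%R).
{ unfold V. assert (0 < 64 * E / c)%R by (apply Rdiv_lt_0_compat; lra). lra. }
assert (HV2 : (0 <= V ^ 2)%R) by nra.
assert (HV3 : (0 <= V ^ 3)%R) by (apply pow_le; lra).
assert (HV4 : (0 <= V ^ 4)%R) by (apply pow_le; lra).
assert (Hec : (0 < 4 * E / c)%R) by (apply Rdiv_lt_0_compat; lra).
split.
{ apply Rmult_le_pos; [lra|]. apply Rplus_le_le_0_compat; apply Rmult_le_pos; try lra.
  unfold Rdiv. apply Rmult_le_pos; [|lra]. apply Rmult_le_pos; nra. }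
intros y Hy HR HI. pose proof PI_RGT_0. pose proof PI_4 as P4.
set (h := 2 * PI * Ci * y).
assert (Hh0 : h <> 0).
{ unfold h. repeat apply Cmult_neq_0; auto; intros X.
  - apply RtoC_inj in X; lra.
  - apply RtoC_inj in X; lra.
  - apply (f_equal Im) in X. simpl in X. lra. }
assert (Rh : Re h = (- (2 * PI * Im y))%R) by (unfold h; destruct y; simpl; ring).
assert (Ih : Im h = (2 * PI * Re y)%R) by (unfold h; destruct y; simpl; ring).
assert (BR : (Rabs (Re h) <= 8)%R).
{ rewrite Rh, Rabs_Ropp, Rabs_mult, Rabs_pos_eq by lra. pose proof (Rabs_pos (Im y)). nra. }
assert (BI : (Rabs (Im h) <= 5)%R).
{ rewrite Ih, Rabs_mult, Rabs_pos_eq by lra. pose proof (Rabs_pos (Re y)).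
  assert (PI * Rabs (Re y) <= 4 * (5 / 8))%R by (apply Rmult_le_compat; lra). lra. }
assert (Mh : (Cmod h <= 8 * Cmod y)%R).
{ unfold h. rewrite !Cmod_mult, !Cmod_real by lra.
  replace (Cmod Ci) with 1%R.
  - pose proof (Cmod_ge_0 y). nra.
  - unfold Cmod, Ci; simpl. replace (0 * (0 * 1) + 1 * (1 * 1))%R with 1%R by ring. now rewrite sqrt_1. }
destruct (Cexp_sub1_le h 8 BR) as [U1 U2].
assert (L := Cexp_sub1_ge h 8 ltac:(lra) BR BI). fold c in L. fold E in U1, U2.
assert (Eq : (Cmod (Cexp h) <= E)%R).
{ rewrite Cmod_Cexp. unfold E. assert (X : (Re h <= 8)%R) by (apply Rabs_le_between in BR; lra).
  destruct (Rle_lt_or_eq_dec _ _ X) as [X'|X']; [apply Rlt_le, exp_increasing, X'|rewrite X'; lra]. }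
unfold full_row. change (nome y) with (Cexp h). set (q := Cexp h) in *.
assert (Hm : (0 < Cmod h)%R) by now apply Cmod_gt_0.
assert (Hq1 : q - 1 <> 0).
{ apply Cmod_gt_0. nra. }
set (v := h / (q - 1)).
(* y^4 (8 / 3) PI^4 = h^4 / 6, so that the quantity is q (1 + 4 q + q^2) / 6 * v^4 - 1, with v and q near 1 *)
assert (X : y ^ 4 * (8 / 3 * RtoC PI ^ 4 * cube_series q) - 1 =
   (q - 1) * (q ^ 2 + 5 * q + 6) / 6 * v ^ 4 + (v - 1) * (v ^ 3 + v ^ 2 + v + 1)).
{ transitivity (q * (1 + 4 * q + q ^ 2) / 6 * v ^ 4 - 1); [|field; Cnz].
  assert (Ev : v ^ 4 = 16 * RtoC PI ^ 4 * y ^ 4 / (q - 1) ^ 4).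
  { unfold v, h. assert (C4 : Ci ^ 4 = 1) by (unfold Ci; apply injective_projections; simpl; ring).
    transitivity (16 * RtoC PI ^ 4 * y ^ 4 * Ci ^ 4 / (q - 1) ^ 4); [field; exact Hq1|].
    rewrite C4. field. exact Hq1. }
  rewrite Ev. unfold cube_series.
  assert (N : 1 - q <> 0) by (intros Z; apply Hq1; replace (q - 1) with (- (1 - q)) by ring; rewrite Z; ring).
  field. repeat split; auto; Cnz. }
rewrite X.
assert (Hv1 : (Cmod (v - 1) <= 4 * E / c * Cmod h)%R).
{ replace (v - 1) with (- ((q - 1 - h) / (q - 1))) by (unfold v; field; exact Hq1).
  rewrite Cmod_opp, Cmod_div by exact Hq1.
  apply Rmult_le_reg_r with (Cmod (q - 1)); [apply Rlt_le_trans with (2 := L); nra|].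
  unfold Rdiv at 1. rewrite Rmult_assoc, Rinv_l, Rmult_1_r by (apply Rgt_not_eq, Rlt_le_trans with (2 := L); nra).
  eapply Rle_trans; [exact U2|].
  replace (4 * E * Cmod h ^ 2)%R with ((4 * E / c * Cmod h) * (c * Cmod h))%R by (field; lra).
  apply Rmult_le_compat_l; [|exact L]. apply Rmult_le_pos; lra. }
assert (HhB : (Cmod h <= 16)%R).
{ eapply Rle_trans; [exact Mh|]. pose proof (Cmod_le_sum y). lra. }
assert (Hv : (Cmod v <= V)%R).
{ replace v with ((v - 1) + 1) by ring. eapply Rle_trans; [apply Cmod_triangle|].
  rewrite Cmod_1r. unfold V.
  assert (4 * E / c * Cmod h <= 4 * E / c * 16)%R by (apply Rmult_le_compat_l; lra).
  replace (64 * E / c)%R with (4 * E / c * 16)%R by (field; lra). lra. }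
assert (Hvp : forall n, (Cmod (v ^ n) <= V ^ n)%R).
{ intros n. rewrite Cmod_pow. apply pow_incr. split; [apply Cmod_ge_0|exact Hv]. }
assert (Hq6 : (Cmod (q ^ 2 + 5 * q + 6) <= E ^ 2 + 5 * E + 6)%R).
{ eapply Rle_trans; [apply Cmod_triangle|]. rewrite Cmod_real by lra. apply Rplus_le_compat_r.
  eapply Rle_trans; [apply Cmod_triangle|]. rewrite Cmod_mult, Cmod_real, Cmod_pow by lra.
  apply Rplus_le_compat; [|lra]. apply pow_incr. split; [apply Cmod_ge_0|exact Eq]. }
assert (T1 : (Cmod ((q - 1) * (q ^ 2 + 5 * q + 6) / 6 * v ^ 4) <=
   ((2 * E) * (E ^ 2 + 5 * E + 6) / 6 * V ^ 4) * Cmod h)%R).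
{ unfold Cdiv. rewrite !Cmod_mult, Cmod_inv, (Cmod_real 6) by (first [lra|Cnz]).
  replace (2 * E * (E ^ 2 + 5 * E + 6) / 6 * V ^ 4 * Cmod h)%R with
    ((2 * E * Cmod h) * (E ^ 2 + 5 * E + 6) * / 6 * V ^ 4)%R by (unfold Rdiv; ring).
  apply Rmult_le_compat; auto using Cmod_ge_0.
  - apply Rmult_le_pos; [apply Rmult_le_pos; apply Cmod_ge_0|lra].
  - apply Rmult_le_compat_r; [lra|]. apply Rmult_le_compat; auto using Cmod_ge_0. }
assert (T2 : (Cmod ((v - 1) * (v ^ 3 + v ^ 2 + v + 1)) <=
   (4 * E / c) * (V ^ 3 + V ^ 2 + V + 1) * Cmod h)%R).
{ rewrite Cmod_mult.
  replace (4 * E / c * (V ^ 3 + V ^ 2 + V + 1) * Cmod h)%R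
    with ((4 * E / c * Cmod h) * (V ^ 3 + V ^ 2 + V + 1))%R by ring.
  apply Rmult_le_compat; auto using Cmod_ge_0.
  eapply Rle_trans; [apply Cmod_triangle|]. rewrite Cmod_1r. apply Rplus_le_compat_r.
  eapply Rle_trans; [apply Cmod_triangle|]. apply Rplus_le_compat; [|exact Hv].
  eapply Rle_trans; [apply Cmod_triangle|]. apply Rplus_le_compat; apply Hvp. }
eapply Rle_trans; [apply Cmod_triangle|].
set (a1 := (2 * E * (E ^ 2 + 5 * E + 6) / 6 * V ^ 4)%R) in *.
set (a2 := (4 * E / c * (V ^ 3 + V ^ 2 + V + 1))%R) in *.
assert (0 <= a1)%R.
{ unfold a1, Rdiv. apply Rmult_le_pos; [|lra]. apply Rmult_le_pos; [|lra]. apply Rmult_le_pos; nra. }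
assert (0 <= a2)%R by (apply Rmult_le_pos; lra).
apply Rle_trans with ((a1 + a2) * Cmod h)%R; [lra|].
replace (8 * (a1 + a2) * Cmod y)%R with ((a1 + a2) * (8 * Cmod y))%R by ring.
apply Rmult_le_compat_l; lra.
Qed.

(** * Finite sums *)

Fixpoint bsum (H : nat -> C) (n : nat) : C :=
  match n with O => 0 | S m => bsum H m + H m end.

Lemma bsum_ext H K n : (forall j, (j < n)%nat -> H j = K j) -> bsum H n = bsum K n.
Proof.
induction n as [|n IH]; intros E; simpl; [easy|].
rewrite IH, E; [easy|lia|]. intros j Hj. apply E. lia.
Qed.

Lemma bsum_plus H K n : bsum (fun j => H j + K j) n = bsum H n + bsum K n.
Proof. induction n as [|n IH]; simpl; [ring|]. rewrite IH. ring. Qed.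

Lemma bsum_minus H K n : bsum (fun j => H j - K j) n = bsum H n - bsum K n.
Proof. induction n as [|n IH]; simpl; [ring|]. rewrite IH. ring. Qed.

Lemma bsum_scal c H n : bsum (fun j => c * H j) n = c * bsum H n.
Proof. induction n as [|n IH]; simpl; [ring|]. rewrite IH. ring. Qed.

Lemma bsum_add H m n : bsum H (m + n) = bsum H m + bsum (fun j => H (m + j)%nat) n.
Proof.
induction n as [|n IH]; simpl.
- rewrite Nat.add_0_r. ring.
- rewrite Nat.add_succ_r. simpl. rewrite IH. ring.
Qed.

Lemma bsum_first H n : bsum H (S n) = H O + bsum (fun j => H (S j)) n.
Proof. replace (S n) with (1 + n)%nat by lia. rewrite bsum_add. simpl. ring. Qed.

Lemma bsum_rev H n : bsum (fun j => H (n - 1 - j)%nat) n = bsum H n.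
Proof.
induction n as [|n IH]; [easy|].
rewrite bsum_first. simpl bsum at 2. rewrite <- IH, Cplus_comm. f_equal.
- apply bsum_ext. intros j Hj. f_equal. lia.
- f_equal. lia.
Qed.

Lemma bsum_fold H P : bsum H (2 * P) = bsum (fun j => H j + H (2 * P - 1 - j)%nat) P.
Proof.
rewrite bsum_plus. replace (2 * P)%nat with (P + P)%nat by lia. rewrite bsum_add. f_equal.
rewrite <- (bsum_rev (fun j => H (P + j)%nat)). apply bsum_ext. intros j Hj. f_equal. lia.
Qed.

(** Comparison with the telescoping sum of 1 / (k (k + 1)). *)
Lemma bsum_sq_bound (H : nat -> C) (B : R) (n : nat) : (0 <= B)%R ->
  (forall j, (j < n)%nat -> (Cmod (H j) <= B / (INR (S j)) ^ 2)%R) ->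
  (Cmod (bsum H n) <= 2 * B)%R.
Proof.
intros HB Hj.
assert (G : forall k, (S k <= n)%nat -> (Cmod (bsum H (S k)) <= B * (2 - / INR (S k)))%R).
{ induction k as [|k IH]; intros Hk.
  - simpl bsum. rewrite Cplus_0_l. eapply Rle_trans; [apply Hj; lia|]. simpl. lra.
  - change (bsum H (S (S k))) with (bsum H (S k) + H (S k)).
    eapply Rle_trans; [apply Cmod_triangle|].
    specialize (IH ltac:(lia)). specialize (Hj (S k) ltac:(lia)).
    assert (P : (0 < INR (S k))%R) by (apply lt_0_INR; lia).
    rewrite (S_INR (S k)) in *. set (x := INR (S k)) in *.
    assert (Q : (/ (x + 1) ^ 2 <= / x - / (x + 1))%R).
    { apply Rmult_le_reg_r with (x * (x + 1) ^ 2)%R; [nra|].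
      replace (/ (x + 1) ^ 2 * (x * (x + 1) ^ 2))%R with x by (field; lra).
      replace ((/ x - / (x + 1)) * (x * (x + 1) ^ 2))%R with (x + 1)%R by (field; lra). lra. }
    unfold Rdiv in Hj. 
    assert (B * / (x + 1) ^ 2 <= B * (/ x - / (x + 1)))%R by (apply Rmult_le_compat_l; lra). lra. }
destruct n as [|n].
- simpl. rewrite Cmod_0. lra.
- eapply Rle_trans; [apply G; lia|].
  assert (0 < / INR (S n))%R by (apply Rinv_0_lt_compat, lt_0_INR; lia). nra.
Qed.

(** * Integer translates and the distribution relation *)

Lemma Cexp_2PI (n : nat) : Cexp (2 * PI * Ci * RtoC (INR n)) = 1.
Proof.
rewrite Cexp_nat.
assert (E : Cexp (2 * PI * Ci) = 1).
{ unfold Cexp.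
  replace (Re (2 * PI * Ci)) with 0%R by (simpl; ring).
  replace (Im (2 * PI * Ci)) with (2 * PI)%R by (simpl; ring).
  rewrite exp_0, cos_2PI, sin_2PI. apply injective_projections; simpl; ring. }
rewrite E. induction n as [|n IH]; simpl; [easy|]. rewrite IH. ring.
Qed.

Lemma nome_plus (a b : C) : nome (a + b) = nome a * nome b.
Proof. unfold nome. rewrite <- Cexp_plus. f_equal. ring. Qed.

Lemma nome_add_nat (w : C) (n : nat) : nome (w + RtoC (INR n)) = nome w.
Proof. rewrite nome_plus. unfold nome at 2. rewrite Cexp_2PI. ring. Qed.

Lemma nome_sub_nat (w : C) (n : nat) : nome (w - RtoC (INR n)) = nome w.
Proof. rewrite <- (nome_add_nat (w - RtoC (INR n)) n). f_equal. ring. Qed.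

Lemma nome_half_neg (w : C) : nome (w - / 2) = - nome w.
Proof.
unfold Cminus. rewrite nome_plus.
assert (E : nome (- / 2) = - (1)).
{ unfold nome, Cexp.
  replace (2 * PI * Ci * - / 2) with (- RtoC PI * Ci) by (field; Cnz).
  replace (Re (- RtoC PI * Ci)) with 0%R by (simpl; ring).
  replace (Im (- RtoC PI * Ci)) with (- PI)%R by (simpl; ring).
  rewrite exp_0, cos_neg, sin_neg, cos_PI, sin_PI. apply injective_projections; simpl; ring. }
rewrite E. ring.
Qed.

Lemma full_row_half (w : C) : nome w <> 1 -> 16 * full_row w = full_row (w / 2) + full_row ((w - 1) / 2).
Proof.
intros H. unfold full_row.
set (p := nome (w / 2)).
assert (E1 : nome w = p * p).
{ unfold p. rewrite <- nome_plus. f_equal. field. all: Cnz. }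
assert (E2 : nome ((w - 1) / 2) = - p).
{ unfold p. rewrite <- nome_half_neg. f_equal. field. all: Cnz. }
rewrite E2, E1. rewrite E1 in H.
replace (16 * (8 / 3 * RtoC PI ^ 4 * cube_series (p * p))) with (8 / 3 * RtoC PI ^ 4 * (16 * cube_series (p * p))) by ring.
rewrite cube_series_double; [ring| |]; intros E; apply H; rewrite E; ring.
Qed.

Lemma nome_div_nat (y : C) (n : nat) : (0 < n)%nat -> nome (y / RtoC (INR n)) ^ n = nome y.
Proof.
intros Hn. unfold nome. rewrite <- Cexp_nat. f_equal. field.
intros E. apply RtoC_inj in E. apply not_0_INR in E; [easy|lia].
Qed.

Lemma INR_nz n : (0 < n)%nat -> RtoC (INR n) <> 0.
Proof. intros H E. apply RtoC_inj in E. apply not_0_INR in E; [easy|lia]. Qed.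

(** Iterating the duplication formula cuts a period into M = 2^(N+1) equal parts.  The translates
    used are the representatives from - M / 2 to M / 2 - 1, the ones closest to 0. *)
Lemma full_row_distribution (w : C) (N : nat) : nome w <> 1 ->
  let P := (2 ^ N)%nat in let M := RtoC (INR (2 * P)) in
  M ^ 4 * full_row w =
  bsum (fun j => full_row ((w + RtoC (INR j)) / M) + full_row ((w - RtoC (INR (S j))) / M)) P.
Proof.
intros Hw. induction N as [|N IH].
- cbv zeta. change (2 ^ 0)%nat with 1%nat. change (2 * 1)%nat with 2%nat. cbn [bsum].
  rewrite Cplus_0_l. replace (RtoC (INR 2)) with (RtoC 2) by (f_equal; simpl; ring).
  change (RtoC (INR 0)) with (RtoC 0). change (RtoC (INR 1)) with (RtoC 1).
  replace (w + 0) with w by ring. rewrite <- full_row_half by exact Hw. ring.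
- cbv zeta in *. set (P := (2 ^ N)%nat) in *.
  assert (EP : (2 ^ S N)%nat = (2 * P)%nat) by (unfold P; simpl; lia).
  assert (HP : (0 < P)%nat) by (unfold P; apply Nat.neq_0_lt_0, Nat.pow_nonzero; lia).
  rewrite EP. set (M := RtoC (INR (2 * P))) in *.
  assert (HM : M <> 0) by (apply INR_nz; lia).
  assert (EM : RtoC (INR (2 * (2 * P))) = 2 * M).
  { unfold M. rewrite (mult_INR 2 (2 * P)), RtoC_mult. f_equal. }
  rewrite EM.
  replace ((2 * M) ^ 4 * full_row w) with (16 * (M ^ 4 * full_row w)) by ring.
  rewrite IH, <- bsum_scal, bsum_fold. apply bsum_ext. intros j Hj.
  assert (NI : forall k : C, nome k = nome w -> nome (k / M) <> 1).
  { intros k Ek E. apply Hw. rewrite <- Ek. unfold M in E.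
    rewrite <- (nome_div_nat k (2 * P)) by lia. rewrite E.
    generalize (2 * P)%nat. intros n. induction n as [|n IHn]; simpl; [easy|]. rewrite IHn. ring. }
  rewrite Cmult_plus_distr_l.
  rewrite full_row_half by (apply NI, nome_add_nat).
  set (y := full_row ((w + RtoC (INR j)) / M / 2) + full_row (((w + RtoC (INR j)) / M - 1) / 2)).
  assert (E16 : 16 * full_row ((w - RtoC (INR (S j))) / M) =
    full_row ((w - RtoC (INR (S j))) / M / 2) + full_row (((w - RtoC (INR (S j))) / M + 1) / 2)).
  { assert (NI' : nome ((w - RtoC (INR (S j))) / M + 1) <> 1).
    { replace (RtoC 1) with (RtoC (INR 1)) at 1 by reflexivity. rewrite nome_add_nat.
      apply NI, nome_sub_nat. }
    assert (EL : full_row ((w - RtoC (INR (S j))) / M) = full_row ((w - RtoC (INR (S j))) / M + 1)).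
    { unfold full_row. replace (RtoC 1) with (RtoC (INR 1)) by reflexivity. now rewrite nome_add_nat. }
    rewrite EL, full_row_half by exact NI'. rewrite Cplus_comm. f_equal. f_equal. f_equal. ring. }
  rewrite E16. unfold y.
  assert (J : RtoC (INR (2 * P - 1 - j)) = M - 1 - RtoC (INR j)).
  { unfold M. rewrite !minus_INR by lia. rewrite !RtoC_minus. reflexivity. }
  assert (J' : RtoC (INR (S (2 * P - 1 - j))) = M - RtoC (INR j)).
  { rewrite S_INR, RtoC_plus, J. ring. }
  rewrite J', J.
  assert (SJ : RtoC (INR (S j)) = RtoC (INR j) + 1) by (rewrite S_INR, RtoC_plus; ring).
  rewrite SJ.
  replace ((w + RtoC (INR j)) / M / 2) with ((w + RtoC (INR j)) / (2 * M)) by (field; repeat split; auto; Cnz).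
  replace (((w + RtoC (INR j)) / M - 1) / 2) with ((w - (M - RtoC (INR j))) / (2 * M)) by (field; repeat split; auto; Cnz).
  replace ((w - (RtoC (INR j) + 1)) / M / 2) with ((w - (RtoC (INR j) + 1)) / (2 * M)) by (field; repeat split; auto; Cnz).
  replace (((w - (RtoC (INR j) + 1)) / M + 1) / 2) with ((w + (M - 1 - RtoC (INR j))) / (2 * M)) by (field; repeat split; auto; Cnz).
  ring.
Qed.

(** A lower bound for |w + n| that grows linearly in |n|. *)
Definition away (c : R) (w : C) : Prop := (0 < c)%R /\ forall j : nat,
  (c * INR (S j) <= Cmod (w + RtoC (INR j)))%R /\ (c * INR (S j) <= Cmod (w - RtoC (INR (S j))))%R.

Definition inv4 (w : C) : C := / w ^ 4.

(** Lipschitz's formula, by Herglotz's method: in the distribution relation each argument (w + j) / M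
    is close to the pole at 0, and replacing the function by its polar part costs
    O (1 / (M |w + j|^3)), which sums to O (1 / M). *)
Lemma full_row_lipschitz (w : C) (c : R) : nome w <> 1 -> away c w ->
  forall e : R, (0 < e)%R -> exists N0 : nat, forall N, (N0 <= N)%nat ->
  (Cmod (full_row w - bsum (fun j => inv4 (w + RtoC (INR j)) + inv4 (w - RtoC (INR (S j))))%C (2 ^ N)) < e)%R.
Proof.
intros Hw [Hc HA] e He. destruct full_row_pole as [K [HK E]].
set (B := (2 * (2 * (K * / c ^ 3)))%R).
assert (HB : (0 <= B)%R).
{ unfold B. assert (0 < / c ^ 3)%R by (apply Rinv_0_lt_compat, pow_lt, Hc). nra. }
destruct (INR_unbounded (8 * Cmod w + B / e + 1)) as [N0 HN0].
exists N0. intros N HN.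
assert (D := full_row_distribution w N Hw). cbv zeta in D.
set (P := (2 ^ N)%nat) in *.
assert (HNP : (N <= P)%nat) by (unfold P; apply Nat.lt_le_incl, Nat.pow_gt_lin_r; lia).
assert (HP : (0 < P)%nat) by (unfold P; apply Nat.neq_0_lt_0, Nat.pow_nonzero; lia).
set (m := INR (2 * P)) in *.
assert (Hm1 : (m = 2 * INR P)%R) by (unfold m; rewrite mult_INR; simpl; ring).
assert (HPN : (8 * Cmod w + B / e + 1 < INR P)%R).
{ eapply Rlt_le_trans; [exact HN0|]. apply le_INR. lia. }
assert (HBe : (0 <= B / e)%R) by (apply Rmult_le_pos; [exact HB|apply Rlt_le, Rinv_0_lt_compat, He]).
assert (Hcw := Cmod_ge_0 w).
assert (Hm : (0 < m)%R) by lra.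
assert (HMC : RtoC m <> 0) by (intros X; apply RtoC_inj in X; lra).
(* the cost of replacing one term by its polar part *)
assert (T : forall x k : C, (c * INR 1 <= Cmod x)%R -> x = w + k -> Im k = 0%R -> (Rabs (Re k) <= INR P)%R ->
   (Cmod (full_row (x / RtoC m) / RtoC m ^ 4 - inv4 x) <= K / m * / (Cmod x) ^ 3)%R).
{ intros x k Hx Ek Ik Hk.
  assert (Hx1 : (0 < Cmod x)%R) by (simpl in Hx; lra).
  assert (Hx0 : x <> 0) by now apply Cmod_gt_0.
  set (y := x / RtoC m).
  assert (Hy : y <> 0).
  { unfold y. intros X. apply Hx0. replace x with (x / RtoC m * RtoC m) by (field; exact HMC). rewrite X. ring. }
  assert (Ry : Re y = (Re x / m)%R).
  { unfold y, Cdiv. rewrite <- RtoC_inv by lra. destruct x; simpl. unfold Rdiv. ring. }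
  assert (Iy : Im y = (Im x / m)%R).
  { unfold y, Cdiv. rewrite <- RtoC_inv by lra. destruct x; simpl. unfold Rdiv. ring. }
  assert (Rw := Re_le_Cmod' w). assert (Iw := Im_le_Cmod' w).
  assert (RX : (Rabs (Re x) <= Cmod w + INR P)%R).
  { rewrite Ek. replace (Re (w + k)) with (Re w + Re k)%R by (destruct w, k; reflexivity).
    eapply Rle_trans; [apply Rabs_triang|]. lra. }
  assert (IX : (Rabs (Im x) <= Cmod w)%R).
  { rewrite Ek. replace (Im (w + k)) with (Im w + Im k)%R by (destruct w, k; reflexivity).
    rewrite Ik, Rplus_0_r. exact Iw. }
  specialize (E y Hy).
  assert (E' : (Cmod (y ^ 4 * full_row y - 1) <= K * Cmod y)%R).
  { apply E.
    - rewrite Ry. unfold Rdiv at 1. rewrite Rabs_mult, (Rabs_pos_eq (/ m)) by (apply Rlt_le, Rinv_0_lt_compat, Hm).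
      apply Rmult_le_reg_r with m; [exact Hm|]. rewrite Rmult_assoc, Rinv_l, Rmult_1_r by lra. lra.
    - rewrite Iy. unfold Rdiv at 1. rewrite Rabs_mult, (Rabs_pos_eq (/ m)) by (apply Rlt_le, Rinv_0_lt_compat, Hm).
      apply Rmult_le_reg_r with m; [exact Hm|]. rewrite Rmult_assoc, Rinv_l, Rmult_1_r by lra. lra. }
  replace (full_row y / RtoC m ^ 4 - inv4 x) with (inv4 x * (y ^ 4 * full_row y - 1)).
  2:{ unfold inv4, y. field. auto. }
  rewrite Cmod_mult. unfold inv4. rewrite Cmod_inv, Cmod_pow by (now apply Cpow_nz).
  apply Rle_trans with (/ Cmod x ^ 4 * (K * Cmod y))%R.
  - apply Rmult_le_compat_l; [|exact E']. apply Rlt_le, Rinv_0_lt_compat, pow_lt, Hx1.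
  - unfold y. rewrite Cmod_div, Cmod_real by (auto; lra). apply Req_le. field. lra. }
replace (full_row w) with (/ RtoC m ^ 4 * (RtoC m ^ 4 * full_row w)) by (field; exact HMC).
rewrite D, <- bsum_scal.
rewrite <- bsum_minus.
eapply Rle_lt_trans.
{ apply (bsum_sq_bound _ (2 * (K / m * / c ^ 3))).
  - apply Rmult_le_pos; [lra|]. apply Rmult_le_pos.
    + apply Rmult_le_pos; [exact HK|apply Rlt_le, Rinv_0_lt_compat, Hm].
    + apply Rlt_le, Rinv_0_lt_compat, pow_lt, Hc.
  - intros j Hj. destruct (HA j) as [A1 A2].
    assert (G1 := INR_S_ge1 j).
    assert (Hsj : (INR (S j) <= INR P)%R) by (apply le_INR; lia).
    assert (T1 := T (w + RtoC (INR j)) (RtoC (INR j))).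
    assert (T2 := T (w - RtoC (INR (S j))) (- RtoC (INR (S j)))).
    replace (/ RtoC m ^ 4 * (full_row ((w + RtoC (INR j)) / RtoC m) + full_row ((w - RtoC (INR (S j))) / RtoC m)) -
      (inv4 (w + RtoC (INR j)) + inv4 (w - RtoC (INR (S j))))) with
     ((full_row ((w + RtoC (INR j)) / RtoC m) / RtoC m ^ 4 - inv4 (w + RtoC (INR j))) +
      (full_row ((w - RtoC (INR (S j))) / RtoC m) / RtoC m ^ 4 - inv4 (w - RtoC (INR (S j))))) by (unfold Cdiv; ring).
    eapply Rle_trans; [apply Cmod_triangle|].
    assert (Hkm : (0 <= K / m)%R) by (apply Rmult_le_pos; [exact HK|apply Rlt_le, Rinv_0_lt_compat, Hm]).
    assert (FIN : forall x : C, (c * INR (S j) <= Cmod x)%R ->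
      (K / m * / Cmod x ^ 3 <= K / m * / c ^ 3 / INR (S j) ^ 2)%R).
    { intros x Hx. unfold Rdiv at 2. rewrite Rmult_assoc. apply Rmult_le_compat_l; [exact Hkm|].
      rewrite <- Rinv_mult. apply Rinv_le_contravar.
      - apply Rmult_lt_0_compat; apply pow_lt; lra.
      - apply Rle_trans with ((c * INR (S j)) ^ 3)%R.
        + rewrite Rpow_mult_distr. apply Rmult_le_compat_l; [apply Rlt_le, pow_lt, Hc|].
          apply Rle_pow; [exact G1|lia].
        + apply pow_incr. split; [|exact Hx]. apply Rmult_le_pos; lra. }
    assert (F1 := FIN _ A1). assert (F2 := FIN _ A2).
    assert (X1 : (c * INR 1 <= c * INR (S j))%R) by (apply Rmult_le_compat_l; [lra|simpl INR at 1; lra]).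
    assert (T1' := T1 ltac:(lra) eq_refl eq_refl).
    rewrite Rabs_pos_eq in T1' by (apply pos_INR). rewrite S_INR in Hsj.
    specialize (T1' ltac:(simpl; lra)).
    assert (T2' := T2 ltac:(lra) eq_refl ltac:(simpl; ring)).
    simpl Re in T2'. rewrite Rabs_Ropp, Rabs_pos_eq in T2' by (apply (pos_INR (S j))).
    specialize (T2' ltac:(rewrite <- S_INR in Hsj; exact Hsj)).
    replace (2 * (K / m * / c ^ 3) / INR (S j) ^ 2)%R with
     (K / m * / c ^ 3 / INR (S j) ^ 2 + K / m * / c ^ 3 / INR (S j) ^ 2)%R by (unfold Rdiv; ring).
    lra. }
replace (2 * (2 * (K / m * / c ^ 3)))%R with (B / m)%R by (unfold B, Rdiv; ring).
apply Rmult_lt_reg_r with m; [exact Hm|].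
unfold Rdiv. rewrite Rmult_assoc, Rinv_l, Rmult_1_r by lra.
replace B with (B / e * e)%R by (field; lra).
rewrite (Rmult_comm e). apply Rmult_lt_compat_r; [exact He|]. lra.
Qed.

(** * Limits of partial sums *)

Lemma Clim_const (l : C) : Clim (fun _ => l) l.
Proof.
intros e He. exists O. intros n _. replace (l - l) with (RtoC 0) by ring. now rewrite Cmod_0.
Qed.

Lemma Clim_plus v w a b : Clim v a -> Clim w b -> Clim (fun n => v n + w n) (a + b).
Proof.
intros Hv Hw e He. destruct (Hv (e / 2)%R) as [N1 H1]; [lra|].
destruct (Hw (e / 2)%R) as [N2 H2]; [lra|].
exists (max N1 N2). intros n Hn. specialize (H1 n ltac:(lia)). specialize (H2 n ltac:(lia)).
replace (v n + w n - (a + b)) with ((v n - a) + (w n - b)) by ring.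
eapply Rle_lt_trans; [apply Cmod_triangle|lra].
Qed.

Lemma Clim_scal c v a : Clim v a -> Clim (fun n => c * v n) (c * a).
Proof.
intros Hv e He. assert (P := Cmod_ge_0 c).
destruct (Hv (e / (Cmod c + 1))%R) as [N H]; [apply Rdiv_lt_0_compat; lra|].
exists N. intros n Hn. specialize (H n Hn).
replace (c * v n - c * a) with (c * (v n - a)) by ring. rewrite Cmod_mult.
apply Rmult_lt_compat_r with (r := (Cmod c + 1)%R) in H; [|lra].
replace (e / (Cmod c + 1) * (Cmod c + 1))%R with e in H by (field; lra).
pose proof (Cmod_ge_0 (v n - a)). nra.
Qed.

Lemma Clim_le (v : nat -> C) (l : C) (B : R) :
  (forall n, (Cmod (v n - l) <= B / INR (S n))%R) -> Clim v l.
Proof.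
intros H e He. destruct (INR_unbounded (Rabs B / e)) as [N HN].
exists N. intros n Hn. eapply Rle_lt_trans; [apply H|].
assert (P : (0 < INR (S n))%R) by (apply lt_0_INR; lia).
apply Rmult_lt_reg_r with (INR (S n)); [exact P|].
unfold Rdiv. rewrite Rmult_assoc, Rinv_l, Rmult_1_r by lra.
apply Rle_lt_trans with (Rabs B); [apply Rle_abs|].
apply Rmult_lt_compat_r with (r := e) in HN; [|exact He].
replace (Rabs B / e * e)%R with (Rabs B) in HN by (field; lra).
assert (INR N < INR (S n))%R by (apply lt_INR; lia). nra.
Qed.

Lemma bsum_Re a n : Re (bsum a (S n)) = sum_n (fun k => Re (a k)) n.
Proof.
induction n as [|n IH].
- rewrite sum_O. cbn [bsum]. now rewrite Cplus_0_l.
- rewrite sum_Sn, <- IH. reflexivity.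
Qed.

Lemma bsum_Im a n : Im (bsum a (S n)) = sum_n (fun k => Im (a k)) n.
Proof.
induction n as [|n IH].
- rewrite sum_O. cbn [bsum]. now rewrite Cplus_0_l.
- rewrite sum_Sn, <- IH. reflexivity.
Qed.

Lemma Clim_CSeries (a : nat -> C) : Cabs_conv a -> Clim (bsum a) (CSeries a).
Proof.
intros Ha.
assert (HR := Series_correct _ (ex_series_Rabs _ (Cabs_conv_Re _ Ha))).
assert (HI := Series_correct _ (ex_series_Rabs _ (Cabs_conv_Im _ Ha))).
assert (G : forall (f : nat -> R) (l : R), is_series f l -> forall e, (0 < e)%R ->
  exists N : nat, forall n, (N <= n)%nat -> (Rabs (sum_n f n - l) < e)%R).
{ intros f l H e He. change (is_lim_seq (sum_n f) (Finite l)) in H.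
  apply is_lim_seq_spec in H. destruct (H (mkposreal e He)) as [N HN]. exists N. exact HN. }
apply Clim_parts; intros e He.
- destruct (G _ _ HR e He) as [N HN]. exists (S N). intros [|n] Hn; [lia|].
  rewrite bsum_Re. apply HN. lia.
- destruct (G _ _ HI e He) as [N HN]. exists (S N). intros [|n] Hn; [lia|].
  rewrite bsum_Im. apply HN. lia.
Qed.

Lemma bsum_0 n : bsum (fun _ => 0) n = 0.
Proof. induction n as [|n IH]; simpl; [easy|]. rewrite IH. ring. Qed.

(** This inserts m zeros before each term of b. *)
Lemma CSeries_gap (a b : nat -> C) (m : nat) :
  Cabs_conv a -> Cabs_conv b ->
  (forall K, a (K * S m + m)%nat = b K) ->
  (forall K j, (j < m)%nat -> a (K * S m + j)%nat = 0) ->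
  CSeries a = CSeries b.
Proof.
intros Ha Hb H1 H0.
assert (E : forall K, bsum a (K * S m)%nat = bsum b K).
{ induction K as [|K IH]; [easy|].
  replace (S K * S m)%nat with (K * S m + S m)%nat by lia.
  rewrite bsum_add, IH. cbn [bsum]. rewrite H1.
  rewrite (bsum_ext (fun j => a (K * S m + j)%nat) (fun _ => 0) m) by (intros j Hj; now apply H0).
  rewrite bsum_0. ring. }
apply (Clim_unique (fun K => bsum a (K * S m)%nat)).
- apply (Clim_sub (bsum a) _ (fun K => (K * S m)%nat)); [now apply Clim_CSeries|].
  intros n. lia.
- apply Clim_ext with (bsum b); [now intros; rewrite E|]. now apply Clim_CSeries.
Qed.

(** * The Lambert series of sigma_3 *)

(** Multiplication by 1 - t takes differences of the coefficients. *)
Lemma qs_diff (a b : nat -> R) (t : C) : poly_growth a -> poly_growth b -> (Cmod t < 1)%R ->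
  a O = b O -> (forall m, b (S m) = (a (S m) - a m)%R) -> qs b t = (1 - t) * qs a t.
Proof.
intros Ha Hb Ht H0 HS.
rewrite (qs_first b t Hb Ht).
rewrite (qs_ext _ (fun m => (a (S m) + (-1) * a m)%R)) by (intros; rewrite HS; ring).
rewrite qs_plus, qs_scal; auto using shift_growth, poly_growth_scal.
assert (E := qs_first a t Ha Ht). rewrite <- H0.
replace (RtoC (-1)) with (- RtoC 1) by (rewrite <- RtoC_opp; reflexivity).
set (X := qs (fun n => a (S n)) t) in *. set (Y := qs a t) in *.
transitivity ((RtoC (a O) * t + t * X) - t * Y); [ring|]. rewrite <- E. ring.
Qed.

Lemma growth_le (a : nat -> R) (K : R) (p : nat) :
  (forall n, (Rabs (a n) <= K * INR (S n) ^ p)%R) -> poly_growth a.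
Proof. intros H. now exists K, p. Qed.

(** Four differences of the sequence of cubes leave 1, 4, 1. *)
Lemma qs_cubes (t : C) : (Cmod t < 1)%R -> qs (fun m => (INR (S m) ^ 3)%R) t = cube_series t.
Proof.
intros Ht.
set (d1 := fun m => (3 * INR m ^ 2 + 3 * INR m + 1)%R).
set (d2 := fun m => match m with O => 1%R | _ => (6 * INR m)%R end).
set (d3 := fun m => match m with O => 1%R | 1%nat => 5%R | _ => 6%R end).
set (d4 := fun m => match m with O => 1%R | 1%nat => 4%R | 2%nat => 1%R | _ => 0%R end).
assert (G0 : poly_growth (fun m => (INR (S m) ^ 3)%R)).
{ apply (growth_le _ 1 3). intros n. rewrite Rabs_pos_eq by apply pow_le, pos_INR. lra. }
assert (G1 : poly_growth d1).
{ apply (growth_le _ 7 2). intros n. unfold d1. rewrite S_INR. pose proof (pos_INR n).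
  rewrite Rabs_pos_eq; nra. }
assert (G2 : poly_growth d2).
{ apply (growth_le _ 6 1). intros n. unfold d2. rewrite S_INR. pose proof (pos_INR n).
  destruct n; [simpl; rewrite Rabs_pos_eq; lra|]. rewrite Rabs_pos_eq; lra. }
assert (G3 : poly_growth d3).
{ apply (growth_le _ 6 0). intros n. unfold d3. simpl.
  destruct n as [|[|n]]; rewrite Rabs_pos_eq; lra. }
assert (G4 : poly_growth d4).
{ apply (growth_le _ 6 0). intros n. unfold d4. simpl.
  destruct n as [|[|[|n]]]; rewrite Rabs_pos_eq; lra. }
assert (E1 : qs d1 t = (1 - t) * qs (fun m => (INR (S m) ^ 3)%R) t).
{ apply qs_diff; auto.
  - unfold d1. simpl. ring.
  - intros m. unfold d1. rewrite !S_INR. ring. }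
assert (E2 : qs d2 t = (1 - t) * qs d1 t).
{ apply qs_diff; auto.
  - unfold d1, d2. simpl. ring.
  - intros m. unfold d1, d2. rewrite !S_INR. ring. }
assert (E3 : qs d3 t = (1 - t) * qs d2 t).
{ apply qs_diff; auto. intros [|m]; unfold d2, d3.
  - simpl. ring.
  - rewrite !S_INR. ring. }
assert (E4 : qs d4 t = (1 - t) * qs d3 t).
{ apply qs_diff; auto. intros [|[|m]]; unfold d3, d4; ring. }
assert (Z : qs (fun _ => 0%R) t = 0).
{ unfold qs. rewrite (CSeries_ext _ (fun n => 0 * (RtoC 0 * t ^ S n))) by (intros; ring).
  rewrite CSeries_scal; [ring|]. apply qs_conv; [|exact Ht].
  apply (growth_le _ 0 0). intros n. rewrite Rabs_R0. lra. }
assert (E5 : qs d4 t = t * (1 + 4 * t + t ^ 2)).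
{ assert (G5 := shift_growth _ G4). assert (G6 := shift_growth _ G5).
  rewrite (qs_first _ _ G4 Ht), (qs_first _ _ G5 Ht), (qs_first _ _ G6 Ht).
  unfold d4. rewrite Z. ring. }
assert (N : 1 - t <> 0).
{ intros X. assert (Y : t = 1) by (replace t with (1 - (1 - t)) by ring; rewrite X; ring).
  rewrite Y, Cmod_1r in Ht. lra. }
rewrite E4, E3, E2, E1 in E5. unfold cube_series. rewrite <- E5. field. exact N.
Qed.

(** The part of sigma_3 (n) contributed by the codivisors n / d with d <= N. *)
Definition codivisor_sum (N n : nat) : nat :=
  list_sum (map (fun d => if Nat.eqb (n mod d) 0 then (n / d) ^ 3 else 0)%nat (seq 1 N)).

Lemma codivisor_sum_S N n : codivisor_sum (S N) n = (codivisor_sum N n + if Nat.eqb (n mod S N) 0 then (n / S N) ^ 3 else 0)%nat.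
Proof.
unfold codivisor_sum. rewrite seq_S, map_app, list_sum_app. 
f_equal. cbn. rewrite Nat.add_0_r. reflexivity.
Qed.

Lemma codivisor_sum_ge N n : (0 < n)%nat -> (n <= N)%nat -> codivisor_sum N n = sigma 3 n.
Proof.
intros Hn H. rewrite DivisorSums.sigma_codiv. fold (codivisor_sum n n).
induction H as [|N H IH]; [easy|].
rewrite codivisor_sum_S, IH. rewrite Nat.mod_small by lia.
destruct n; [lia|]. simpl. lia.
Qed.

Lemma codivisor_sum_le N n : (0 < n)%nat -> (codivisor_sum N n <= sigma 3 n)%nat.
Proof.
intros Hn. destruct (Nat.le_gt_cases n N) as [H|H]; [rewrite codivisor_sum_ge; auto|].
rewrite <- (codivisor_sum_ge n n) by lia.
assert (G : forall k, (codivisor_sum N n <= codivisor_sum (N + k) n)%nat).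
{ induction k as [|k IH]; [rewrite Nat.add_0_r; lia|]. rewrite Nat.add_succ_r, codivisor_sum_S. lia. }
specialize (G (n - N)%nat). now replace (N + (n - N))%nat with n in G by lia.
Qed.

(** The contribution of the single divisor d to the coefficient of q^(m + 1). *)
Definition codivisor_term (d m : nat) : R :=
  INR (if Nat.eqb (S m mod d) 0 then (S m / d) ^ 3 else 0).

Lemma cube_growth (f : nat -> nat) : (forall m, (f m <= S m ^ 3)%nat) -> poly_growth (fun m => INR (f m)).
Proof.
intros H. apply (growth_le _ 1 3). intros n. rewrite Rabs_pos_eq by apply pos_INR.
rewrite Rmult_1_l, <- pow_INR. apply le_INR, H.
Qed.

Lemma codivisor_term_growth d : poly_growth (codivisor_term d).
Proof.
apply cube_growth. intros m. destruct (Nat.eqb _ _); [|lia].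
apply Nat.pow_le_mono_l. destruct d as [|d]; [simpl; lia|]. apply Nat.Div0.div_le_upper_bound. lia.
Qed.

Lemma qs_codivisor_term (d : nat) (q : C) : (Cmod q < 1)%R -> qs (codivisor_term (S d)) q = cube_series (q ^ S d).
Proof.
intros Hq.
assert (Hqd : (Cmod (q ^ S d) < 1)%R).
{ rewrite Cmod_pow. pose proof (Cmod_ge_0 q).
  assert (Cmod q ^ d <= 1)%R by (rewrite <- (pow1 d); apply pow_incr; lra).
  change (Cmod q ^ S d)%R with (Cmod q * Cmod q ^ d)%R. nra. }
rewrite <- qs_cubes by exact Hqd. unfold qs. apply CSeries_gap with d.
- apply qs_conv; [apply codivisor_term_growth|exact Hq].
- apply qs_conv; [|exact Hqd]. apply (growth_le _ 1 3). intros n.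
  rewrite Rabs_pos_eq by apply pow_le, pos_INR. lra.
- intros K. unfold codivisor_term.
  replace (S (K * S d + d)) with (S K * S d)%nat by lia.
  rewrite Nat.Div0.mod_mul, Nat.div_mul by lia. cbn [Nat.eqb].
  rewrite pow_INR. f_equal. rewrite Nat.mul_comm. now rewrite Cpow_mult_r.
- intros K j Hj. unfold codivisor_term. replace (S (K * S d + j)) with (S j + K * S d)%nat by lia.
  rewrite Nat.Div0.mod_add, Nat.mod_small by lia. simpl. ring.
Qed.

(** The partial sum over d <= N has the right coefficients up to q^N, and smaller nonnegative ones
    beyond. *)
Lemma lambert (q : C) : (Cmod q < 1)%R ->
  Clim (bsum (fun d => cube_series (q ^ S d))) (qs (sigma_seq 3) q).
Proof.
intros Hq. assert (H0 := Cmod_ge_0 q).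
set (r := ((1 + Cmod q) / 2)%R). assert (Hr : (Cmod q < r < 1)%R) by (unfold r; lra).
set (e := fun N m => (sigma_seq 3 m - INR (codivisor_sum N (S m)))%R).
assert (GC : forall N, poly_growth (fun m => INR (codivisor_sum N (S m)))).
{ intros N. destruct (poly_growth_K _ (sigma_seq_growth 3)) as [K [p [K0 H]]].
  apply (growth_le _ K p). intros n. eapply Rle_trans; [|apply H].
  rewrite !Rabs_pos_eq by apply pos_INR. apply le_INR, codivisor_sum_le. lia. }
assert (E : forall N, bsum (fun d => cube_series (q ^ S d)) N = qs (fun m => INR (codivisor_sum N (S m))) q).
{ induction N as [|N IH].
  - simpl. unfold qs. rewrite (CSeries_ext _ (fun n => 0 * (RtoC 0 * q ^ S n))).
    + rewrite CSeries_scal; [ring|]. apply qs_conv; [|exact Hq].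
      apply (growth_le _ 0 0). intros n. rewrite Rabs_R0. lra.
    + intros n. unfold codivisor_sum. simpl. ring.
  - cbn [bsum]. rewrite IH, <- (qs_codivisor_term N q Hq), <- qs_plus by (auto; apply codivisor_term_growth).
    apply qs_ext. intros n. rewrite codivisor_sum_S, plus_INR. reflexivity. }
set (S3 := Series (fun m => Rabs (sigma_seq 3 m) * r ^ S m)%R).
assert (HS : ex_series (fun m => Rabs (sigma_seq 3 m) * r ^ S m)%R).
{ apply qs_conv_bound; [apply sigma_seq_growth|lra]. }
assert (HS0 : (0 <= S3)%R).
{ apply Series_pos; [|exact HS]. intros n. apply Rmult_le_pos; [apply Rabs_pos|apply pow_le; lra]. }
set (x := (Cmod q / r)%R).
assert (Hx : (0 <= x < 1)%R).
{ unfold x. split; [apply Rmult_le_pos; [lra|apply Rlt_le, Rinv_0_lt_compat; lra]|].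
  apply Rmult_lt_reg_r with r; [lra|]. unfold Rdiv. rewrite Rmult_assoc, Rinv_l; lra. }
assert (D : forall N, (Cmod (bsum (fun d => cube_series (q ^ S d))%C N - qs (sigma_seq 3) q) <= 2 * (x ^ N * S3))%R).
{ intros N. rewrite E.
  replace (qs (fun m => INR (codivisor_sum N (S m))) q - qs (sigma_seq 3) q) with (- (1) * qs (e N) q).
  2:{ unfold e. rewrite (qs_ext _ (fun m => (sigma_seq 3 m + (-1) * INR (codivisor_sum N (S m)))%R)) by (intros; ring).
      rewrite qs_plus, qs_scal; auto using sigma_seq_growth, poly_growth_scal.
      replace (RtoC (-1)) with (- RtoC 1) by (rewrite <- RtoC_opp; reflexivity). ring. }
  rewrite Cmod_mult, Cmod_opp, Cmod_1r, Rmult_1_l.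
  unfold S3. rewrite <- Series_scal_l. unfold qs. apply CSeries_bound_by.
  - intros n. rewrite Cmod_mult, Cmod_R, Cmod_pow.
    assert (Hle := codivisor_sum_le N (S n) ltac:(lia)).
    assert (HL := le_INR _ _ Hle). fold (sigma_seq 3 n) in HL.
    assert (P1 := pos_INR (codivisor_sum N (S n))). assert (P2 : (0 <= sigma_seq 3 n)%R) by apply pos_INR.
    assert (P3 : (0 <= r ^ S n)%R) by (apply pow_le; lra).
    assert (P4 : (0 <= x ^ N)%R) by (apply pow_le; lra).
    unfold e. rewrite Rabs_pos_eq by lra. rewrite (Rabs_pos_eq (sigma_seq 3 n)) by lra.
    destruct (Nat.le_gt_cases (S n) N) as [H|H].
    + rewrite codivisor_sum_ge by lia. fold (sigma_seq 3 n). rewrite Rminus_diag, Rmult_0_l.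
      apply Rmult_le_pos; [exact P4|]. apply Rmult_le_pos; assumption.
    + replace (Cmod q ^ S n)%R with (x ^ S n * r ^ S n)%R.
      2:{ rewrite <- Rpow_mult_distr. f_equal. unfold x. field. lra. }
      assert (X : (x ^ S n <= x ^ N)%R).
      { replace (S n) with (N + (S n - N))%nat by lia. rewrite pow_add.
        rewrite <- (Rmult_1_r (x ^ N)) at 2. apply Rmult_le_compat_l; [exact P4|].
        rewrite <- (pow1 (S n - N)). apply pow_incr. lra. }
      apply Rle_trans with (sigma_seq 3 n * (x ^ N * r ^ S n))%R; [|apply Req_le; ring].
      apply Rmult_le_compat; try lra.
      * apply Rmult_le_pos; [apply pow_le; lra|exact P3].
      * now apply Rmult_le_compat_r.
  - apply (@ex_series_scal R_AbsRing R_NormedModule). exact HS. }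
intros eps Heps.
destruct (pow_lt_1_zero x ltac:(rewrite Rabs_pos_eq; lra) (eps / (2 * S3 + 1))%R) as [N HN].
{ apply Rdiv_lt_0_compat; lra. }
exists N. intros n Hn. specialize (HN n Hn). eapply Rle_lt_trans; [apply D|].
rewrite Rabs_pos_eq in HN by (apply pow_le; lra).
apply Rmult_lt_compat_r with (r := (2 * S3 + 1)%R) in HN; [|lra].
replace (eps / (2 * S3 + 1) * (2 * S3 + 1))%R with eps in HN by (field; lra).
assert (0 <= x ^ n)%R by (apply pow_le; lra). nra.
Qed.

(** * The lattice sum of weight 4 *)

(** Sum of (w + n)^(-4) for - N <= n < N, the range of the distribution relation. *)
Definition window (w : C) (N : nat) : C :=
  bsum (fun j => inv4 (w + RtoC (INR j)) + inv4 (w - RtoC (INR (S j)))) N.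

(** The symmetric range - N <= n <= N, the one suited to the inversion of the lattice. *)
Definition row (w : C) (N : nat) : C :=
  inv4 w + bsum (fun j => inv4 (w + RtoC (INR (S j))) + inv4 (w - RtoC (INR (S j)))) N.

Lemma row_window w N : row w N = window w N + inv4 (w + RtoC (INR N)).
Proof.
unfold row, window. rewrite !bsum_plus.
assert (E : inv4 w + bsum (fun j => inv4 (w + RtoC (INR (S j)))) N =
  bsum (fun j => inv4 (w + RtoC (INR j))) N + inv4 (w + RtoC (INR N))).
{ change (bsum (fun j => inv4 (w + RtoC (INR j))) N + inv4 (w + RtoC (INR N)))
    with (bsum (fun j => inv4 (w + RtoC (INR j))) (S N)).
  rewrite bsum_first. f_equal. f_equal. simpl. ring. }
rewrite Cplus_assoc, E. ring.
Qed.

Lemma inv4_bound (c : R) (x : C) (n : nat) : (0 < c)%R -> (c * INR (S n) <= Cmod x)%R ->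
  (Cmod (inv4 x) <= / c ^ 4 / INR (S n) ^ 4)%R.
Proof.
intros Hc Hx. assert (P := INR_S_ge1 n).
assert (Q : (0 < c * INR (S n))%R) by (apply Rmult_lt_0_compat; lra).
unfold inv4. rewrite Cmod_inv by (apply Cpow_nz, Cmod_gt_0; lra). rewrite Cmod_pow.
unfold Rdiv. rewrite <- Rinv_mult, <- Rpow_mult_distr.
apply Rinv_le_contravar; [now apply pow_lt|]. apply pow_incr. lra.
Qed.

Lemma window_tail (w : C) (c : R) (N k : nat) : away c w ->
  (Cmod (window w (N + k) - window w N) <= 4 * / c ^ 4 / INR (S N) ^ 2)%R.
Proof.
intros [Hc HA]. unfold window. rewrite bsum_add.
match goal with |- (Cmod (?a + ?b - ?a) <= _)%R => replace (a + b - a) with b by ring end.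
assert (P := INR_S_ge1 N).
assert (Hc4 : (0 < / c ^ 4)%R) by (apply Rinv_0_lt_compat, pow_lt, Hc).
replace (4 * / c ^ 4 / INR (S N) ^ 2)%R with (2 * (2 * / c ^ 4 / INR (S N) ^ 2))%R by (unfold Rdiv; ring).
apply bsum_sq_bound.
{ apply Rmult_le_pos; [lra|]. apply Rlt_le, Rinv_0_lt_compat, pow_lt. lra. }
intros j _. destruct (HA (N + j)%nat) as [A1 A2].
eapply Rle_trans; [apply Cmod_triangle|].
assert (B1 := inv4_bound c _ _ Hc A1). assert (B2 := inv4_bound c _ _ Hc A2).
assert (G : (/ c ^ 4 / INR (S (N + j)) ^ 4 <= / c ^ 4 / INR (S N) ^ 2 / INR (S j) ^ 2)%R).
{ assert (PJ := INR_S_ge1 j). assert (PN := INR_S_ge1 (N + j)).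
  assert (L1 : (INR (S N) <= INR (S (N + j)))%R) by (apply le_INR; lia).
  assert (L2 : (INR (S j) <= INR (S (N + j)))%R) by (apply le_INR; lia).
  unfold Rdiv. rewrite Rmult_assoc. apply Rmult_le_compat_l; [lra|].
  rewrite <- Rinv_mult. apply Rinv_le_contravar.
  - apply Rmult_lt_0_compat; apply pow_lt; lra.
  - replace (INR (S (N + j)) ^ 4)%R with (INR (S (N + j)) ^ 2 * INR (S (N + j)) ^ 2)%R by ring.
    apply Rmult_le_compat; try (apply pow_le; lra); apply pow_incr; lra. }
replace (2 * / c ^ 4 / INR (S N) ^ 2 / INR (S j) ^ 2)%R with
 (/ c ^ 4 / INR (S N) ^ 2 / INR (S j) ^ 2 + / c ^ 4 / INR (S N) ^ 2 / INR (S j) ^ 2)%R by (unfold Rdiv; ring).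
lra.
Qed.

(** The error is O (1 / N^2) with a constant depending on c only, so
    the N rows of a box contribute an error that tends to 0. *)
Lemma row_full_row (w : C) (c : R) (N : nat) : nome w <> 1 -> away c w ->
  (Cmod (row w N - full_row w) <= 5 * / c ^ 4 / INR (S N) ^ 2)%R.
Proof.
intros Hw HA. assert (Hc := proj1 HA).
assert (Hc4 : (0 < / c ^ 4)%R) by (apply Rinv_0_lt_compat, pow_lt, Hc).
assert (P := INR_S_ge1 N).
assert (W : (Cmod (window w N - full_row w) <= 4 * / c ^ 4 / INR (S N) ^ 2)%R).
{ apply Rle_plus_epsilon. intros eps He.
  destruct (full_row_lipschitz w c Hw HA eps He) as [N0 H].
  set (n := max N N0). specialize (H n ltac:(unfold n; lia)).
  fold (window w (2 ^ n)) in H.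
  assert (Hn : (N <= 2 ^ n)%nat).
  { apply Nat.le_trans with n; [unfold n; lia|]. apply Nat.lt_le_incl, Nat.pow_gt_lin_r. lia. }
  assert (T := window_tail w c N (2 ^ n - N) HA).
  replace (N + (2 ^ n - N))%nat with (2 ^ n)%nat in T by lia.
  replace (window w N - full_row w) with (- (window w (2 ^ n) - window w N) + - (full_row w - window w (2 ^ n))) by ring.
  eapply Rle_trans; [apply Cmod_triangle|]. rewrite !Cmod_opp. lra. }
rewrite row_window.
replace (window w N + inv4 (w + RtoC (INR N)) - full_row w) with ((window w N - full_row w) + inv4 (w + RtoC (INR N))) by ring.
eapply Rle_trans; [apply Cmod_triangle|].
assert (B := inv4_bound c _ _ Hc (proj1 (proj2 HA N))).
assert (G : (/ c ^ 4 / INR (S N) ^ 4 <= / c ^ 4 / INR (S N) ^ 2)%R).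
{ unfold Rdiv. apply Rmult_le_compat_l; [lra|]. apply Rinv_le_contravar; [apply pow_lt; lra|].
  apply Rle_pow; [exact P|lia]. }
replace (5 * / c ^ 4 / INR (S N) ^ 2)%R with (4 * / c ^ 4 / INR (S N) ^ 2 + / c ^ 4 / INR (S N) ^ 2)%R
  by (unfold Rdiv; ring).
lra.
Qed.

(** One constant serves all the rows m z with m >= 1, because their imaginary parts grow with m. *)
Lemma away_lattice (z : C) : UpperHalfPlane z ->
  exists c : R, forall m : nat, away c (RtoC (INR (S m)) * z).
Proof.
unfold UpperHalfPlane. intros Hz. destruct z as [x y]. simpl in Hz.
pose proof (Rabs_pos x) as Hx.
set (c := Rmin (y / (1 + 2 * Rabs x)) (Rmin (/ 4) (y / 2))).
assert (Hc : (0 < c)%R).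
{ repeat apply Rmin_glb_lt; try lra. apply Rdiv_lt_0_compat; lra. }
assert (C1 : (c <= y / (1 + 2 * Rabs x))%R) by apply Rmin_l.
assert (C2 : (c <= / 4)%R) by (eapply Rle_trans; [apply Rmin_r|apply Rmin_l]).
assert (C3 : (c <= y / 2)%R) by (eapply Rle_trans; [apply Rmin_r|apply Rmin_r]).
exists c. intros m.
assert (G : forall n : R, (c * (1 + Rabs n) <= Cmod (RtoC (INR (S m)) * (x, y) + RtoC n))%R).
{ intros n. assert (M := INR_S_ge1 m). set (mm := INR (S m)) in *.
  set (v := RtoC mm * (x, y) + RtoC n).
  assert (Rv : Re v = (mm * x + n)%R) by (unfold v; simpl; ring).
  assert (Iv : Im v = (mm * y)%R) by (unfold v; simpl; ring).
  assert (V1 := Re_le_Cmod' v). assert (V2 := Im_le_Cmod' v). rewrite Rv in V1. rewrite Iv in V2.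
  rewrite (Rabs_pos_eq (mm * y)) in V2 by (apply Rmult_le_pos; lra).
  pose proof (Rabs_pos n) as Hn.
  destruct (Rle_dec (Rabs n) (2 * mm * Rabs x)) as [H|H].
  - apply Rmult_le_compat_r with (r := (1 + 2 * Rabs x)%R) in C1; [|lra].
    replace (y / (1 + 2 * Rabs x) * (1 + 2 * Rabs x))%R with y in C1 by (field; lra).
    apply Rle_trans with (mm * (c * (1 + 2 * Rabs x)))%R.
    + replace (mm * (c * (1 + 2 * Rabs x)))%R with (c * (mm + 2 * mm * Rabs x))%R by ring.
      apply Rmult_le_compat_l; lra.
    + apply Rle_trans with (mm * y)%R; [|exact V2]. apply Rmult_le_compat_l; lra.
  - assert (T : (Rabs n <= Rabs (mm * x + n) + mm * Rabs x)%R).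
    { replace n with ((mm * x + n) + - (mm * x))%R at 1 by ring.
      eapply Rle_trans; [apply Rabs_triang|]. rewrite Rabs_Ropp, Rabs_mult, (Rabs_pos_eq mm) by lra. lra. }
    assert (y <= mm * y)%R by nra.
    assert (c * Rabs n <= / 4 * Rabs n)%R by (apply Rmult_le_compat_r; lra).
    lra. }
split; [exact Hc|]. intros j. assert (PJ := pos_INR j). split.
- specialize (G (INR j)). rewrite Rabs_pos_eq in G by exact PJ. rewrite S_INR. 
  replace (INR j + 1)%R with (1 + INR j)%R by ring. exact G.
- specialize (G (- INR (S j))%R). rewrite Rabs_Ropp, Rabs_pos_eq in G by apply pos_INR.
  rewrite RtoC_opp in G. unfold Cminus. eapply Rle_trans; [|exact G].
  apply Rmult_le_compat_l; lra.
Qed.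

(** Half of the sum of (m z + n)^(-4) over the nonzero (m, n) with |m|, |n| <= N.  The truncation
    is to squares because the inversion z -> - 1 / z then becomes an exact symmetry. *)
Definition box (z : C) (N : nat) : C :=
  bsum (fun k => inv4 (RtoC (INR (S k)))) N + bsum (fun m => row (RtoC (INR (S m)) * z) N) N.

Lemma bsum_swap (F : nat -> nat -> C) M N :
  bsum (fun i => bsum (fun j => F i j) N) M = bsum (fun j => bsum (fun i => F i j) M) N.
Proof.
induction M as [|M IH]; simpl.
- now rewrite bsum_0.
- rewrite IH, <- bsum_plus. reflexivity.
Qed.

(** The map (m, n) -> (n, - m) permutes the box. *)
Lemma box_S (z : C) (N : nat) : UpperHalfPlane z -> box (- / z) N = z ^ 4 * box z N.
Proof.
intros Hz. unfold UpperHalfPlane in Hz.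
assert (Z0 : z <> 0) by (intros E; rewrite E in Hz; simpl in Hz; lra).
assert (NZ : forall m n : R, (0 < m)%R -> RtoC m * z + RtoC n <> 0).
{ intros m n Hm E. apply (f_equal Im) in E. destruct z as [x y]. simpl in *. nra. }
assert (PS : forall k, (0 < INR (S k))%R) by (intros; apply lt_0_INR; lia).
assert (Q : forall a b : C, a <> 0 -> b <> 0 -> (a = z * b \/ a = - (z * b)) -> z ^ 4 * inv4 a = inv4 b).
{ intros a b Ha Hb [->| ->]; unfold inv4; field; auto. }
assert (RS : forall k, RtoC (INR (S k)) <> 0) by (intros k; apply INR_nz; lia).
assert (NZ1 : forall i, RtoC (INR (S i)) * z <> 0) by (intros; now apply Cmult_neq_0).
assert (NZ2 : forall i j, RtoC (INR (S i)) * z + RtoC (INR (S j)) <> 0) by (intros; now apply NZ).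
assert (NZ3 : forall i j, RtoC (INR (S i)) * z - RtoC (INR (S j)) <> 0).
{ intros i j. unfold Cminus. rewrite <- RtoC_opp. now apply NZ. }
unfold box, row. rewrite !bsum_plus.
assert (E1 : bsum (fun m => inv4 (RtoC (INR (S m)) * - / z)) N =
  z ^ 4 * bsum (fun k => inv4 (RtoC (INR (S k)))) N).
{ rewrite <- bsum_scal. apply bsum_ext. intros k _. symmetry. apply Q; auto.
  - intros E. apply (RS k). replace (RtoC (INR (S k))) with (- z * (RtoC (INR (S k)) * - / z)) by (field; auto).
    rewrite E. ring.
  - right. field. auto. }
assert (E2 : bsum (fun k => inv4 (RtoC (INR (S k)))) N =
  z ^ 4 * bsum (fun m => inv4 (RtoC (INR (S m)) * z)) N).
{ rewrite <- bsum_scal. apply bsum_ext. intros k _. symmetry. apply Q; auto. left. ring. }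
match goal with |- (_ + (_ + ?A) = z ^ 4 * (_ + (_ + ?B))) => assert (E3 : A = z ^ 4 * B) end.
{ rewrite bsum_swap, <- bsum_scal. apply bsum_ext. intros j _. rewrite <- bsum_scal. apply bsum_ext. intros i _.
  rewrite Cmult_plus_distr_l, Cplus_comm. f_equal; symmetry.
  + apply Q; auto; [|right; field; auto].
    intros E. apply (NZ2 j i). replace (RtoC (INR (S j)) * z + RtoC (INR (S i))) with
      (- z * (RtoC (INR (S i)) * - / z - RtoC (INR (S j)))) by (field; auto).
    rewrite E. ring.
  + apply Q; auto; [|left; field; auto].
    intros E. apply (NZ3 j i). replace (RtoC (INR (S j)) * z - RtoC (INR (S i))) with
      (z * (RtoC (INR (S i)) * - / z + RtoC (INR (S j)))) by (field; auto).
    rewrite E. ring. }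
rewrite E1, E3. rewrite E2 at 1. ring.
Qed.

(** * The value of zeta(4) *)

Definition zeta4 (N : nat) : C := bsum (fun k => inv4 (RtoC (INR (S k)))) N.

Lemma inv4_RtoC (x : R) : x <> 0%R -> inv4 (RtoC x) = RtoC (/ x ^ 4).
Proof.
intros Hx. unfold inv4. rewrite <- RtoC_pow, <- RtoC_inv by (now apply pow_nonzero). reflexivity.
Qed.

Lemma zeta4_conv : exists l : R, Clim zeta4 (RtoC l).
Proof.
assert (Hp : forall k, inv4 (RtoC (INR (S k))) = RtoC (/ INR (S k) ^ 4)).
{ intros k. apply inv4_RtoC. apply not_0_INR. lia. }
assert (Im0 : forall N, Im (zeta4 N) = 0%R).
{ intros N. unfold zeta4. induction N as [|N IH]; [reflexivity|]. cbn [bsum].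
  rewrite Hp. replace (Im (bsum (fun k => inv4 (RtoC (INR (S k)))) N + RtoC (/ INR (S N) ^ 4)))
    with (Im (bsum (fun k => inv4 (RtoC (INR (S k)))) N) + 0)%R by reflexivity. rewrite IH. ring. }
assert (B : forall N, (Cmod (zeta4 N) <= 2 * 1)%R).
{ intros N. apply bsum_sq_bound; [lra|]. intros j _. rewrite Hp, Cmod_real.
  - unfold Rdiv. rewrite Rmult_1_l. pose proof (INR_S_ge1 j).
    apply Rinv_le_contravar; [apply pow_lt; lra|]. apply Rle_pow; [lra|lia].
  - apply Rlt_le, Rinv_0_lt_compat, pow_lt, lt_0_INR. lia. }
destruct (ex_finite_lim_seq_incr (fun N => Re (zeta4 N)) 2) as [l Hl].
- intros N. unfold zeta4. cbn [bsum]. rewrite Hp.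
  replace (Re (bsum (fun k => inv4 (RtoC (INR (S k)))) N + RtoC (/ INR (S N) ^ 4)))
    with (Re (bsum (fun k => inv4 (RtoC (INR (S k)))) N) + / INR (S N) ^ 4)%R by reflexivity.
  assert (0 < / INR (S N) ^ 4)%R by (apply Rinv_0_lt_compat, pow_lt, lt_0_INR; lia). lra.
- intros N. specialize (B N). eapply Rle_trans; [apply Rle_abs|].
  eapply Rle_trans; [apply Re_le_Cmod'|lra].
- exists l. apply Clim_parts.
  + intros e He. apply is_lim_seq_spec in Hl. destruct (Hl (mkposreal e He)) as [N HN].
    exists N. exact HN.
  + intros e He. exists O. intros n _. rewrite Im0, Rminus_diag, Rabs_R0. exact He.
Qed.

Lemma bsum_even_odd F P : bsum F (2 * P) = bsum (fun j => F (2 * j)%nat + F (S (2 * j))) P.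
Proof.
induction P as [|P IH]; [easy|].
replace (2 * S P)%nat with (S (S (2 * P))) by lia. cbn [bsum]. rewrite IH. ring.
Qed.

Lemma nome_half : nome (/ 2) = - (1).
Proof.
replace (/ 2) with (1 - / 2) by (field; Cnz). rewrite nome_half_neg. f_equal.
assert (E := nome_add_nat 0 1). rewrite Cplus_0_l in E. simpl INR in E. rewrite E.
unfold nome. replace (2 * PI * Ci * 0) with (RtoC 0) by ring. apply Cexp_0.
Qed.

(** At w = 1/2 Lipschitz's formula evaluates the sum over the odd integers, and the even ones
    contribute one sixteenth of the whole. *)
Lemma zeta4_lim : Clim zeta4 (RtoC (PI ^ 4 / 90)).
Proof.
destruct zeta4_conv as [l Hl].
assert (L : forall e : R, (0 < e)%R -> exists N0 : nat, forall N, (N0 <= N)%nat ->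
  (Cmod (full_row (/ 2) - bsum (fun j => inv4 (/ 2 + RtoC (INR j)) + inv4 (/ 2 - RtoC (INR (S j))))%C (2 ^ N)) < e)%R).
{ apply full_row_lipschitz with (c := (/ 2)%R).
  - rewrite nome_half. intros E. apply (f_equal Re) in E. simpl in E. lra.
  - split; [lra|]. intros j. assert (P := pos_INR j).
    assert (E : RtoC (/ 2) = / 2) by (rewrite RtoC_inv; [reflexivity|lra]).
    rewrite <- E, S_INR. split.
    + rewrite <- RtoC_plus, Cmod_real; lra.
    + rewrite <- RtoC_minus, Cmod_R, Rabs_left; lra. }
assert (V : full_row (/ 2) = RtoC (PI ^ 4 / 3)).
{ unfold full_row, cube_series. rewrite nome_half. rewrite RtoC_div, RtoC_pow by lra. field. all: Cnz. }
assert (T : forall j, inv4 (/ 2 + RtoC (INR j)) + inv4 (/ 2 - RtoC (INR (S j))) =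
   32 * inv4 (RtoC (INR (S (2 * j))))).
{ intros j. assert (N : RtoC (INR (S (2 * j))) <> 0) by (apply INR_nz; lia).
  assert (E : RtoC (INR (S (2 * j))) = 2 * RtoC (INR j) + 1).
  { rewrite S_INR, mult_INR, RtoC_plus, RtoC_mult. reflexivity. }
  rewrite E in *. rewrite S_INR, RtoC_plus.
  replace (/ 2 + RtoC (INR j)) with ((2 * RtoC (INR j) + 1) / 2) by (field; Cnz).
  replace (/ 2 - (RtoC (INR j) + 1)) with (- ((2 * RtoC (INR j) + 1) / 2)) by (field; Cnz).
  unfold inv4. field. repeat split; auto; Cnz. }
assert (D : Clim (fun n => zeta4 (2 * 2 ^ n)) (RtoC (PI ^ 4 / 96) + RtoC (/ 16) * RtoC l)).
{ apply Clim_ext with (fun n => RtoC (/ 32) * (bsum (fun j => inv4 (/ 2 + RtoC (INR j)) + inv4 (/ 2 - RtoC (INR (S j)))) (2 ^ n)) +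
     RtoC (/ 16) * zeta4 (2 ^ n)).
  - intros n. unfold zeta4. rewrite bsum_even_odd, <- !bsum_scal, <- bsum_plus.
    apply bsum_ext. intros j _. rewrite T.
    replace (S (S (2 * j))) with (2 * S j)%nat by lia.
    rewrite (mult_INR 2 (S j)), RtoC_mult, !RtoC_inv by lra.
    replace (RtoC (INR 2)) with (RtoC 2) by (f_equal; simpl; ring).
    assert (N : RtoC (INR (S j)) <> 0) by (apply INR_nz; lia).
    assert (N' : RtoC (INR (S (2 * j))) <> 0) by (apply INR_nz; lia).
    unfold inv4. field. repeat split; auto; Cnz.
  - apply Clim_plus.
    + replace (RtoC (PI ^ 4 / 96)) with (RtoC (/ 32) * RtoC (PI ^ 4 / 3)) by (rewrite <- RtoC_mult; f_equal; field).
      apply Clim_scal. intros e He. destruct (L e He) as [N HN]. exists N. intros n Hn.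
      specialize (HN n Hn). rewrite V in HN. rewrite <- Cmod_opp.
      match goal with |- (Cmod (- (?a - ?b)) < _)%R => replace (- (a - b)) with (b - a) by ring end. exact HN.
    + apply Clim_scal. apply (Clim_sub zeta4 _ (fun n => (2 ^ n)%nat)); [exact Hl|].
      intros n. simpl. pose proof (Nat.pow_nonzero 2 n). lia. }
assert (D' : Clim (fun n => zeta4 (2 * 2 ^ n)) (RtoC l)).
{ apply (Clim_sub zeta4 _ (fun n => (2 * 2 ^ n)%nat)); [exact Hl|].
  intros n. simpl. pose proof (Nat.pow_nonzero 2 n). lia. }
assert (E := Clim_unique _ _ _ D D'). rewrite <- RtoC_mult, <- RtoC_plus in E. apply RtoC_inj in E.
replace (PI ^ 4 / 90)%R with l by lra. exact Hl.
Qed.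

(** * The behaviour of g_1, g_2, g_3 under z -> -1/z *)

Lemma bsum_bound (H : nat -> C) (B : R) n : (forall j, (j < n)%nat -> (Cmod (H j) <= B)%R) ->
  (Cmod (bsum H n) <= INR n * B)%R.
Proof.
induction n as [|n IH]; intros Hj.
- simpl. rewrite Cmod_0. lra.
- cbn [bsum]. eapply Rle_trans; [apply Cmod_triangle|]. rewrite S_INR.
  specialize (IH ltac:(intros; apply Hj; lia)). specialize (Hj n ltac:(lia)). lra.
Qed.

Lemma nome_mul (z : C) (n : nat) : nome (RtoC (INR n) * z) = nome z ^ n.
Proof. unfold nome. rewrite <- Cexp_nat. f_equal. ring. Qed.

Lemma pow_lt_1 (q : C) (d : nat) : (Cmod q < 1)%R -> (Cmod (q ^ S d) < 1)%R.
Proof.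
intros Hq. rewrite Cmod_pow. pose proof (Cmod_ge_0 q).
assert (Cmod q ^ d <= 1)%R by (rewrite <- (pow1 d); apply pow_incr; lra).
change (Cmod q ^ S d)%R with (Cmod q * Cmod q ^ d)%R. nra.
Qed.

Lemma box_lim (z : C) : UpperHalfPlane z ->
  Clim (box z) (RtoC (PI ^ 4 / 90) * (1 + 240 * qs (sigma_seq 3) (nome z))).
Proof.
intros Hz. assert (Hq := nome_lt_1 z Hz). destruct (away_lattice z Hz) as [c Hc].
assert (Hc4 : (0 < / c ^ 4)%R) by (apply Rinv_0_lt_compat, pow_lt, (proj1 (Hc O))).
replace (RtoC (PI ^ 4 / 90) * (1 + 240 * qs (sigma_seq 3) (nome z))) with
  (RtoC (PI ^ 4 / 90) + (8 / 3 * RtoC PI ^ 4 * qs (sigma_seq 3) (nome z) + 0)).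
2:{ rewrite RtoC_div, RtoC_pow by lra. field; repeat split; Cnz. }
apply Clim_ext with (fun N => zeta4 N + (8 / 3 * RtoC PI ^ 4 * bsum (fun d => cube_series (nome z ^ S d)) N +
   bsum (fun m => row (RtoC (INR (S m)) * z) N - full_row (RtoC (INR (S m)) * z)) N)).
{ intros N. unfold box. fold (zeta4 N). f_equal. rewrite bsum_minus, <- bsum_scal.
  rewrite (bsum_ext (fun j => full_row (RtoC (INR (S j)) * z)) (fun j => 8 / 3 * RtoC PI ^ 4 * cube_series (nome z ^ S j))).
  - ring.
  - intros j _. unfold full_row. now rewrite nome_mul. }
apply Clim_plus; [apply zeta4_lim|]. apply Clim_plus; [apply Clim_scal, lambert, Hq|].
apply (Clim_le _ _ (5 * / c ^ 4)). intros N.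
match goal with |- (Cmod (?a - _) <= _)%R => replace (a - 0) with a by ring end.
assert (P := INR_S_ge1 N).
eapply Rle_trans.
- apply (bsum_bound _ (5 * / c ^ 4 / INR (S N) ^ 2)). intros j _. apply row_full_row; [|apply Hc].
  rewrite nome_mul. intros E. assert (X := pow_lt_1 _ j Hq). rewrite E, Cmod_1r in X. lra.
- rewrite S_INR in *. pose proof (pos_INR N). set (x := INR N) in *.
  replace (x * (5 * / c ^ 4 / (x + 1) ^ 2))%R with (5 * / c ^ 4 / (x + 1) * (x / (x + 1)))%R by (pose proof (proj1 (Hc O)); field; split; lra).
  rewrite <- (Rmult_1_r (5 * / c ^ 4 / (x + 1))) at 2.
  apply Rmult_le_compat_l.
  + apply Rmult_le_pos; [lra|apply Rlt_le, Rinv_0_lt_compat; lra].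
  + apply Rmult_le_reg_r with (x + 1)%R; [lra|]. unfold Rdiv. rewrite Rmult_assoc, Rinv_l; lra.
Qed.

Lemma UHP_inv z : UpperHalfPlane z -> UpperHalfPlane (- / z).
Proof.
unfold UpperHalfPlane. destruct z as [x y]. simpl. intros Hy.
replace (- (- y / (x * (x * 1) + y * (y * 1))))%R with (y / (x * x + y * y))%R by (field; nra).
apply Rdiv_lt_0_compat; nra.
Qed.

(** Both sides are limits of box sums, up to the same constant. *)
Lemma g2_S z : UpperHalfPlane z -> g 2 (- / z) = z ^ 4 * g 2 z.
Proof.
intros Hz. assert (L1 := box_lim z Hz). assert (L2 := box_lim _ (UHP_inv z Hz)).
assert (E := Clim_unique _ _ _ (Clim_ext _ _ _ (fun N => box_S z N Hz) L2) (Clim_scal (z ^ 4) _ _ L1)).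
rewrite !g2_eq.
assert (HP : RtoC (PI ^ 4 / 90) <> 0).
{ intros X. apply RtoC_inj in X. assert (0 < PI ^ 4)%R by (apply pow_lt, PI_RGT_0). lra. }
set (a := 1 + 240 * qs (sigma_seq 3) (nome (- / z))) in *. set (b := 1 + 240 * qs (sigma_seq 3) (nome z)) in *.
assert (F : a = z ^ 4 * b).
{ transitivity (/ RtoC (PI ^ 4 / 90) * (RtoC (PI ^ 4 / 90) * a)); [field; exact HP|].
  rewrite E. field. exact HP. }
rewrite F. ring.
Qed.

Lemma Cmult_integral (x y : C) : x * y = 0 -> x = 0 \/ y = 0.
Proof.
intros H. destruct (Ceq_dec x 0) as [E|E]; [now left|]. destruct (Ceq_dec y 0) as [F|F]; [now right|].
now apply Cmult_neq_0 in H.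
Qed.

Lemma UHP_neq_0 z : UpperHalfPlane z -> z <> 0.
Proof. unfold UpperHalfPlane. intros H E. rewrite E in H. simpl in H. lra. Qed.

Lemma UHP_open z : UpperHalfPlane z -> near0 (fun h => UpperHalfPlane (z + h)).
Proof.
unfold UpperHalfPlane. intros Hz. exists (Im z). split; [exact Hz|].
intros h Hh. assert (I := Im_le_Cmod' h). apply Rabs_le_between in I.
replace (Im (z + h)) with (Im z + Im h)%R by (destruct z, h; reflexivity). lra.
Qed.

Lemma Cderiv_eq_UHP (f k : C -> C) (z a b : C) :
  (forall z, UpperHalfPlane z -> f z = k z) -> UpperHalfPlane z ->
  Cderiv f z a -> Cderiv k z b -> a = b.
Proof.
intros E Hz Hf Hk. apply (Cderiv_unique k z); [|exact Hk].
apply Cderiv_ext_near with f; [|exact Hf].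
generalize (UHP_open z Hz). apply near0_imp. intros h Hh. now apply E.
Qed.

(** Statements are made for all solutions of the system because two are compared: g and its
    transform under z -> - 1 / z. *)
Definition solution (f1 f2 f3 : C -> C) : Prop := forall z, UpperHalfPlane z ->
  Cderiv f1 z (f1 z ^ 2 - / 12 * f2 z) /\
  Cderiv f2 z (4 * f1 z * f2 z - 6 * f3 z) /\
  Cderiv f3 z (6 * f1 z * f3 z - / 3 * f2 z ^ 2).

Lemma solution_g : solution (g 1) (g 2) (g 3).
Proof. intros z Hz. split; [|split]; [now apply Cderiv_g1|now apply Cderiv_g2|now apply Cderiv_g3]. Qed.

Lemma solution_second f1 f2 f3 z : solution f1 f2 f3 -> UpperHalfPlane z ->
  Cderiv (fun z => 4 * f1 z * f2 z - 6 * f3 z) z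
    (20 * f1 z ^ 2 * f2 z - 60 * f1 z * f3 z + 5 / 3 * f2 z ^ 2).
Proof.
intros H Hz. destruct (H z Hz) as [H1 [H2 H3]]. eapply Cderiv_val.
- apply Cderiv_minus.
  + apply Cderiv_mult; [apply Cderiv_mult; [apply Cderiv_const|exact H1]|exact H2].
  + apply Cderiv_mult; [apply Cderiv_const|exact H3].
- cbv beta. field; Cnz.
Qed.

Lemma solution_disc f1 f2 f3 z : solution f1 f2 f3 -> UpperHalfPlane z ->
  Cderiv (fun z => 27 * f3 z ^ 2 - f2 z ^ 3) z (12 * f1 z * (27 * f3 z ^ 2 - f2 z ^ 3)).
Proof.
intros H Hz. destruct (H z Hz) as [H1 [H2 H3]]. eapply Cderiv_val.
- apply Cderiv_minus.
  + apply Cderiv_mult; [apply Cderiv_const|]. apply Cderiv_pow, H3.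
  + apply Cderiv_pow, H2.
- cbv beta. simpl INR. simpl pred.
  replace (RtoC (1 + 1 + 1)) with (RtoC 3) by (f_equal; ring).
  replace (RtoC (1 + 1)) with (RtoC 2) by (f_equal; ring).
  field; Cnz.
Qed.

(** Let d be the difference of the first components.  The equation for the second component gives
    that of the third ones as (2/3) d g_2, and its derivative gives d (d g_2 + 3 g_3) = 0 pointwise.
    Either way the third components agree up to sign, so the discriminants agree; their
    logarithmic derivatives are 12 times the first components. *)
Lemma solution_determined f1 f3 : solution f1 (g 2) f3 ->
  forall z, UpperHalfPlane z -> f1 z = g 1 z /\ f3 z = g 3 z.
Proof.
intros H. assert (G := solution_g).
assert (R1 : forall z, UpperHalfPlane z -> 4 * f1 z * g 2 z - 6 * f3 z = 4 * g 1 z * g 2 z - 6 * g 3 z).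
{ intros z Hz. apply (Cderiv_unique (g 2) z); [apply (H z Hz)|apply (G z Hz)]. }
assert (R2 : forall z, UpperHalfPlane z ->
   20 * f1 z ^ 2 * g 2 z - 60 * f1 z * f3 z + 5 / 3 * g 2 z ^ 2 =
   20 * g 1 z ^ 2 * g 2 z - 60 * g 1 z * g 3 z + 5 / 3 * g 2 z ^ 2).
{ intros z Hz. apply (Cderiv_eq_UHP _ _ z _ _ R1 Hz); now apply solution_second. }
assert (E3 : forall z, UpperHalfPlane z -> f3 z ^ 2 = g 3 z ^ 2).
{ intros z Hz. specialize (R1 z Hz). specialize (R2 z Hz).
  set (d := f1 z - g 1 z).
  assert (F1 : f1 z = g 1 z + d) by (unfold d; ring).
  assert (F3 : f3 z = g 3 z + 2 / 3 * d * g 2 z).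
  { replace (f3 z) with (/ 6 * (4 * f1 z * g 2 z - (4 * f1 z * g 2 z - 6 * f3 z))) by (field; Cnz).
    rewrite R1, F1. field; Cnz. }
  rewrite F1, F3 in R2. rewrite F3.
  assert (P : d * (d * g 2 z + 3 * g 3 z) = 0).
  { replace (d * (d * g 2 z + 3 * g 3 z)) with
     (- / 20 * ((20 * (g 1 z + d) ^ 2 * g 2 z - 60 * (g 1 z + d) * (g 3 z + 2 / 3 * d * g 2 z) + 5 / 3 * g 2 z ^ 2)
       - (20 * g 1 z ^ 2 * g 2 z - 60 * g 1 z * g 3 z + 5 / 3 * g 2 z ^ 2))) by (field; Cnz).
    rewrite R2. ring. }
  destruct (Cmult_integral _ _ P) as [D0|D0].
  - rewrite D0. field; Cnz.
  - replace (g 3 z + 2 / 3 * d * g 2 z) with (2 / 3 * (d * g 2 z + 3 * g 3 z) - g 3 z) by (field; Cnz).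
    rewrite D0. field; Cnz. }
assert (E1 : forall z, UpperHalfPlane z -> f1 z = g 1 z).
{ intros z Hz.
  assert (X : 12 * f1 z * (27 * f3 z ^ 2 - g 2 z ^ 3) = 12 * g 1 z * (27 * g 3 z ^ 2 - g 2 z ^ 3)).
  { apply (Cderiv_eq_UHP (fun z => 27 * f3 z ^ 2 - g 2 z ^ 3) (fun z => 27 * g 3 z ^ 2 - g 2 z ^ 3) z).
    - intros x Hx. now rewrite E3.
    - exact Hz.
    - now apply solution_disc.
    - now apply solution_disc. }
  rewrite E3 in X by exact Hz. fold (Dg z) in X. assert (N := Dg_neq_0 z Hz).
  replace (f1 z) with (12 * f1 z * Dg z / (12 * Dg z)) by (field; repeat split; auto; Cnz).
  rewrite X. field; repeat split; auto; Cnz. }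
intros z Hz. split; [now apply E1|].
specialize (R1 z Hz). rewrite (E1 z Hz) in R1.
replace (f3 z) with (/ 6 * (4 * g 1 z * g 2 z - (4 * g 1 z * g 2 z - 6 * f3 z))) by (field; Cnz).
rewrite R1. field; Cnz.
Qed.

Lemma Cderiv_neg_inv (z : C) : z <> 0 -> Cderiv (fun z => - / z) z (/ (z * z)).
Proof.
intros Hz. eapply Cderiv_val; [apply Cderiv_opp, Cderiv_inv, Hz|]. field. exact Hz.
Qed.

Lemma Cderiv_inv_pow (f : C -> C) (l z : C) (n : nat) : UpperHalfPlane z ->
  Cderiv f (- / z) l ->
  Cderiv (fun z => f (- / z) / z ^ S n) z (l / z ^ S (S (S n)) - RtoC (INR (S n)) * f (- / z) / z ^ S (S n)).
Proof.
intros Hz Hf. assert (Z0 := UHP_neq_0 z Hz).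
assert (P : forall k, z ^ k <> 0) by (intros; now apply Cpow_nz).
eapply Cderiv_val.
- apply Cderiv_div; [|apply Cderiv_pow, Cderiv_id|apply P].
  apply (Cderiv_comp f (fun z => - / z)); [exact Hf|now apply Cderiv_neg_inv].
- cbv beta. simpl pred. simpl Cpow. field. repeat split; auto.
Qed.

(** The correction - 1 / z in the first component absorbs the derivative of the powers of z. *)
Lemma solution_S : solution (fun z => g 1 (- / z) / z ^ 2 - / z) (fun z => g 2 (- / z) / z ^ 4)
  (fun z => g 3 (- / z) / z ^ 6).
Proof.
intros z Hz. assert (Z0 := UHP_neq_0 z Hz).
destruct (solution_g _ (UHP_inv z Hz)) as [H1 [H2 H3]]. split; [|split].
- eapply Cderiv_val.
  + apply Cderiv_minus; [apply (Cderiv_inv_pow (g 1) _ z 1 Hz H1)|apply Cderiv_inv, Z0].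
  + cbv beta. replace (RtoC (INR 2)) with (RtoC 2) by (f_equal; simpl; ring). field; repeat split; auto; Cnz.
- eapply Cderiv_val.
  + apply (Cderiv_inv_pow (g 2) _ z 3 Hz H2).
  + cbv beta. replace (RtoC (INR 4)) with (RtoC 4) by (f_equal; simpl; ring). field; repeat split; auto; Cnz.
- eapply Cderiv_val.
  + apply (Cderiv_inv_pow (g 3) _ z 5 Hz H3).
  + cbv beta. replace (RtoC (INR 6)) with (RtoC 6) by (f_equal; simpl; ring). field; repeat split; auto; Cnz.
Qed.

Lemma g13_S z : UpperHalfPlane z -> g 1 (- / z) = z ^ 2 * g 1 z + z /\ g 3 (- / z) = z ^ 6 * g 3 z.
Proof.
assert (X : solution (fun z => g 1 (- / z) / z ^ 2 - / z) (g 2) (fun z => g 3 (- / z) / z ^ 6)).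
{ assert (E : forall z, UpperHalfPlane z -> g 2 (- / z) / z ^ 4 = g 2 z).
  { intros x Hx. assert (X0 := UHP_neq_0 x Hx). rewrite g2_S by exact Hx. field. exact X0. }
  intros x Hx. destruct (solution_S x Hx) as [H1 [H2 H3]]. cbv beta in *.
  rewrite (E x Hx) in H1, H2, H3. split; [exact H1|split; [|exact H3]].
  apply Cderiv_ext_near with (2 := H2).
  generalize (UHP_open x Hx). apply near0_imp. intros h Hh. now apply E. }
intros Hz. assert (Z0 := UHP_neq_0 z Hz).
destruct (solution_determined _ _ X z Hz) as [E1 E3]. cbv beta in E1, E3.
rewrite <- E1, <- E3. split; field; exact Z0.
Qed.

(** * The modular group acting on the parametrization *)

Lemma C3_eq (a b c a' b' c' : C) : a = a' -> b = b' -> c = c' -> (a, b, c) = (a', b', c').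
Proof. now intros -> -> ->. Qed.

Lemma disc_u z c2 c4 : 27 * pr3 (u z c2 c4) ^ 2 - pr2 (u z c2 c4) ^ 3 = Dg z * (c4 * z - c2) ^ 12.
Proof. unfold u, pr2, pr3, Dg. cbn [fst snd]. ring. Qed.

Lemma u_in_T z c2 c4 : U z c2 c4 -> T (u z c2 c4).
Proof.
intros [Hz [_ Hw]]. unfold T. rewrite disc_u.
apply Cmult_neq_0; [now apply Dg_neq_0|now apply Cpow_nz].
Qed.

Lemma nome_add1 z : nome (z + 1) = nome z.
Proof. exact (nome_add_nat z 1). Qed.

Lemma g_periodic z : g 1 (z + 1) = g 1 z /\ g 2 (z + 1) = g 2 z /\ g 3 (z + 1) = g 3 z.
Proof. rewrite !g1_eq, !g2_eq, !g3_eq, nome_add1. auto. Qed.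

Lemma pair_neq (a b : C) : (a <> 0 \/ b <> 0) <-> (a, b) <> (RtoC 0, RtoC 0).
Proof.
split.
- intros [Ha|Hb] E; [apply Ha; exact (f_equal fst E)|apply Hb; exact (f_equal snd E)].
- intros H. destruct (Ceq_dec a 0) as [->|Ha]; [|now left].
  destruct (Ceq_dec b 0) as [->|Hb]; [|now right]. now exfalso.
Qed.

(** Besides the point, the image has to be preserved: this is what allows points of a fixed image to
    be moved into the fundamental domain, at the price of other parameters. *)
Definition equiv_par (z c2 c4 z' c2' c4' : C) : Prop :=
  U z' c2' c4' /\ u z c2 c4 = u z' c2' c4' /\
  forall t, u_image c2 c4 t <-> u_image c2' c4' t.

Lemma equiv_par_trans z c2 c4 z' c2' c4' z'' c2'' c4'' :
  equiv_par z c2 c4 z' c2' c4' -> equiv_par z' c2' c4' z'' c2'' c4'' -> equiv_par z c2 c4 z'' c2'' c4''.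
Proof.
intros [_ [E I]] [H' [E' I']]. split; [exact H'|]. split; [congruence|].
intros t. rewrite I. apply I'.
Qed.

Lemma equiv_par_refl z c2 c4 : U z c2 c4 -> equiv_par z c2 c4 z c2 c4.
Proof. intros H. split; [exact H|]. split; [easy|]. easy. Qed.

Lemma u_T z c2 c4 : u (z + 1) (c2 + c4) c4 = u z c2 c4.
Proof.
destruct (g_periodic z) as [E1 [E2 E3]]. unfold u. rewrite E1, E2, E3. apply C3_eq; ring.
Qed.

Lemma U_T z c2 c4 : U z c2 c4 -> U (z + 1) (c2 + c4) c4.
Proof.
intros [Hz [Hc Hw]]. split; [|split].
- unfold UpperHalfPlane in *. destruct z; simpl in *. lra.
- apply pair_neq. apply pair_neq in Hc. destruct (Ceq_dec c4 0) as [->|N]; [|now right].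
  left. destruct Hc as [Hc|Hc]; [|easy]. now replace (c2 + 0) with c2 by ring.
- now replace (c4 * (z + 1) - (c2 + c4)) with (c4 * z - c2) by ring.
Qed.

Lemma U_T_inv z c2 c4 : U z (c2 + c4) c4 -> U (z - 1) c2 c4.
Proof.
intros [Hz [Hc Hw]]. split; [|split].
- unfold UpperHalfPlane in *. destruct z; simpl in *. lra.
- apply pair_neq. apply pair_neq in Hc. destruct (Ceq_dec c4 0) as [->|N]; [|now right].
  left. destruct Hc as [Hc|Hc]; [|easy]. now replace c2 with (c2 + 0) by ring.
- now replace (c4 * (z - 1) - c2) with (c4 * z - (c2 + c4)) by ring.
Qed.

Lemma image_T c2 c4 t : u_image c2 c4 t <-> u_image (c2 + c4) c4 t.
Proof.
split; intros [z [H ->]].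
- exists (z + 1). split; [now apply U_T|]. now rewrite u_T.
- exists (z - 1). split; [now apply U_T_inv|]. rewrite <- (u_T (z - 1) c2 c4). f_equal. ring.
Qed.

Lemma equiv_par_T z c2 c4 : U z c2 c4 -> equiv_par z c2 c4 (z + 1) (c2 + c4) c4.
Proof.
intros H. split; [now apply U_T|]. split; [now rewrite u_T|]. intros t. apply image_T.
Qed.

Lemma equiv_par_T_inv z c2 c4 : U z c2 c4 -> equiv_par z c2 c4 (z - 1) (c2 - c4) c4.
Proof.
intros H. assert (E : c2 = (c2 - c4) + c4) by ring.
split; [apply U_T_inv; now rewrite <- E|]. split.
- rewrite <- (u_T (z - 1) (c2 - c4) c4). f_equal; ring.
- intros t. rewrite E at 1. symmetry. apply image_T.
Qed.

Lemma equiv_par_translate (n : nat) z c2 c4 : U z c2 c4 ->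
  (exists c, equiv_par z c2 c4 (z + RtoC (INR n)) c c4) /\ (exists c, equiv_par z c2 c4 (z - RtoC (INR n)) c c4).
Proof.
intros H. induction n as [|n [[c Hc] [d Hd]]].
- simpl. split; exists c2.
  + replace (z + 0) with z by ring. now apply equiv_par_refl.
  + replace (z - 0) with z by ring. now apply equiv_par_refl.
- rewrite S_INR, RtoC_plus. split.
  + exists (c + c4). replace (z + (RtoC (INR n) + 1)) with (z + RtoC (INR n) + 1) by ring.
    apply equiv_par_trans with (1 := Hc). apply equiv_par_T, (proj1 Hc).
  + exists (d - c4). replace (z - (RtoC (INR n) + 1)) with (z - RtoC (INR n) - 1) by ring.
    apply equiv_par_trans with (1 := Hd). apply equiv_par_T_inv, (proj1 Hd).
Qed.

Lemma equiv_par_strip z c2 c4 : U z c2 c4 -> exists z' c, equiv_par z c2 c4 z' c c4 /\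
  (Rabs (Re z') <= / 2)%R /\ Im z' = Im z.
Proof.
intros H.
assert (N : exists k : Z, (Rabs (Re z - IZR k) <= / 2)%R).
{ exists (up (Re z - / 2)). destruct (archimed (Re z - / 2)) as [A B].
  apply Rabs_le. lra. }
destruct N as [k Hk]. destruct (Z_le_gt_dec 0 k) as [P|P].
- destruct (proj2 (equiv_par_translate (Z.to_nat k) z c2 c4 H)) as [c Hc].
  exists (z - RtoC (INR (Z.to_nat k))), c. split; [exact Hc|].
  rewrite INR_IZR_INZ, Z2Nat.id by lia. split.
  + replace (Re (z - RtoC (IZR k))) with (Re z - IZR k)%R by (destruct z; reflexivity). exact Hk.
  + destruct z; simpl; ring.
- destruct (proj1 (equiv_par_translate (Z.to_nat (- k)) z c2 c4 H)) as [c Hc].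
  exists (z + RtoC (INR (Z.to_nat (- k)))), c. split; [exact Hc|].
  rewrite INR_IZR_INZ, Z2Nat.id by lia. rewrite opp_IZR. split.
  + replace (Re (z + RtoC (- IZR k))) with (Re z - IZR k)%R by (destruct z; reflexivity). exact Hk.
  + destruct z; simpl; ring.
Qed.

Lemma u_S z c2 c4 : UpperHalfPlane z -> u (- / z) (- c4) c2 = u z c2 c4.
Proof.
intros Hz. assert (Z0 := UHP_neq_0 z Hz).
destruct (g13_S z Hz) as [E1 E3]. assert (E2 := g2_S z Hz).
unfold u. rewrite E1, E2, E3. apply C3_eq; field; exact Z0.
Qed.

Lemma U_S z c2 c4 : U z c2 c4 -> U (- / z) (- c4) c2.
Proof.
intros [Hz [Hc Hw]]. assert (Z0 := UHP_neq_0 z Hz). split; [now apply UHP_inv|]. split.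
- apply pair_neq. apply pair_neq in Hc. destruct Hc as [Hc|Hc]; [now right|left].
  intros E. apply Hc. replace c4 with (- - c4) by ring. rewrite E. ring.
- intros E. apply Hw. replace (c4 * z - c2) with (z * (c2 * - / z - - c4)) by (field; exact Z0).
  rewrite E. ring.
Qed.

Lemma image_S_sub c2 c4 t : u_image c2 c4 t -> u_image (- c4) c2 t.
Proof.
intros [z [H ->]]. exists (- / z). split; [now apply U_S|]. now rewrite u_S by apply H.
Qed.

(** The inversion applied twice. *)
Lemma image_neg c2 c4 t : u_image c2 c4 t <-> u_image (- c2) (- c4) t.
Proof.
assert (E : forall z c2 c4, U z c2 c4 -> U z (- c2) (- c4)).
{ intros z a b H. assert (X := U_S _ _ _ (U_S _ _ _ H)).
  assert (Z0 := UHP_neq_0 z (proj1 H)).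
  replace (- / - / z) with z in X by (field; exact Z0). exact X. }
assert (V : forall z c2 c4, u z (- c2) (- c4) = u z c2 c4) by (intros; unfold u; apply C3_eq; ring).
split; intros [z [H ->]]; exists z.
- split; [now apply E|]. now rewrite V.
- split; [|now rewrite V]. apply E in H.
  replace (- - c2) with c2 in H by ring. now replace (- - c4) with c4 in H by ring.
Qed.

Lemma equiv_par_S z c2 c4 : U z c2 c4 -> equiv_par z c2 c4 (- / z) (- c4) c2.
Proof.
intros H. split; [now apply U_S|]. split; [now rewrite u_S by apply H|].
intros t. split; [apply image_S_sub|]. intros X. apply image_neg.
now apply image_S_sub in X.
Qed.

(** Translations bring a point into the strip |Re| <= 1/2.  If its height is then below 1/2, its squared
    modulus is at most 1/2 and the inversion at least doubles its height. *)
Lemma equiv_par_reduce_aux (n : nat) : forall z c2 c4, U z c2 c4 -> (/ 2 ^ S n <= Im z)%R ->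
  exists z' c2' c4', equiv_par z c2 c4 z' c2' c4' /\ (Rabs (Re z') <= / 2)%R /\ (/ 2 <= Im z')%R.
Proof.
induction n as [|n IH]; intros z c2 c4 H HI;
  destruct (equiv_par_strip z c2 c4 H) as [z1 [c [S1 [R1 I1]]]].
- exists z1, c, c4. split; [exact S1|]. split; [exact R1|]. rewrite I1. simpl in HI. lra.
- destruct (Rle_dec (/ 2) (Im z1)) as [L|L]; [now exists z1, c, c4|].
  assert (S2 := equiv_par_S _ _ _ (proj1 S1)).
  assert (HU := proj1 (proj1 S1)). unfold UpperHalfPlane in HU.
  assert (I2 : (/ 2 ^ S n <= Im (- / z1))%R).
  { destruct z1 as [x y]. simpl in R1, I1, L, HU.
    replace (Im (- / (x, y))) with (y / (x * x + y * y))%R by (simpl; field; nra).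
    assert (Hx : (x * x <= / 4)%R).
    { apply Rabs_le_between in R1. nra. }
    assert (D : (0 < x * x + y * y <= / 2)%R) by nra.
    apply Rle_trans with (2 * y)%R.
    - rewrite I1. replace (/ 2 ^ S n)%R with (2 * / 2 ^ S (S n))%R; [lra|].
      simpl. field. apply pow_nonzero. lra.
    - apply Rmult_le_reg_r with (x * x + y * y)%R; [lra|].
      replace (y / (x * x + y * y) * (x * x + y * y))%R with y by (field; lra). nra. }
  destruct (IH _ _ _ (proj1 S2) I2) as [z' [c2' [c4' [S3 [R3 I3]]]]].
  exists z', c2', c4'. split; [|auto].
  apply equiv_par_trans with (1 := S1). apply equiv_par_trans with (1 := S2). exact S3.
Qed.

Lemma equiv_par_reduce z c2 c4 : U z c2 c4 ->
  exists z' c2' c4', equiv_par z c2 c4 z' c2' c4' /\ (Rabs (Re z') <= / 2)%R /\ (/ 2 <= Im z')%R.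
Proof.
intros H. assert (Hz := proj1 H). unfold UpperHalfPlane in Hz.
destruct (pow_lt_1_zero (/ 2) ltac:(rewrite Rabs_pos_eq; lra) (Im z) Hz) as [n Hn].
apply (equiv_par_reduce_aux n); [exact H|]. specialize (Hn (S n) ltac:(lia)).
rewrite pow_inv in Hn. rewrite Rabs_pos_eq in Hn; [lra|].
apply Rlt_le, Rinv_0_lt_compat, pow_lt. lra.
Qed.

(** * Arithmetic of limits *)

Lemma Clim_bounded v l : Clim v l -> exists N, forall n, (N <= n)%nat -> (Cmod (v n) <= Cmod l + 1)%R.
Proof.
intros H. destruct (H 1%R Rlt_0_1) as [N HN]. exists N. intros n Hn. specialize (HN n Hn).
replace (v n) with ((v n - l) + l) by ring. eapply Rle_trans; [apply Cmod_triangle|lra].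
Qed.

Lemma Clim_away v l : Clim v l -> l <> 0 -> exists N, forall n, (N <= n)%nat -> (Cmod l / 2 <= Cmod (v n))%R.
Proof.
intros H Hl. assert (P := proj1 (Cmod_gt_0 l) Hl).
destruct (H (Cmod l / 2)%R) as [N HN]; [lra|]. exists N. intros n Hn. specialize (HN n Hn).
assert (T := Cmod_triangle_sub (v n) (v n - l)). replace (v n - (v n - l)) with l in T by ring. lra.
Qed.

Lemma Clim_mult v w a b : Clim v a -> Clim w b -> Clim (fun n => v n * w n) (a * b).
Proof.
intros Hv Hw e He. destruct (Clim_bounded _ _ Hv) as [N0 H0].
assert (P := Cmod_ge_0 a). assert (Q := Cmod_ge_0 b).
destruct (Hv (e / (2 * (Cmod b + 1)))%R) as [N1 H1]; [apply Rdiv_lt_0_compat; lra|].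
destruct (Hw (e / (2 * (Cmod a + 1)))%R) as [N2 H2]; [apply Rdiv_lt_0_compat; lra|].
exists (max N0 (max N1 N2)). intros n Hn.
specialize (H0 n ltac:(lia)). specialize (H1 n ltac:(lia)). specialize (H2 n ltac:(lia)).
replace (v n * w n - a * b) with (v n * (w n - b) + (v n - a) * b) by ring.
eapply Rle_lt_trans; [apply Cmod_triangle|]. rewrite !Cmod_mult.
assert (B1 : (Cmod (v n) * Cmod (w n - b) <= (Cmod a + 1) * Cmod (w n - b))%R)
  by (apply Rmult_le_compat_r; [apply Cmod_ge_0|exact H0]).
assert (B2 : ((Cmod a + 1) * Cmod (w n - b) < e / 2)%R).
{ apply Rmult_lt_compat_l with (r := (Cmod a + 1)%R) in H2; [|lra].
  replace ((Cmod a + 1) * (e / (2 * (Cmod a + 1))))%R with (e / 2)%R in H2 by (field; lra). exact H2. }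
assert (B3 : (Cmod (v n - a) * Cmod b <= e / 2)%R).
{ apply Rmult_lt_compat_r with (r := (Cmod b + 1)%R) in H1; [|lra].
  replace (e / (2 * (Cmod b + 1)) * (Cmod b + 1))%R with (e / 2)%R in H1 by (field; lra).
  pose proof (Cmod_ge_0 (v n - a)). nra. }
lra.
Qed.

Lemma Clim_pow v a k : Clim v a -> Clim (fun n => v n ^ k) (a ^ k).
Proof.
intros H. induction k as [|k IH]; simpl; [apply Clim_const|]. now apply Clim_mult.
Qed.

Lemma Cinv_nz (x : C) : x <> 0 -> / x <> 0.
Proof.
intros Hx E. assert (X : x * / x = 1) by (field; exact Hx). rewrite E in X.
apply (f_equal Re) in X. simpl in X. lra.
Qed.

Lemma Clim_inv (v : nat -> C) (a : C) : a <> 0 -> Clim v a -> Clim (fun n => / v n) (/ a).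
Proof. intros Ha H. exact (Clim_deriv (fun x => / x) a _ v (Cderiv_inv a Ha) H). Qed.

Lemma Clim_minus v w a b : Clim v a -> Clim w b -> Clim (fun n => v n - w n) (a - b).
Proof.
intros Hv Hw. replace (a - b) with (a + - (1) * b) by ring.
apply Clim_ext with (fun n => v n + - (1) * w n); [intros; ring|].
apply Clim_plus; [exact Hv|]. now apply Clim_scal.
Qed.

Lemma extraction_shift N : extraction (fun n => n + N)%nat.
Proof. intros n. lia. Qed.

(** * Properness modulo the modular group *)

(** The discriminant of (t2, t3) is the limit of D(z_n) w_n^12.  Since it is nonzero, g_2^3 / D is bounded
    along the sequence, so that z_n remains in a compact set by cusp_bound; then D(z_n) is bounded
    below and w_n is bounded too. *)
Lemma fundamental_compact (z w : nat -> C) (t2 t3 : C) :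
  (forall n, (Rabs (Re (z n)) <= / 2)%R /\ (/ 2 <= Im (z n))%R /\ w n <> 0) ->
  Clim (fun n => g 2 (z n) * w n ^ 4) t2 -> Clim (fun n => g 3 (z n) * w n ^ 6) t3 ->
  27 * t3 ^ 2 - t2 ^ 3 <> 0 ->
  exists (phi : nat -> nat) (z0 w0 : C), extraction phi /\
    Clim (fun n => z (phi n)) z0 /\ Clim (fun n => w (phi n)) w0 /\
    UpperHalfPlane z0 /\ w0 <> 0 /\ g 2 z0 * w0 ^ 4 = t2 /\ g 3 z0 * w0 ^ 6 = t3.
Proof.
intros HF L2 L3 HD.
assert (HU : forall n, UpperHalfPlane (z n)) by (intros n; unfold UpperHalfPlane; specialize (HF n); lra).
set (D := 27 * t3 ^ 2 - t2 ^ 3) in *.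
assert (LD : Clim (fun n => Dg (z n) * w n ^ 12) D).
{ apply Clim_ext with (fun n => 27 * (g 3 (z n) * w n ^ 6) ^ 2 - (g 2 (z n) * w n ^ 4) ^ 3).
  - intros n. unfold Dg. ring.
  - apply Clim_minus; [apply Clim_scal|]; now apply Clim_pow. }
assert (HD0 := proj1 (Cmod_gt_0 D) HD).
destruct (Clim_bounded _ _ L2) as [N1 B1]. destruct (Clim_away _ _ LD HD) as [N2 B2].
set (B := ((Cmod t2 + 1) ^ 3 / (Cmod D / 2))%R).
destruct (cusp_bound B) as [Y HY].
set (N := max N1 N2).
assert (BI : forall n, (Im (z (n + N)%nat) <= Y)%R).
{ intros n. set (k := (n + N)%nat). specialize (B1 k ltac:(unfold k, N; lia)).
  specialize (B2 k ltac:(unfold k, N; lia)).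
  apply HY; [apply HU|].
  assert (W : (0 < Cmod (w k))%R) by (apply Cmod_gt_0, HF).
  assert (W12 : (0 < Cmod (w k) ^ 12)%R) by now apply pow_lt.
  apply Rmult_le_reg_r with (Cmod (w k) ^ 12)%R; [exact W12|].
  replace (Cmod (g 2 (z k)) ^ 3 * Cmod (w k) ^ 12)%R with (Cmod (g 2 (z k) * w k ^ 4) ^ 3)%R
    by (rewrite Cmod_mult, Cmod_pow; ring).
  replace (B * Cmod (Dg (z k)) * Cmod (w k) ^ 12)%R with (B * Cmod (Dg (z k) * w k ^ 12))%R
    by (rewrite (Cmod_mult (Dg (z k))), Cmod_pow; ring).
  apply Rle_trans with ((Cmod t2 + 1) ^ 3)%R; [apply pow_incr; split; [apply Cmod_ge_0|exact B1]|].
  replace ((Cmod t2 + 1) ^ 3)%R with (B * (Cmod D / 2))%R by (unfold B; field; lra).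
  apply Rmult_le_compat_l; [|exact B2]. unfold B. apply Rmult_le_pos.
  - apply pow_le. pose proof (Cmod_ge_0 t2). lra.
  - apply Rlt_le, Rinv_0_lt_compat. lra. }
destruct (complex_BW (fun n => z (n + N)%nat) (/ 2 + Rabs Y)) as [phi [z0 [Hphi Lz]]].
{ intros n. eapply Rle_trans; [apply Cmod_le_sum|]. destruct (HF (n + N)%nat) as [F1 [F2 _]].
  specialize (BI n). rewrite (Rabs_pos_eq (Im _)) by lra. pose proof (Rle_abs Y). lra. }
assert (Hz0 : UpperHalfPlane z0).
{ unfold UpperHalfPlane. destruct (Clim_im _ _ Lz (/ 4)%R ltac:(lra)) as [k Hk].
  specialize (Hk k ltac:(lia)). destruct (HF (phi k + N)%nat) as [_ [F2 _]].
  apply Rabs_lt_between in Hk. lra. }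
assert (LDz : Clim (fun n => Dg (z (phi n + N)%nat)) (Dg z0)).
{ apply (Clim_deriv Dg z0 _ _ (Cderiv_Dg z0 Hz0) Lz). }
assert (HDz := Dg_neq_0 z0 Hz0). assert (HDz0 := proj1 (Cmod_gt_0 _) HDz).
destruct (Clim_away _ _ LDz HDz) as [N3 B3].
destruct (Clim_bounded _ _ LD) as [N4 B4].
set (b := ((Cmod D + 1) / (Cmod (Dg z0) / 2))%R).
assert (Hb : (0 <= b)%R).
{ unfold b. apply Rmult_le_pos; [lra|apply Rlt_le, Rinv_0_lt_compat; lra]. }
destruct (complex_BW (fun n => w (phi (n + max N3 N4) + N)%nat) (1 + b)) as [psi [w0 [Hpsi Lw]]].
{ intros n. set (m := (n + max N3 N4)%nat). specialize (B3 m ltac:(unfold m; lia)).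
  set (k := (phi m + N)%nat) in *.
  assert (Hk : (N4 <= k)%nat).
  { pose proof (extraction_ge phi Hphi m). unfold k, m in *. lia. }
  specialize (B4 k Hk). rewrite Cmod_mult, Cmod_pow in B4.
  apply Rnot_lt_le. intros X.
  assert (X12 : (b < Cmod (w k) ^ 12)%R).
  { apply Rlt_le_trans with (Cmod (w k)); [lra|]. rewrite <- (pow_1 (Cmod (w k))) at 1.
    apply Rle_pow; [lra|lia]. }
  assert (Y1 : (Cmod (Dg z0) / 2 * Cmod (w k) ^ 12 <= Cmod D + 1)%R).
  { eapply Rle_trans; [|exact B4]. apply Rmult_le_compat_r; [apply pow_le, Cmod_ge_0|exact B3]. }
  apply Rmult_lt_compat_l with (r := (Cmod (Dg z0) / 2)%R) in X12; [|lra].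
  replace (Cmod (Dg z0) / 2 * b)%R with (Cmod D + 1)%R in X12 by (unfold b; field; lra). lra. }
set (theta := fun n => (phi (psi n + max N3 N4) + N)%nat).
assert (Htheta : extraction theta).
{ apply (extraction_comp (fun n => n + N)%nat (fun n => phi (psi n + max N3 N4)%nat)); [apply extraction_shift|].
  apply (extraction_comp phi (fun n => (psi n + max N3 N4)%nat)); [exact Hphi|].
  apply (extraction_comp (fun n => n + max N3 N4)%nat psi); [apply extraction_shift|exact Hpsi]. }
assert (Lz' : Clim (fun n => z (theta n)) z0).
{ apply (Clim_sub _ _ (fun n => (psi n + max N3 N4)%nat) Lz).
  apply (extraction_comp (fun n => n + max N3 N4)%nat psi); [apply extraction_shift|exact Hpsi]. }
assert (E2 : g 2 z0 * w0 ^ 4 = t2).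
{ apply (Clim_unique (fun n => g 2 (z (theta n)) * w (theta n) ^ 4)).
  - apply Clim_mult; [apply (Clim_deriv _ _ _ _ (Cderiv_g2 z0 Hz0) Lz')|now apply Clim_pow].
  - exact (Clim_sub _ _ theta L2 Htheta). }
assert (E3 : g 3 z0 * w0 ^ 6 = t3).
{ apply (Clim_unique (fun n => g 3 (z (theta n)) * w (theta n) ^ 6)).
  - apply Clim_mult; [apply (Clim_deriv _ _ _ _ (Cderiv_g3 z0 Hz0) Lz')|now apply Clim_pow].
  - exact (Clim_sub _ _ theta L3 Htheta). }
exists theta, z0, w0. split; [exact Htheta|]. split; [exact Lz'|]. split; [exact Lw|].
split; [exact Hz0|]. split; [|split; [exact E2|exact E3]].
intros W. apply HD. unfold D. rewrite <- E2, <- E3, W. simpl. ring.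
Qed.

(** * Surjectivity *)

(** Up to a constant factor, the modular invariant. *)
Definition jinv (z : C) : C := g 2 z ^ 3 / Dg z.

Lemma Cderiv_jinv z : UpperHalfPlane z -> Cderiv jinv z (- (18) * g 2 z ^ 2 * g 3 z / Dg z).
Proof.
intros Hz. assert (N := Dg_neq_0 z Hz). unfold jinv. eapply Cderiv_val.
- apply Cderiv_div; [apply Cderiv_pow, Cderiv_g2, Hz|apply Cderiv_Dg, Hz|exact N].
- cbv beta. simpl INR. simpl pred.
  replace (RtoC (1 + 1 + 1)) with (RtoC 3) by (f_equal; ring). field. exact N.
Qed.

Lemma jinv_equiv_par z c2 c4 z' c2' c4' : U z c2 c4 -> equiv_par z c2 c4 z' c2' c4' -> jinv z = jinv z'.
Proof.
intros H [H' [E _]].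
assert (G : forall z c2 c4, U z c2 c4 ->
  jinv z = pr2 (u z c2 c4) ^ 3 / (27 * pr3 (u z c2 c4) ^ 2 - pr2 (u z c2 c4) ^ 3)).
{ intros x a b [Hx [_ Hw]]. rewrite disc_u. assert (N := Dg_neq_0 x Hx).
  unfold u, pr2, jinv. cbn [fst snd]. field. auto. }
rewrite (G _ _ _ H), (G _ _ _ H'). now rewrite E.
Qed.

Lemma Clim_quot (f : C -> C) (z l : C) (h : nat -> C) : Cderiv f z l -> Clim h 0 ->
  (forall n, h n <> 0) -> Clim (fun n => (f (z + h n) - f z) / h n) l.
Proof.
intros Hf Hh H0 e He.
destruct (proj1 (Cderiv_eps f z l) Hf (e / 2)%R ltac:(lra)) as [d [Hd Hd']].
destruct (Hh d Hd) as [N HN]. exists N. intros n Hn. specialize (HN n Hn).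
replace (h n - 0) with (h n) in HN by ring. specialize (Hd' _ HN).
assert (P := proj1 (Cmod_gt_0 _) (H0 n)).
replace ((f (z + h n) - f z) / h n - l) with ((f (z + h n) - f z - l * h n) / h n) by (field; apply H0).
rewrite Cmod_div by apply H0.
apply Rle_lt_trans with (e / 2)%R; [|lra].
apply Rmult_le_reg_r with (Cmod (h n)); [exact P|].
unfold Rdiv at 1. rewrite Rmult_assoc, Rinv_l; lra.
Qed.

(** A function of the form F(z + h) = F(z) + h^k (c + o(1)), with c nonzero and k > 0, moves in every
    direction: take for h small positive multiples of a k-th root of e0 / c. *)
Lemma decrease (F : C -> C) (z e0 c : C) (k : nat) :
  (0 < k)%nat -> c <> 0 -> e0 <> 0 -> UpperHalfPlane z ->
  (forall h : nat -> C, Clim h 0 -> (forall n, h n <> 0) ->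
     (forall n, UpperHalfPlane (z + h n)) ->
     exists Q : nat -> C, Clim Q c /\ forall n, F (z + h n) - F z = h n ^ k * Q n) ->
  exists z', UpperHalfPlane z' /\ (Cmod (F z' - F z - e0) < Cmod e0)%R.
Proof.
intros Hk Hc He0 Hz HF.
destruct (Croot (e0 / c) k Hk) as [h1 [N1 R1]].
{ intros E. apply He0. replace e0 with (e0 / c * c) by (field; exact Hc). rewrite E. ring. }
destruct (UHP_open z Hz) as [d [Hd HdU]].
destruct (INR_unbounded (Cmod h1 / d)) as [N HN].
set (s := fun n : nat => (/ INR (S (N + n)))%R).
assert (Hs : forall n, (0 < s n <= 1)%R).
{ intros n. unfold s. pose proof (INR_S_ge1 (N + n)). split; [apply Rinv_0_lt_compat; lra|].
  rewrite <- Rinv_1. apply Rinv_le_contravar; lra. }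
set (h := fun n => RtoC (s n) * h1).
assert (Hm := proj1 (Cmod_gt_0 _) N1).
assert (Hh0 : forall n, h n <> 0).
{ intros n. unfold h. apply Cmult_neq_0; [|exact N1]. intros E. apply RtoC_inj in E. specialize (Hs n). lra. }
assert (Mh : forall n, Cmod (h n) = (s n * Cmod h1)%R).
{ intros n. unfold h. rewrite Cmod_mult, Cmod_real; [easy|]. specialize (Hs n). lra. }
destruct (HF h) as [Q [LQ EQ]].
- apply (Clim_le _ _ (Cmod h1)). intros n. replace (h n - 0) with (h n) by ring. rewrite Mh.
  unfold s, Rdiv. rewrite Rmult_comm. apply Rmult_le_compat_l; [lra|].
  apply Rinv_le_contravar; [apply lt_0_INR; lia|apply le_INR; lia].
- exact Hh0.
- intros n. apply HdU. rewrite Mh. unfold s.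
  assert (X : (INR N < INR (S (N + n)))%R) by (apply lt_INR; lia).
  assert (P : (0 < INR (S (N + n)))%R) by (apply lt_0_INR; lia).
  apply Rmult_lt_compat_r with (r := d) in HN; [|exact Hd].
  replace (Cmod h1 / d * d)%R with (Cmod h1) in HN by (field; lra).
  apply Rmult_lt_reg_r with (INR (S (N + n))); [exact P|].
  replace (/ INR (S (N + n)) * Cmod h1 * INR (S (N + n)))%R with (Cmod h1) by (field; lra).
  nra.
- assert (Hcm := proj1 (Cmod_gt_0 _) Hc).
  destruct (LQ (Cmod c / 2)%R ltac:(lra)) as [n Hn]. specialize (Hn n ltac:(lia)).
  exists (z + h n). split.
  + apply HdU. rewrite Mh. unfold s.
    assert (X : (INR N < INR (S (N + n)))%R) by (apply lt_INR; lia).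
    assert (P : (0 < INR (S (N + n)))%R) by (apply lt_0_INR; lia).
    apply Rmult_lt_compat_r with (r := d) in HN; [|exact Hd].
    replace (Cmod h1 / d * d)%R with (Cmod h1) in HN by (field; lra).
    apply Rmult_lt_reg_r with (INR (S (N + n))); [exact P|].
    replace (/ INR (S (N + n)) * Cmod h1 * INR (S (N + n)))%R with (Cmod h1) by (field; lra).
    nra.
  + rewrite EQ. unfold h. rewrite Cpow_mult_l, R1.
    set (x := (s n ^ k)%R).
    assert (Hx : (0 < x <= 1)%R).
    { unfold x. specialize (Hs n). split; [apply pow_lt; lra|]. rewrite <- (pow1 k). apply pow_incr. lra. }
    replace (RtoC (s n) ^ k * (e0 / c) * Q n - e0) with
      (e0 * (RtoC x * ((Q n - c) / c) + - RtoC (1 - x))).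
    2:{ unfold x. rewrite RtoC_minus, RtoC_pow. field. exact Hc. }
    rewrite Cmod_mult. assert (He := proj1 (Cmod_gt_0 _) He0).
    rewrite <- (Rmult_1_r (Cmod e0)) at 2. apply Rmult_lt_compat_l; [exact He|].
    eapply Rle_lt_trans; [apply Cmod_triangle|].
    rewrite Cmod_opp, (Cmod_real (1 - x)) by lra.
    rewrite Cmod_mult, (Cmod_real x), Cmod_div by (first [exact Hc|lra]).
    assert (Y : (Cmod (Q n - c) / Cmod c < / 2)%R).
    { apply Rmult_lt_reg_r with (Cmod c); [exact Hcm|].
      unfold Rdiv. rewrite Rmult_assoc, Rinv_l; lra. }
    nra.
Qed.

(** The exponent k is 3 at the zeros of g_2, 2 at the zeros of g_3, and 1 elsewhere; at the zeros the
    derivative of g_2 or g_3 is nonzero because the discriminant is. *)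
Lemma jinv_decrease (z e0 : C) : UpperHalfPlane z -> e0 <> 0 ->
  exists z', UpperHalfPlane z' /\ (Cmod (jinv z' - jinv z - e0) < Cmod e0)%R.
Proof.
intros Hz He. assert (N := Dg_neq_0 z Hz).
assert (LD : forall h, Clim h 0 -> Clim (fun n => Dg (z + h n)) (Dg z)).
{ intros h Hh. apply (Clim_deriv Dg z _ _ (Cderiv_Dg z Hz)).
  intros e Hpos. destruct (Hh e Hpos) as [k Hk]. exists k. intros n Hn. specialize (Hk n Hn).
  now replace (z + h n - z) with (h n - 0) by ring. }
destruct (Ceq_dec (g 2 z) 0) as [Z2|N2]; [|destruct (Ceq_dec (g 3 z) 0) as [Z3|N3]].
- assert (N3 : g 3 z <> 0).
  { intros Z3. apply N. unfold Dg. rewrite Z2, Z3. simpl. ring. }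
  set (l := 4 * g 1 z * g 2 z - 6 * g 3 z).
  assert (Hl : l <> 0).
  { unfold l. rewrite Z2. replace (4 * g 1 z * 0 - 6 * g 3 z) with (- (6) * g 3 z) by ring.
    apply Cmult_neq_0; [|exact N3]. intros E. apply (f_equal Re) in E. simpl in E. lra. }
  apply (decrease jinv z e0 (l ^ 3 * / Dg z) 3); auto with arith.
  { apply Cmult_neq_0; [now apply Cpow_nz|]. now apply Cinv_nz. }
  intros h Hh H0 HU. exists (fun n => ((g 2 (z + h n) - g 2 z) / h n) ^ 3 * / Dg (z + h n)). split.
  + apply Clim_mult; [apply Clim_pow, Clim_quot; auto; now apply Cderiv_g2|].
    apply Clim_inv; [exact N|now apply LD].
  + intros n. unfold jinv. rewrite Z2. assert (N' := Dg_neq_0 _ (HU n)). field. repeat split; auto.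
- set (l := 6 * g 1 z * g 3 z - / 3 * g 2 z ^ 2).
  assert (Hl : l <> 0).
  { unfold l. rewrite Z3. replace (6 * g 1 z * 0 - / 3 * g 2 z ^ 2) with (- / 3 * g 2 z ^ 2) by ring.
    apply Cmult_neq_0; [|now apply Cpow_nz]. rewrite <- RtoC_inv, <- RtoC_opp by lra.
    intros E. apply RtoC_inj in E. lra. }
  apply (decrease jinv z e0 (27 * l ^ 2 * / Dg z) 2); auto with arith.
  { apply Cmult_neq_0; [apply Cmult_neq_0; [Cnz|now apply Cpow_nz]|now apply Cinv_nz]. }
  intros h Hh H0 HU. exists (fun n => 27 * ((g 3 (z + h n) - g 3 z) / h n) ^ 2 * / Dg (z + h n)). split.
  + apply Clim_mult; [apply Clim_scal, Clim_pow, Clim_quot; auto; now apply Cderiv_g3|].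
    apply Clim_inv; [exact N|now apply LD].
  + intros n. assert (N' := Dg_neq_0 _ (HU n)).
    assert (J1 : forall x, Dg x <> 0 -> jinv x = 27 * g 3 x ^ 2 / Dg x - 1).
    { intros x Hx. unfold jinv. replace (g 2 x ^ 3) with (27 * g 3 x ^ 2 - Dg x) by (unfold Dg; ring).
      field. exact Hx. }
    rewrite !J1 by assumption. rewrite Z3. field. repeat split; auto.
- apply (decrease jinv z e0 (- (18) * g 2 z ^ 2 * g 3 z / Dg z) 1); auto with arith.
  { apply Cmult_neq_0; [|now apply Cinv_nz]. apply Cmult_neq_0; [|exact N3].
    apply Cmult_neq_0; [|now apply Cpow_nz]. intros E. apply (f_equal Re) in E. simpl in E. lra. }
  intros h Hh H0 HU. exists (fun n => (jinv (z + h n) - jinv z) / h n). split.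
  + apply Clim_quot; auto. now apply Cderiv_jinv.
  + intros n. simpl. field. apply H0.
Qed.

(** A minimizing sequence for |jinv - zeta| can be taken in the fundamental domain, where cusp_bound
    keeps it in a compact set; the minimum is 0 by jinv_decrease.  The modular reduction of a point
    is applied through the parameters (- 1, 0), for which c4 z - c2 = 1. *)
Lemma jinv_surj (zeta : C) : exists z, UpperHalfPlane z /\ jinv z = zeta.
Proof.
set (E := fun r : R => exists z, UpperHalfPlane z /\ r = (- Cmod (jinv z - zeta))%R).
assert (Hi : UpperHalfPlane Ci) by (unfold UpperHalfPlane; simpl; lra).
destruct (completeness E) as [m [Ub Lub]].
{ exists 0%R. intros r [z [_ ->]]. pose proof (Cmod_ge_0 (jinv z - zeta)). lra. }
{ exists (- Cmod (jinv Ci - zeta))%R. now exists Ci. }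
assert (Hseq : forall n : nat, exists z, UpperHalfPlane z /\
  (Rabs (Re z) <= / 2)%R /\ (/ 2 <= Im z)%R /\ (Cmod (jinv z - zeta) <= - m + / INR (S n))%R).
{ intros n. assert (P : (0 < / INR (S n))%R) by (apply Rinv_0_lt_compat, lt_0_INR; lia).
  assert (X : exists z, UpperHalfPlane z /\ (Cmod (jinv z - zeta) < - m + / INR (S n))%R).
  { apply Classical_Prop.NNPP. intros NX.
    assert (Y : is_upper_bound E (m - / INR (S n))).
    { intros r [z [Hz ->]]. apply Rnot_lt_le. intros L. apply NX. exists z. split; [exact Hz|lra]. }
    specialize (Lub _ Y). lra. }
  destruct X as [z [Hz L]].
  assert (HU : U z (- (1)) 0).
  { split; [exact Hz|]. split.
    - apply pair_neq. left. intros X. apply (f_equal Re) in X. simpl in X. lra.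
    - replace (0 * z - - (1)) with (RtoC 1) by ring. Cnz. }
  destruct (equiv_par_reduce _ _ _ HU) as [z' [c [d [S1 [R1 I1]]]]].
  exists z'. split; [apply (proj1 S1)|]. split; [exact R1|]. split; [exact I1|].
  rewrite <- (jinv_equiv_par _ _ _ _ _ _ HU S1). lra. }
set (z := fun n => proj1_sig (constructive_indefinite_description _ (Hseq n))).
assert (Hz : forall n, UpperHalfPlane (z n) /\
  (Rabs (Re (z n)) <= / 2)%R /\ (/ 2 <= Im (z n))%R /\ (Cmod (jinv (z n) - zeta) <= - m + / INR (S n))%R).
{ intros n. unfold z. now destruct (constructive_indefinite_description _ (Hseq n)). }
assert (Hinv : forall n, (/ INR (S n) <= 1)%R).
{ intros n. rewrite <- Rinv_1. apply Rinv_le_contravar; [lra|apply INR_S_ge1]. }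
destruct (cusp_bound (- m + 1 + Cmod zeta)) as [Y HY].
destruct (complex_BW z (/ 2 + Rabs Y)) as [phi [z0 [Hphi L]]].
{ intros n. destruct (Hz n) as [H1 [H2 [H3 H4]]]. specialize (Hinv n).
  assert (B : (Im (z n) <= Y)%R).
  { apply HY; [exact H1|]. assert (N := Dg_neq_0 _ H1).
    replace (Cmod (g 2 (z n)) ^ 3)%R with (Cmod (jinv (z n)) * Cmod (Dg (z n)))%R.
    - apply Rmult_le_compat_r; [apply Cmod_ge_0|].
      replace (jinv (z n)) with ((jinv (z n) - zeta) + zeta) by ring.
      eapply Rle_trans; [apply Cmod_triangle|lra].
    - rewrite <- Cmod_mult, <- Cmod_pow. f_equal. unfold jinv. field. exact N. }
  eapply Rle_trans; [apply Cmod_le_sum|]. rewrite (Rabs_pos_eq (Im _)) by lra.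
  pose proof (Rle_abs Y). lra. }
assert (Hz0 : UpperHalfPlane z0).
{ unfold UpperHalfPlane. destruct (Clim_im _ _ L (/ 4)%R ltac:(lra)) as [k Hk].
  specialize (Hk k ltac:(lia)). destruct (Hz (phi k)) as [_ [_ [F2 _]]].
  apply Rabs_lt_between in Hk. lra. }
assert (LJ := Clim_deriv jinv z0 _ _ (Cderiv_jinv z0 Hz0) L).
assert (Min : (Cmod (jinv z0 - zeta) <= - m)%R).
{ apply Rle_plus_epsilon. intros eps He.
  destruct (LJ (eps / 2)%R ltac:(lra)) as [N1 H1].
  destruct (archimed_cor1 (eps / 2)%R ltac:(lra)) as [N2 [H2 H2']].
  set (n := max N1 N2). specialize (H1 n ltac:(unfold n; lia)).
  destruct (Hz (phi n)) as [_ [_ [_ H4]]].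
  assert (H5 : (/ INR (S (phi n)) <= / INR N2)%R).
  { apply Rinv_le_contravar; [now apply lt_0_INR|]. apply le_INR.
    pose proof (extraction_ge phi Hphi n). unfold n in *. lia. }
  replace (jinv z0 - zeta) with ((jinv (z (phi n)) - zeta) - (jinv (z (phi n)) - jinv z0)) by ring.
  eapply Rle_trans; [apply Cmod_triangle_sub|]. lra. }
exists z0. split; [exact Hz0|].
destruct (Ceq_dec (zeta - jinv z0) 0) as [Z|NZ].
{ replace zeta with ((zeta - jinv z0) + jinv z0) by ring. rewrite Z. ring. }
exfalso. destruct (jinv_decrease z0 _ Hz0 NZ) as [z' [Hz' L']].
replace (jinv z' - jinv z0 - (zeta - jinv z0)) with (jinv z' - zeta) in L' by ring.
assert (X : (- Cmod (jinv z' - zeta) <= m)%R) by (apply Ub; now exists z').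
rewrite <- Cmod_opp in Min. replace (- (jinv z0 - zeta)) with (zeta - jinv z0) in Min by ring. lra.
Qed.

Lemma Csqr_eq (a b : C) : a ^ 2 = b ^ 2 -> a = b \/ a = - b.
Proof.
intros H. assert (X : (a - b) * (a + b) = 0).
{ replace ((a - b) * (a + b)) with (a ^ 2 - b ^ 2) by ring. rewrite H. ring. }
destruct (Cmult_integral _ _ X) as [E|E]; [left|right].
- replace a with (a - b + b) by ring. rewrite E. ring.
- replace a with (a + b - b) by ring. rewrite E. ring.
Qed.

(** Once z has the right value of g_2^3 / D, a fourth root fixes w up to a power of i, and the sign of
    the third coordinate decides whether w or i w is right; if g_2 vanishes at z a sixth root is taken
    instead.  The parameters c2 and c4 are then determined by the first coordinate. *)
Lemma u_surj (t : C3) : T t -> exists z c2 c4, U z c2 c4 /\ t = u z c2 c4.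
Proof.
destruct t as [[t1 t2] t3]. unfold T, pr2, pr3. cbn [fst snd]. intros HD.
set (D := 27 * t3 ^ 2 - t2 ^ 3) in *.
destruct (jinv_surj (t2 ^ 3 / D)) as [z [Hz J]]. assert (N := Dg_neq_0 z Hz).
assert (J1 : g 2 z ^ 3 * D = t2 ^ 3 * Dg z).
{ unfold jinv in J. replace (g 2 z ^ 3) with (g 2 z ^ 3 / Dg z * Dg z) by (field; exact N).
  rewrite J. field. exact HD. }
assert (W : exists w : C, w <> 0 /\ g 2 z * w ^ 4 = t2 /\ g 3 z * w ^ 6 = t3).
{ destruct (Ceq_dec (g 2 z) 0) as [Z2|N2].
  - assert (T2 : t2 = 0).
    { destruct (Ceq_dec t2 0) as [E|E]; [exact E|exfalso].
      assert (X : t2 ^ 3 * Dg z <> 0) by (apply Cmult_neq_0; [now apply Cpow_nz|exact N]).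
      apply X. rewrite <- J1, Z2. simpl. ring. }
    assert (N3 : g 3 z <> 0).
    { intros Z3. apply N. unfold Dg. rewrite Z2, Z3. simpl. ring. }
    assert (T3 : t3 <> 0).
    { intros Z3. apply HD. unfold D. rewrite T2, Z3. simpl. ring. }
    destruct (Croot (t3 / g 3 z) 6) as [w [Hw Ew]]; [lia| |].
    { apply Cmult_neq_0; [exact T3|now apply Cinv_nz]. }
    exists w. split; [exact Hw|]. split.
    + rewrite Z2, T2. ring.
    + rewrite Ew. field. exact N3.
  - assert (T2 : t2 <> 0).
    { intros E. assert (X : g 2 z ^ 3 * D <> 0) by (apply Cmult_neq_0; [now apply Cpow_nz|exact HD]).
      apply X. rewrite J1, E. simpl. ring. }
    destruct (Croot (t2 / g 2 z) 4) as [w [Hw Ew]]; [lia| |].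
    { apply Cmult_neq_0; [exact T2|now apply Cinv_nz]. }
    assert (E2 : g 2 z * w ^ 4 = t2) by (rewrite Ew; field; exact N2).
    assert (ED : Dg z * w ^ 12 = D).
    { replace (w ^ 12) with ((w ^ 4) ^ 3) by ring. rewrite Ew.
      replace (Dg z * (t2 / g 2 z) ^ 3) with (t2 ^ 3 * Dg z / g 2 z ^ 3) by (field; exact N2).
      rewrite <- J1. field. exact N2. }
    assert (E3 : (g 3 z * w ^ 6) ^ 2 = t3 ^ 2).
    { replace ((g 3 z * w ^ 6) ^ 2) with (/ 27 * (Dg z * w ^ 12 + (g 2 z * w ^ 4) ^ 3))
        by (unfold Dg; field; Cnz).
      rewrite ED, E2. unfold D. field; Cnz. }
    destruct (Csqr_eq _ _ E3) as [E|E].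
    + exists w. auto.
    + assert (I2 : Ci * Ci = - (1)) by (apply injective_projections; simpl; ring).
      exists (Ci * w). split; [|split].
      * apply Cmult_neq_0; [|exact Hw]. intros X. apply (f_equal Im) in X. simpl in X. lra.
      * replace (g 2 z * (Ci * w) ^ 4) with (g 2 z * w ^ 4 * ((Ci * Ci) * (Ci * Ci))) by ring.
        rewrite E2, I2. ring.
      * replace (g 3 z * (Ci * w) ^ 6) with (g 3 z * w ^ 6 * ((Ci * Ci) * (Ci * Ci) * (Ci * Ci))) by ring.
        rewrite E, I2. ring. }
destruct W as [w [Hw [E2 E3]]].
set (c4 := (t1 - g 1 z * w ^ 2) / w). set (c2 := c4 * z - w).
assert (Ew : c4 * z - c2 = w) by (unfold c2; ring).
exists z, c2, c4. split.
- split; [exact Hz|]. split; [|now rewrite Ew].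
  apply pair_neq. destruct (Ceq_dec c4 0) as [E|E]; [left|now right].
  unfold c2. rewrite E. intros X. apply Hw. replace w with (- (0 * z - w)) by ring. rewrite X. ring.
- unfold u. rewrite Ew, E2, E3. apply C3_eq; auto. unfold c4. field. exact Hw.
Qed.

(** * Strict differentiability and the inverse function theorem in two variables *)

(** Strict differentiability at (z0, w0) with partial derivatives a and b.  The increment is taken
    between two arbitrary nearby points, which is what injectivity and Newton's iteration need. *)
Definition strict2 (F : C -> C -> C) (z0 w0 a b : C) : Prop :=
  forall e : R, (0 < e)%R -> exists rho : R, (0 < rho)%R /\
  forall z w z' w' : C, (Cmod (z - z0) < rho)%R -> (Cmod (w - w0) < rho)%R ->
    (Cmod (z' - z0) < rho)%R -> (Cmod (w' - w0) < rho)%R ->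
    (Cmod (F z w - F z' w' - a * (z - z') - b * (w - w')) <= e * (Cmod (z - z') + Cmod (w - w')))%R.

Lemma strict2_lin (F G : C -> C -> C) (z0 w0 a b c d x y : C) :
  strict2 F z0 w0 a b -> strict2 G z0 w0 c d ->
  strict2 (fun z w => x * F z w + y * G z w) z0 w0 (x * a + y * c) (x * b + y * d).
Proof.
intros HF HG e He. assert (X := Cmod_ge_0 x). assert (Y := Cmod_ge_0 y).
set (m := (2 * (Cmod x + Cmod y + 1))%R).
destruct (HF (e / m)%R) as [r1 [R1 H1]]; [apply Rdiv_lt_0_compat; unfold m; lra|].
destruct (HG (e / m)%R) as [r2 [R2 H2]]; [apply Rdiv_lt_0_compat; unfold m; lra|].
exists (Rmin r1 r2). split; [now apply Rmin_glb_lt|].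
intros z w z' w' A B A' B'.
pose proof (Rmin_l r1 r2). pose proof (Rmin_r r1 r2).
specialize (H1 z w z' w' ltac:(lra) ltac:(lra) ltac:(lra) ltac:(lra)).
specialize (H2 z w z' w' ltac:(lra) ltac:(lra) ltac:(lra) ltac:(lra)).
replace (x * F z w + y * G z w - (x * F z' w' + y * G z' w') - (x * a + y * c) * (z - z') - (x * b + y * d) * (w - w'))
 with (x * (F z w - F z' w' - a * (z - z') - b * (w - w')) + y * (G z w - G z' w' - c * (z - z') - d * (w - w'))) by ring.
eapply Rle_trans; [apply Cmod_triangle|]. rewrite !(Cmod_mult x), !(Cmod_mult y).
set (t := (Cmod (z - z') + Cmod (w - w'))%R) in *.
assert (T : (0 <= t)%R) by (unfold t; pose proof (Cmod_ge_0 (z - z')); pose proof (Cmod_ge_0 (w - w')); lra).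
apply Rle_trans with ((Cmod x + Cmod y) * (e / m * t))%R.
- rewrite Rmult_plus_distr_r. apply Rplus_le_compat; apply Rmult_le_compat_l; auto.
- replace (e * t)%R with (m * (e / m * t))%R by (field; unfold m; lra).
  apply Rmult_le_compat_r; [|unfold m; lra].
  apply Rmult_le_pos; [|exact T]. apply Rlt_le, Rdiv_lt_0_compat; unfold m; lra.
Qed.

(** The mean value inequality on the segment from z' to z, which stays in the disc. *)
Lemma strict_C1 (f df : C -> C) (z0 : C) :
  near0 (fun h => Cderiv f (z0 + h) (df (z0 + h))) ->
  (forall e, (0 < e)%R -> near0 (fun h => (Cmod (df (z0 + h)%C - df z0) < e)%R)) ->
  forall e : R, (0 < e)%R -> exists rho : R, (0 < rho)%R /\
  forall z z' : C, (Cmod (z - z0) < rho)%R -> (Cmod (z' - z0) < rho)%R ->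
    (Cmod (f z - f z' - df z0 * (z - z')) <= e * Cmod (z - z'))%R.
Proof.
intros Hd Hc e He. destruct (near0_and _ _ Hd (Hc (e / 2)%R ltac:(lra))) as [rho [Hr H]].
exists rho. split; [exact Hr|]. intros z z' A A'.
assert (S : forall t : R, (0 <= t <= 1)%R -> (Cmod (seg z' z t - z0) < rho)%R).
{ intros t Ht. replace (seg z' z t - z0) with (RtoC (1 - t) * (z' - z0) + RtoC t * (z - z0))
    by (rewrite RtoC_minus; ring).
  eapply Rle_lt_trans; [apply Cmod_triangle|]. rewrite !Cmod_mult, !Cmod_real by lra.
  assert (X : (Rmax (Cmod (z' - z0)) (Cmod (z - z0)) < rho)%R) by (apply Rmax_lub_lt; auto).
  pose proof (Rmax_l (Cmod (z' - z0)) (Cmod (z - z0))). pose proof (Rmax_r (Cmod (z' - z0)) (Cmod (z - z0))).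
  apply Rle_lt_trans with (2 := X).
  set (M := Rmax (Cmod (z' - z0)) (Cmod (z - z0))) in *.
  replace M with ((1 - t) * M + t * M)%R by ring.
  apply Rplus_le_compat; apply Rmult_le_compat_l; lra. }
replace (e * Cmod (z - z'))%R with (2 * (e / 2) * Cmod (z - z'))%R by field.
apply (segment_mvt f df z' z (df z0) (e / 2)).
- intros t Ht. destruct (H _ (S t Ht)) as [D _].
  now replace (z0 + (seg z' z t - z0)) with (seg z' z t) in D by ring.
- intros t Ht. destruct (H _ (S t Ht)) as [_ D].
  replace (z0 + (seg z' z t - z0)) with (seg z' z t) in D by ring. lra.
Qed.

Lemma strict2_prod (f k : C -> C) (z0 w0 a b : C) :
  (forall e : R, (0 < e)%R -> exists rho : R, (0 < rho)%R /\
    forall z z' : C, (Cmod (z - z0) < rho)%R -> (Cmod (z' - z0) < rho)%R ->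
    (Cmod (f z - f z' - a * (z - z')) <= e * Cmod (z - z'))%R) ->
  (forall e : R, (0 < e)%R -> exists rho : R, (0 < rho)%R /\
    forall z z' : C, (Cmod (z - w0) < rho)%R -> (Cmod (z' - w0) < rho)%R ->
    (Cmod (k z - k z' - b * (z - z')) <= e * Cmod (z - z'))%R) ->
  strict2 (fun z w => f z * k w) z0 w0 (a * k w0) (f z0 * b).
Proof.
intros Hf Hk e He.
set (m := (4 * (Cmod a + Cmod b + Cmod (f z0) + Cmod (k w0) + 2))%R).
assert (M1 := Cmod_ge_0 a). assert (M2 := Cmod_ge_0 b).
assert (M3 := Cmod_ge_0 (f z0)). assert (M4 := Cmod_ge_0 (k w0)).
set (x := Rmin 1 (e / m)).
assert (Hx : (0 < x)%R) by (apply Rmin_glb_lt; [lra|apply Rdiv_lt_0_compat; unfold m; lra]).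
assert (Hx1 : (x <= 1)%R) by apply Rmin_l.
assert (Hxm : (x * m <= e)%R).
{ apply Rle_trans with (e / m * m)%R; [|apply Req_le; field; unfold m; lra].
  apply Rmult_le_compat_r; [unfold m; lra|apply Rmin_r]. }
destruct (Hf x Hx) as [r1 [R1 H1]]. destruct (Hk x Hx) as [r2 [R2 H2]].
set (sf := (x / (Cmod a + 1))%R). set (sk := (x / (Cmod b + 1))%R).
assert (Hsf : (0 < sf)%R) by (apply Rdiv_lt_0_compat; lra).
assert (Hsk : (0 < sk)%R) by (apply Rdiv_lt_0_compat; lra).
exists (Rmin (Rmin r1 r2) (Rmin sf sk)).
split; [repeat apply Rmin_glb_lt; auto|].
intros z w z' w' A B A' B'.
pose proof (Rmin_l (Rmin r1 r2) (Rmin sf sk)). pose proof (Rmin_r (Rmin r1 r2) (Rmin sf sk)).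
pose proof (Rmin_l r1 r2). pose proof (Rmin_r r1 r2). pose proof (Rmin_l sf sk). pose proof (Rmin_r sf sk).
assert (Z00 : (Cmod (z0 - z0) < r1)%R) by (replace (z0 - z0) with (RtoC 0) by ring; rewrite Cmod_0; lra).
assert (W00 : (Cmod (w0 - w0) < r2)%R) by (replace (w0 - w0) with (RtoC 0) by ring; rewrite Cmod_0; lra).
assert (Ff : (Cmod (f z' - f z0) <= 2 * x)%R).
{ specialize (H1 z' z0 ltac:(lra) Z00).
  replace (f z' - f z0) with ((f z' - f z0 - a * (z' - z0)) + a * (z' - z0)) by ring.
  eapply Rle_trans; [apply Cmod_triangle|]. rewrite (Cmod_mult a).
  assert (Q : (Cmod (z' - z0) < sf)%R) by lra.
  assert (Q2 : (sf * (Cmod a + 1) = x)%R) by (unfold sf; field; lra).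
  pose proof (Cmod_ge_0 (z' - z0)).
  assert ((Cmod a + 1) * Cmod (z' - z0) <= x)%R by (rewrite <- Q2, (Rmult_comm sf); apply Rmult_le_compat_l; lra).
  assert (x * Cmod (z' - z0) <= 1 * Cmod (z' - z0))%R by (apply Rmult_le_compat_r; lra). lra. }
assert (Fk : (Cmod (k w - k w0) <= 2 * x)%R).
{ specialize (H2 w w0 ltac:(lra) W00).
  replace (k w - k w0) with ((k w - k w0 - b * (w - w0)) + b * (w - w0)) by ring.
  eapply Rle_trans; [apply Cmod_triangle|]. rewrite (Cmod_mult b).
  assert (Q : (Cmod (w - w0) < sk)%R) by lra.
  assert (Q2 : (sk * (Cmod b + 1) = x)%R) by (unfold sk; field; lra).
  pose proof (Cmod_ge_0 (w - w0)).
  assert ((Cmod b + 1) * Cmod (w - w0) <= x)%R by (rewrite <- Q2, (Rmult_comm sk); apply Rmult_le_compat_l; lra).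
  assert (x * Cmod (w - w0) <= 1 * Cmod (w - w0))%R by (apply Rmult_le_compat_r; lra). lra. }
specialize (H1 z z' ltac:(lra) ltac:(lra)). specialize (H2 w w' ltac:(lra) ltac:(lra)).
replace (f z * k w - f z' * k w' - a * k w0 * (z - z') - f z0 * b * (w - w')) with
  ((f z - f z' - a * (z - z')) * (k w - k w0) + (f z - f z' - a * (z - z')) * k w0
   + a * (z - z') * (k w - k w0)
   + ((f z' - f z0) * (k w - k w' - b * (w - w')) + f z0 * (k w - k w' - b * (w - w')))
   + (f z' - f z0) * (b * (w - w'))) by ring.
set (p := Cmod (z - z')) in *. set (q := Cmod (w - w')) in *.
assert (Pp : (0 <= p)%R) by apply Cmod_ge_0. assert (Pq : (0 <= q)%R) by apply Cmod_ge_0.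
set (EF := f z - f z' - a * (z - z')) in *. set (EK := k w - k w' - b * (w - w')) in *.
eapply Rle_trans; [apply Cmod_triangle|].
eapply Rle_trans; [apply Rplus_le_compat_r, Cmod_triangle|].
eapply Rle_trans; [apply Rplus_le_compat_r, Rplus_le_compat; [apply Cmod_triangle|apply Cmod_triangle]|].
eapply Rle_trans; [apply Rplus_le_compat_r, Rplus_le_compat_r, Rplus_le_compat_r, Cmod_triangle|].
rewrite !Cmod_mult. fold p q.
assert (T1 : (Cmod EF * Cmod (k w - k w0) <= (x * p) * 2)%R).
{ apply Rmult_le_compat; auto using Cmod_ge_0. lra. }
assert (T2 : (Cmod EF * Cmod (k w0) <= (x * p) * Cmod (k w0))%R) by (apply Rmult_le_compat_r; auto).
assert (T3 : (Cmod a * p * Cmod (k w - k w0) <= Cmod a * p * (2 * x))%R).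
{ apply Rmult_le_compat_l; [apply Rmult_le_pos; lra|exact Fk]. }
assert (T4 : (Cmod (f z' - f z0) * Cmod EK <= 2 * (x * q))%R).
{ apply Rmult_le_compat; auto using Cmod_ge_0. lra. }
assert (T5 : (Cmod (f z0) * Cmod EK <= Cmod (f z0) * (x * q))%R) by (apply Rmult_le_compat_l; auto).
assert (T6 : (Cmod (f z' - f z0) * (Cmod b * q) <= (2 * x) * (Cmod b * q))%R).
{ apply Rmult_le_compat_r; [apply Rmult_le_pos; lra|exact Ff]. }
apply Rle_trans with (x * m * (p + q))%R; [|apply Rmult_le_compat_r; lra].
unfold m.
assert (0 <= x * p)%R by (apply Rmult_le_pos; lra). assert (0 <= x * q)%R by (apply Rmult_le_pos; lra).
assert (0 <= x * p * Cmod a)%R by (apply Rmult_le_pos; lra).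
assert (0 <= x * p * Cmod b)%R by (apply Rmult_le_pos; lra).
assert (0 <= x * p * Cmod (f z0))%R by (apply Rmult_le_pos; lra).
assert (0 <= x * p * Cmod (k w0))%R by (apply Rmult_le_pos; lra).
assert (0 <= x * q * Cmod a)%R by (apply Rmult_le_pos; lra).
assert (0 <= x * q * Cmod b)%R by (apply Rmult_le_pos; lra).
assert (0 <= x * q * Cmod (f z0))%R by (apply Rmult_le_pos; lra).
assert (0 <= x * q * Cmod (k w0))%R by (apply Rmult_le_pos; lra).
lra.
Qed.

(** A contraction argument.  On a small ball the map (P, Q) differs from the identity by a map with
    Lipschitz constant 1/2 for the norm |z| + |w|.  Hence the lower bound on distances, and the
    residual of the simplified Newton iteration is halved at each step. *)
Lemma near_identity (P Q : C -> C -> C) (z0 w0 : C) (rho : R) :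
  strict2 P z0 w0 1 0 -> strict2 Q z0 w0 0 1 -> (0 < rho)%R ->
  exists r d : R, (0 < r <= rho)%R /\ (0 < d)%R /\
  (forall z w z' w', (Cmod (z - z0) < r)%R -> (Cmod (w - w0) < r)%R ->
     (Cmod (z' - z0) < r)%R -> (Cmod (w' - w0) < r)%R ->
     (Cmod (z - z') + Cmod (w - w') <= 2 * (Cmod (P z w - P z' w') + Cmod (Q z w - Q z' w')))%R) /\
  (forall p q, (Cmod (p - P z0 w0) + Cmod (q - Q z0 w0) < d)%R ->
     exists z w, (Cmod (z - z0) < r)%R /\ (Cmod (w - w0) < r)%R /\ P z w = p /\ Q z w = q).
Proof.
intros HP HQ Hrho.
destruct (HP (/ 4)%R ltac:(lra)) as [r1 [R1 H1]]. destruct (HQ (/ 4)%R ltac:(lra)) as [r2 [R2 H2]].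
set (r := Rmin rho (Rmin r1 r2)).
assert (Hr : (0 < r)%R) by (repeat apply Rmin_glb_lt; auto).
assert (Hr0 : (r <= rho)%R) by apply Rmin_l.
assert (Hr1 : (r <= r1)%R) by (eapply Rle_trans; [apply Rmin_r|apply Rmin_l]).
assert (Hr2 : (r <= r2)%R) by (eapply Rle_trans; [apply Rmin_r|apply Rmin_r]).
assert (EP : forall z w z' w', (Cmod (z - z0) < r)%R -> (Cmod (w - w0) < r)%R ->
     (Cmod (z' - z0) < r)%R -> (Cmod (w' - w0) < r)%R ->
     (Cmod (P z w - P z' w' - (z - z')) <= / 4 * (Cmod (z - z') + Cmod (w - w')))%R /\
     (Cmod (Q z w - Q z' w' - (w - w')) <= / 4 * (Cmod (z - z') + Cmod (w - w')))%R).
{ intros z w z' w' A B A' B'. split.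
  - replace (P z w - P z' w' - (z - z')) with (P z w - P z' w' - 1 * (z - z') - 0 * (w - w')) by ring.
    apply H1; lra.
  - replace (Q z w - Q z' w' - (w - w')) with (Q z w - Q z' w' - 0 * (z - z') - 1 * (w - w')) by ring.
    apply H2; lra. }
clear H1 H2.
exists r, (r / 4)%R. split; [lra|]. split; [lra|]. split.
- intros z w z' w' A B A' B'. destruct (EP z w z' w' A B A' B') as [E1 E2].
  assert (T1 := Cmod_triangle_sub (P z w - P z' w') (P z w - P z' w' - (z - z'))).
  assert (T2 := Cmod_triangle_sub (Q z w - Q z' w') (Q z w - Q z' w' - (w - w'))).
  replace (P z w - P z' w' - (P z w - P z' w' - (z - z'))) with (z - z') in T1 by ring.
  replace (Q z w - Q z' w' - (Q z w - Q z' w' - (w - w'))) with (w - w') in T2 by ring.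
  lra.
- intros p q Hpq. set (e0 := (Cmod (p - P z0 w0) + Cmod (q - Q z0 w0))%R) in *.
  assert (He0 : (0 <= e0)%R) by (unfold e0; pose proof (Cmod_ge_0 (p - P z0 w0)); pose proof (Cmod_ge_0 (q - Q z0 w0)); lra).
  set (step := fun x : C * C => (fst x + (p - P (fst x) (snd x)), snd x + (q - Q (fst x) (snd x)))).
  set (x := fix x n := match n with O => (z0, w0) | S m => step (x m) end).
  set (zz := fun n => fst (x n)). set (ww := fun n => snd (x n)).
  set (res := fun n => (Cmod (p - P (zz n) (ww n)) + Cmod (q - Q (zz n) (ww n)))%R).
  assert (Zs : forall n, zz (S n) = zz n + (p - P (zz n) (ww n))) by reflexivity.
  assert (Ws : forall n, ww (S n) = ww n + (q - Q (zz n) (ww n))) by reflexivity.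
  assert (I : forall n, (Cmod (zz n - z0) + Cmod (ww n - w0) <= 2 * e0 * (1 - (/ 2) ^ n))%R /\ (res n <= e0 * (/ 2) ^ n)%R).
  { induction n as [|n [I1 I2]].
    - unfold zz, ww, res. simpl. replace (z0 - z0) with (RtoC 0) by ring. replace (w0 - w0) with (RtoC 0) by ring.
      rewrite Cmod_0. unfold zz, ww, e0. simpl. lra.
    - assert (Pn : (0 < (/ 2) ^ n)%R) by (apply pow_lt; lra).
      assert (I1' : (Cmod (zz (S n) - z0) + Cmod (ww (S n) - w0) <= 2 * e0 * (1 - (/ 2) ^ S n))%R).
      { rewrite Zs, Ws.
        replace (zz n + (p - P (zz n) (ww n)) - z0) with ((zz n - z0) + (p - P (zz n) (ww n))) by ring.
        replace (ww n + (q - Q (zz n) (ww n)) - w0) with ((ww n - w0) + (q - Q (zz n) (ww n))) by ring.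
        assert (T1 := Cmod_triangle (zz n - z0) (p - P (zz n) (ww n))).
        assert (T2 := Cmod_triangle (ww n - w0) (q - Q (zz n) (ww n))).
        unfold res in I2. simpl. lra. }
      split; [exact I1'|].
      assert (Pn1 : (0 < (/ 2) ^ S n)%R) by (apply pow_lt; lra).
      assert (B : forall k, (Cmod (zz k - z0) + Cmod (ww k - w0) <= 2 * e0 * (1 - (/ 2) ^ k))%R -> (0 < (/ 2) ^ k)%R ->
         (Cmod (zz k - z0) < r)%R /\ (Cmod (ww k - w0) < r)%R).
      { intros k Hk Hp. pose proof (Cmod_ge_0 (zz k - z0)). pose proof (Cmod_ge_0 (ww k - w0)). split; nra. }
      destruct (B n I1 Pn) as [B1 B2]. destruct (B (S n) I1' Pn1) as [B3 B4].
      destruct (EP (zz (S n)) (ww (S n)) (zz n) (ww n) B3 B4 B1 B2) as [E1 E2].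
      unfold res.
      replace (p - P (zz (S n)) (ww (S n))) with (- (P (zz (S n)) (ww (S n)) - P (zz n) (ww n) - (zz (S n) - zz n)))
        by (set (PS := P (zz (S n)) (ww (S n))); rewrite Zs; ring).
      replace (q - Q (zz (S n)) (ww (S n))) with (- (Q (zz (S n)) (ww (S n)) - Q (zz n) (ww n) - (ww (S n) - ww n)))
        by (set (QS := Q (zz (S n)) (ww (S n))); rewrite Ws; ring).
      rewrite !Cmod_opp.
      replace (zz (S n) - zz n) with (p - P (zz n) (ww n)) in * by (rewrite Zs; ring).
      replace (ww (S n) - ww n) with (q - Q (zz n) (ww n)) in * by (rewrite Ws; ring).
      fold (res n) in E1, E2. simpl. lra. }
  assert (Half : forall n, (0 < (/ 2) ^ n)%R) by (intros; apply pow_lt; lra).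
  assert (Bz : forall n, (Cmod (zz n - z0) <= r / 2)%R /\ (Cmod (ww n - w0) <= r / 2)%R).
  { intros n. destruct (I n) as [I1 _]. specialize (Half n).
    pose proof (Cmod_ge_0 (zz n - z0)). pose proof (Cmod_ge_0 (ww n - w0)).
    assert (0 <= e0 * (/ 2) ^ n)%R by (apply Rmult_le_pos; lra). split; lra. }
  destruct (complex_BW (fun n => zz n - z0) (r / 2)) as [phi [z1 [Hphi Lz]]]; [intros; apply Bz|].
  destruct (complex_BW (fun n => ww (phi n) - w0) (r / 2)) as [psi [w1 [Hpsi Lw]]]; [intros; apply Bz|].
  set (th := fun n => phi (psi n)).
  assert (Hth : extraction th) by exact (extraction_comp phi psi Hphi Hpsi).
  assert (Lz' : Clim (fun n => zz (th n) - z0) z1) by exact (Clim_sub _ _ psi Lz Hpsi).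
  assert (LB : forall (v : nat -> C) (l : C) (B : R), Clim v l -> (forall n, (Cmod (v n) <= B)%R) -> (Cmod l <= B)%R).
  { intros v l B L H. apply Rle_plus_epsilon. intros eps He. destruct (L eps He) as [N HN].
    specialize (HN N ltac:(lia)). replace l with (v N - (v N - l)) by ring.
    eapply Rle_trans; [apply Cmod_triangle_sub|]. specialize (H N). lra. }
  assert (Hz1 : (Cmod z1 <= r / 2)%R) by (apply (LB _ _ _ Lz'); intros; apply Bz).
  assert (Hw1 : (Cmod w1 <= r / 2)%R) by (apply (LB _ _ _ Lw); intros; apply Bz).
  set (zt := z0 + z1). set (wt := w0 + w1).
  exists zt, wt.
  assert (A1 : (Cmod (zt - z0) < r)%R) by (replace (zt - z0) with z1 by (unfold zt; ring); lra).
  assert (A2 : (Cmod (wt - w0) < r)%R) by (replace (wt - w0) with w1 by (unfold wt; ring); lra).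
  split; [exact A1|]. split; [exact A2|].
  assert (Key : forall eps, (0 < eps)%R -> (Cmod (P zt wt - p) <= 0 + eps)%R /\
     (Cmod (Q zt wt - q) <= 0 + eps)%R).
  { intros eps He.
    destruct (Lz' (eps / 8)%R ltac:(lra)) as [N1 H1]. destruct (Lw (eps / 8)%R ltac:(lra)) as [N2 H2].
    destruct (pow_lt_1_zero (/ 2) ltac:(rewrite Rabs_pos_eq; lra) (eps / (4 * (e0 + 1)))%R) as [N3 H3];
      [apply Rdiv_lt_0_compat; lra|].
    set (n := max N1 (max N2 N3)).
    specialize (H1 n ltac:(unfold n; lia)). specialize (H2 n ltac:(unfold n; lia)).
    assert (Hn3 : (N3 <= th n)%nat) by (pose proof (extraction_ge th Hth n); unfold n in *; lia).
    specialize (H3 (th n) Hn3). fold (th n) in H2.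
    destruct (I (th n)) as [_ I2]. specialize (Half (th n)).
    rewrite Rabs_pos_eq in H3 by lra.
    assert (Res : (res (th n) <= eps / 4)%R).
    { eapply Rle_trans; [exact I2|].
      apply Rmult_lt_compat_r with (r := (e0 + 1)%R) in H3; [|lra].
      replace (eps / (4 * (e0 + 1)) * (e0 + 1))%R with (eps / 4)%R in H3 by (field; lra). nra. }
    destruct (Bz (th n)) as [B1 B2].
    destruct (EP zt wt (zz (th n)) (ww (th n)) A1 A2 ltac:(lra) ltac:(lra)) as [E1 E2].
    assert (D1 : (Cmod (zt - zz (th n)) < eps / 8)%R).
    { replace (zt - zz (th n)) with (- (zz (th n) - z0 - z1)) by (unfold zt; ring). now rewrite Cmod_opp. }
    assert (D2 : (Cmod (wt - ww (th n)) < eps / 8)%R).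
    { replace (wt - ww (th n)) with (- (ww (th n) - w0 - w1)) by (unfold wt; ring). now rewrite Cmod_opp. }
    unfold res in Res. pose proof (Cmod_ge_0 (p - P (zz (th n)) (ww (th n)))). pose proof (Cmod_ge_0 (q - Q (zz (th n)) (ww (th n)))).
    split.
    - replace (P zt wt - p) with
        ((P zt wt - P (zz (th n)) (ww (th n)) - (zt - zz (th n))) +
         ((zt - zz (th n)) - (p - P (zz (th n)) (ww (th n))))) by ring.
      eapply Rle_trans; [apply Cmod_triangle|].
      eapply Rle_trans; [apply Rplus_le_compat_l, Cmod_triangle_sub|]. lra.
    - replace (Q zt wt - q) with
        ((Q zt wt - Q (zz (th n)) (ww (th n)) - (wt - ww (th n))) +
         ((wt - ww (th n)) - (q - Q (zz (th n)) (ww (th n))))) by ring.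
      eapply Rle_trans; [apply Cmod_triangle|].
      eapply Rle_trans; [apply Rplus_le_compat_l, Cmod_triangle_sub|]. lra. }
  assert (Fin : forall a b : C, (forall eps, (0 < eps)%R -> (Cmod (a - b) <= 0 + eps)%R) -> a = b).
  { intros a b H. assert (X : (Cmod (a - b) <= 0)%R) by (apply Rle_plus_epsilon; exact H).
    assert (Y : a - b = 0) by (apply Cmod_eq_0; pose proof (Cmod_ge_0 (a - b)); lra).
    replace a with (a - b + b) by ring. rewrite Y. ring. }
  split; apply Fin; intros eps He; apply (Key eps He).
Qed.

(** * Local charts *)

Definition Phi2 (z w : C) : C := g 2 z * w ^ 4.
Definition Phi3 (z w : C) : C := g 3 z * w ^ 6.

Lemma strict_g (f df : C -> C) (z0 l : C) : UpperHalfPlane z0 ->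
  (forall z, UpperHalfPlane z -> Cderiv f z (df z)) -> Cderiv df z0 l ->
  forall e : R, (0 < e)%R -> exists rho : R, (0 < rho)%R /\
  forall z z' : C, (Cmod (z - z0) < rho)%R -> (Cmod (z' - z0) < rho)%R ->
    (Cmod (f z - f z' - df z0 * (z - z')) <= e * Cmod (z - z'))%R.
Proof.
intros Hz Hf Hdf. apply strict_C1.
- generalize (UHP_open z0 Hz). apply near0_imp. intros h Hh. now apply Hf.
- now apply Cderiv_cont with l.
Qed.

Lemma strict_pow (n : nat) (w0 : C) :
  forall e : R, (0 < e)%R -> exists rho : R, (0 < rho)%R /\
  forall z z' : C, (Cmod (z - w0) < rho)%R -> (Cmod (z' - w0) < rho)%R ->
    (Cmod (z ^ n - z' ^ n - RtoC (INR n) * w0 ^ pred n * (z - z')) <= e * Cmod (z - z'))%R.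
Proof.
apply (strict_C1 (fun w => w ^ n) (fun w => RtoC (INR n) * w ^ pred n)).
- exists 1%R. split; [lra|]. intros h _. eapply Cderiv_val; [apply Cderiv_pow, Cderiv_id|cbv beta; ring].
- eapply (Cderiv_cont (fun w => RtoC (INR n) * w ^ pred n)).
  apply Cderiv_mult; [apply Cderiv_const|apply Cderiv_pow, Cderiv_id].
Qed.

Definition dg2 (z : C) : C := 4 * g 1 z * g 2 z - 6 * g 3 z.
Definition dg3 (z : C) : C := 6 * g 1 z * g 3 z - / 3 * g 2 z ^ 2.

Lemma strict_Phi2 (z0 w0 : C) : UpperHalfPlane z0 ->
  strict2 Phi2 z0 w0 (dg2 z0 * w0 ^ 4) (g 2 z0 * (4 * w0 ^ 3)).
Proof.
intros Hz. apply (strict2_prod (g 2) (fun w => w ^ 4)).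
- eapply (strict_g (g 2) dg2 z0); [exact Hz|exact Cderiv_g2|].
  apply (solution_second _ _ _ z0 solution_g Hz).
- assert (S := strict_pow 4 w0). replace (RtoC (INR 4)) with (RtoC 4) in S by (f_equal; simpl; ring). exact S.
Qed.

Lemma strict_Phi3 (z0 w0 : C) : UpperHalfPlane z0 ->
  strict2 Phi3 z0 w0 (dg3 z0 * w0 ^ 6) (g 3 z0 * (6 * w0 ^ 5)).
Proof.
intros Hz. apply (strict2_prod (g 3) (fun w => w ^ 6)).
- eapply (strict_g (g 3) dg3 z0); [exact Hz|exact Cderiv_g3|]. unfold dg3.
  apply Cderiv_minus.
  + apply Cderiv_mult; [apply Cderiv_mult; [apply Cderiv_const|now apply Cderiv_g1]|now apply Cderiv_g3].
  + apply Cderiv_mult; [apply Cderiv_const|]. apply Cderiv_pow. now apply Cderiv_g2.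
- assert (S := strict_pow 6 w0). replace (RtoC (INR 6)) with (RtoC 6) in S by (f_equal; simpl; ring). exact S.
Qed.

(** The Jacobian determinant of (Phi2, Phi3); the differential system of the g_k makes it a multiple of
    the discriminant. *)
Definition jac (z w : C) : C := - (4 / 3) * Dg z * w ^ 9.

Lemma jac_neq_0 (z w : C) : UpperHalfPlane z -> w <> 0 -> jac z w <> 0.
Proof.
intros Hz Hw. unfold jac. apply Cmult_neq_0; [apply Cmult_neq_0; [|now apply Dg_neq_0]|now apply Cpow_nz].
rewrite <- RtoC_div, <- RtoC_opp by lra. intros E. apply RtoC_inj in E. lra.
Qed.

(** (Phi2, Phi3) composed with the inverse of its differential at (z0, w0). *)
Definition Px (z0 w0 z w : C) : C :=
  6 * g 3 z0 * w0 ^ 5 / jac z0 w0 * Phi2 z w + - (4 * g 2 z0 * w0 ^ 3) / jac z0 w0 * Phi3 z w.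
Definition Py (z0 w0 z w : C) : C :=
  - (dg3 z0 * w0 ^ 6) / jac z0 w0 * Phi2 z w + dg2 z0 * w0 ^ 4 / jac z0 w0 * Phi3 z w.

Lemma strict_Px (z0 w0 : C) : UpperHalfPlane z0 -> w0 <> 0 -> strict2 (Px z0 w0) z0 w0 1 0.
Proof.
intros Hz Hw. assert (N := Dg_neq_0 z0 Hz). assert (J := jac_neq_0 z0 w0 Hz Hw).
assert (S := strict2_lin _ _ _ _ _ _ _ _ (6 * g 3 z0 * w0 ^ 5 / jac z0 w0) (- (4 * g 2 z0 * w0 ^ 3) / jac z0 w0)
  (strict_Phi2 z0 w0 Hz) (strict_Phi3 z0 w0 Hz)).
match type of S with strict2 _ _ _ ?a ?b => replace a with (RtoC 1) in S; [replace b with (RtoC 0) in S|] end.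
- exact S.
- field. exact J.
- unfold dg2, dg3. transitivity (jac z0 w0 / jac z0 w0); [field; exact J|].
  unfold Cdiv. unfold jac at 1. unfold Dg. field; Cnz; try exact J.
Qed.

Lemma strict_Py (z0 w0 : C) : UpperHalfPlane z0 -> w0 <> 0 -> strict2 (Py z0 w0) z0 w0 0 1.
Proof.
intros Hz Hw. assert (N := Dg_neq_0 z0 Hz). assert (J := jac_neq_0 z0 w0 Hz Hw).
assert (S := strict2_lin _ _ _ _ _ _ _ _ (- (dg3 z0 * w0 ^ 6) / jac z0 w0) (dg2 z0 * w0 ^ 4 / jac z0 w0)
  (strict_Phi2 z0 w0 Hz) (strict_Phi3 z0 w0 Hz)).
match type of S with strict2 _ _ _ ?a ?b => replace a with (RtoC 0) in S; [replace b with (RtoC 1) in S|] end.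
- exact S.
- unfold dg2, dg3. transitivity (jac z0 w0 / jac z0 w0); [field; exact J|].
  unfold Cdiv. unfold jac at 1. unfold Dg. field; Cnz; try exact J.
- field. exact J.
Qed.

Lemma lin_bound (a b x y : C) : (Cmod (a * x + b * y) <= (Cmod a + Cmod b) * (Cmod x + Cmod y))%R.
Proof.
eapply Rle_trans; [apply Cmod_triangle|]. rewrite !Cmod_mult.
pose proof (Cmod_ge_0 a). pose proof (Cmod_ge_0 b). pose proof (Cmod_ge_0 x). pose proof (Cmod_ge_0 y). nra.
Qed.

(** The inverse function theorem for (Phi2, Phi3), from near_identity for (Px, Py). *)
Lemma chart (z0 w0 : C) : UpperHalfPlane z0 -> w0 <> 0 ->
  exists r d L : R, (0 < r)%R /\ (0 < d)%R /\ (0 <= L)%R /\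
  (forall z w, (Cmod (z - z0) < r)%R -> (Cmod (w - w0) < r)%R -> UpperHalfPlane z /\ w <> 0) /\
  (forall z w z' w', (Cmod (z - z0) < r)%R -> (Cmod (w - w0) < r)%R ->
     (Cmod (z' - z0) < r)%R -> (Cmod (w' - w0) < r)%R ->
     (Cmod (z - z') + Cmod (w - w') <=
       L * (Cmod (Phi2 z w - Phi2 z' w') + Cmod (Phi3 z w - Phi3 z' w')))%R) /\
  (forall t2 t3, (Cmod (t2 - Phi2 z0 w0) + Cmod (t3 - Phi3 z0 w0) < d)%R ->
     exists z w, (Cmod (z - z0) < r)%R /\ (Cmod (w - w0) < r)%R /\ Phi2 z w = t2 /\ Phi3 z w = t3).
Proof.
intros Hz Hw. assert (J := jac_neq_0 z0 w0 Hz Hw).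
destruct (UHP_open z0 Hz) as [d1 [Hd1 HU]].
assert (Hw' := proj1 (Cmod_gt_0 w0) Hw).
set (rho := Rmin d1 (Cmod w0)).
assert (Hrho : (0 < rho)%R) by now apply Rmin_glb_lt.
destruct (near_identity (Px z0 w0) (Py z0 w0) z0 w0 rho (strict_Px z0 w0 Hz Hw) (strict_Py z0 w0 Hz Hw) Hrho)
  as [r [d [[Hr Hrr] [Hd [Inj Surj]]]]].
set (x1 := 6 * g 3 z0 * w0 ^ 5 / jac z0 w0) in *. set (y1 := - (4 * g 2 z0 * w0 ^ 3) / jac z0 w0) in *.
set (x2 := - (dg3 z0 * w0 ^ 6) / jac z0 w0) in *. set (y2 := dg2 z0 * w0 ^ 4 / jac z0 w0) in *.
set (m := (Cmod x1 + Cmod y1 + (Cmod x2 + Cmod y2))%R).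
assert (Hm : (0 <= m)%R).
{ unfold m. pose proof (Cmod_ge_0 x1). pose proof (Cmod_ge_0 y1). pose proof (Cmod_ge_0 x2). pose proof (Cmod_ge_0 y2). lra. }
assert (PB : forall a b a' b', (Cmod ((x1 * a + y1 * b) - (x1 * a' + y1 * b')) + Cmod ((x2 * a + y2 * b) - (x2 * a' + y2 * b'))
   <= m * (Cmod (a - a') + Cmod (b - b')))%R).
{ intros a b a' b'.
  replace ((x1 * a + y1 * b) - (x1 * a' + y1 * b')) with (x1 * (a - a') + y1 * (b - b')) by ring.
  replace ((x2 * a + y2 * b) - (x2 * a' + y2 * b')) with (x2 * (a - a') + y2 * (b - b')) by ring.
  assert (B1 := lin_bound x1 y1 (a - a') (b - b')). assert (B2 := lin_bound x2 y2 (a - a') (b - b')).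
  unfold m. lra. }
exists r, (d / (m + 1))%R, (2 * m)%R.
split; [exact Hr|]. split; [apply Rdiv_lt_0_compat; lra|]. split; [lra|]. split; [|split].
- intros z w A B. split.
  + replace z with (z0 + (z - z0)) by ring. apply HU.
    apply Rlt_le_trans with (1 := A). apply Rle_trans with (1 := Hrr), Rmin_l.
  + intros E. rewrite E in B. replace (0 - w0) with (- w0) in B by ring. rewrite Cmod_opp in B.
    assert (rho <= Cmod w0)%R by apply Rmin_r. lra.
- intros z w z' w' A B A' B'. eapply Rle_trans; [now apply Inj|].
  rewrite Rmult_assoc. apply Rmult_le_compat_l; [lra|]. unfold Px, Py. apply PB.
- intros t2 t3 Ht.
  destruct (Surj (x1 * t2 + y1 * t3) (x2 * t2 + y2 * t3)) as [z [w [A [B [E1 E2]]]]].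
  + unfold Px, Py. fold x1 y1 x2 y2. eapply Rle_lt_trans; [apply PB|].
    apply Rmult_lt_compat_r with (r := (m + 1)%R) in Ht; [|lra].
    replace (d / (m + 1) * (m + 1))%R with d in Ht by (field; lra).
    pose proof (Cmod_ge_0 (t2 - Phi2 z0 w0)). pose proof (Cmod_ge_0 (t3 - Phi3 z0 w0)). nra.
  + exists z, w. split; [exact A|]. split; [exact B|].
    unfold Px in E1. unfold Py in E2. fold x1 y1 in E1. fold x2 y2 in E2.
    (* the matrix (x1, y1; x2, y2) is invertible, with inverse the Jacobian matrix *)
    assert (D : x1 * y2 - y1 * x2 = / jac z0 w0).
    { unfold x1, y1, x2, y2, dg2, dg3.
      transitivity (jac z0 w0 / (jac z0 w0 * jac z0 w0)); [|field; exact J].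
      unfold Cdiv. unfold jac at 5. unfold Dg. field; Cnz; try exact J. }
    assert (D0 : x1 * y2 - y1 * x2 <> 0) by (rewrite D; now apply Cinv_nz).
    split.
    * replace (Phi2 z w) with ((y2 * (x1 * Phi2 z w + y1 * Phi3 z w) - y1 * (x2 * Phi2 z w + y2 * Phi3 z w)) / (x1 * y2 - y1 * x2))
        by (field; exact D0).
      rewrite E1, E2. field. exact D0.
    * replace (Phi3 z w) with ((x1 * (x2 * Phi2 z w + y2 * Phi3 z w) - x2 * (x1 * Phi2 z w + y1 * Phi3 z w)) / (x1 * y2 - y1 * x2))
        by (field; exact D0).
      rewrite E1, E2. field. exact D0.
Qed.

(** The chain rule for P along (zs, ws) read backwards: a Lipschitz curve whose image under P is
    differentiable is itself differentiable in the direction seen by the differential of P.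
    Lipschitz bounds on lifts are what the chart provides. *)
Lemma lift_deriv (P : C -> C -> C) (zs ws : C -> C) (s p' a b : C) (K : R) :
  strict2 P (zs s) (ws s) a b -> Cderiv (fun s => P (zs s) (ws s)) s p' ->
  near0 (fun h => (Cmod (zs (s + h)%C - zs s) + Cmod (ws (s + h)%C - ws s) <= K * Cmod h)%R) ->
  Cderiv (fun s => a * zs s + b * ws s) s p'.
Proof.
intros HS HP HL. apply Cderiv_eps. intros eps He.
set (K1 := (Rabs K + 1)%R). assert (HK1 : (0 < K1)%R) by (unfold K1; pose proof (Rabs_pos K); lra).
destruct (HS (eps / (2 * K1))%R) as [rho [Hr H]]; [apply Rdiv_lt_0_compat; lra|].
assert (He2 : (0 < eps / 2)%R) by lra.
assert (Hrk : (0 < rho / K1)%R) by (apply Rdiv_lt_0_compat; lra).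
generalize (near0_and _ _ HL (near0_and _ _ (proj1 (Cderiv_eps _ _ _) HP _ He2) (near0_lt _ Hrk))).
apply near0_imp. intros h [A [B Hh]].
assert (P0 := Cmod_ge_0 h).
assert (A' : (Cmod (zs (s + h)%C - zs s) + Cmod (ws (s + h)%C - ws s) <= K1 * Cmod h)%R).
{ eapply Rle_trans; [exact A|]. apply Rmult_le_compat_r; [exact P0|]. unfold K1. pose proof (Rle_abs K). lra. }
assert (Small : (K1 * Cmod h < rho)%R).
{ apply Rmult_lt_compat_l with (r := K1) in Hh; [|exact HK1].
  replace (K1 * (rho / K1))%R with rho in Hh by (field; lra). exact Hh. }
pose proof (Cmod_ge_0 (zs (s + h) - zs s)). pose proof (Cmod_ge_0 (ws (s + h) - ws s)).
assert (Z : forall x, (Cmod (x - x) < rho)%R).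
{ intros x. replace (x - x) with (RtoC 0) by ring. now rewrite Cmod_0. }
specialize (H (zs (s + h)) (ws (s + h)) (zs s) (ws s) ltac:(lra) ltac:(lra) (Z _) (Z _)).
replace (a * zs (s + h) + b * ws (s + h) - (a * zs s + b * ws s) - p' * h) with
  ((P (zs (s + h)) (ws (s + h)) - P (zs s) (ws s) - p' * h) -
   (P (zs (s + h)) (ws (s + h)) - P (zs s) (ws s) - a * (zs (s + h) - zs s) - b * (ws (s + h) - ws s))) by ring.
eapply Rle_trans; [apply Cmod_triangle_sub|].
assert (X : (eps / (2 * K1) * (Cmod (zs (s + h)%C - zs s) + Cmod (ws (s + h)%C - ws s)) <= eps / 2 * Cmod h)%R).
{ replace (eps / 2 * Cmod h)%R with (eps / (2 * K1) * (K1 * Cmod h))%R by (field; lra).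
  apply Rmult_le_compat_l; [apply Rlt_le, Rdiv_lt_0_compat; lra|exact A']. }
lra.
Qed.

(** * Lifting tangent discs *)

Lemma Cderiv_lip_pair (f k : C -> C) (s a b : C) : Cderiv f s a -> Cderiv k s b ->
  near0 (fun h => (Cmod (f (s + h)%C - f s) + Cmod (k (s + h)%C - k s) <= (Cmod a + Cmod b + 2) * Cmod h)%R).
Proof.
intros Hf Hk. generalize (near0_and _ _ (Cderiv_lip f s a Hf) (Cderiv_lip k s b Hk)).
apply near0_imp. intros h [A B]. lra.
Qed.

Lemma near0_shift (s a : C) (r : R) : (Cmod (s - a) < r)%R -> near0 (fun h => (Cmod (s + h - a)%C < r)%R).
Proof.
intros H. exists (r - Cmod (s - a))%R. split; [lra|]. intros h Hh.
replace (s + h - a) with ((s - a) + h) by ring.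
eapply Rle_lt_trans; [apply Cmod_triangle|lra].
Qed.

(** The velocity of a lifted integral curve.  The factors in front of p2 and p3 are the entries of the
    inverse Jacobian matrix, and the result is the velocity h (w^2, w (t1 - g_1 w^2)) of (z, w). *)
Lemma lift_velocity (z w t1 h : C) : UpperHalfPlane z -> w <> 0 ->
  let t2 := Phi2 z w in let t3 := Phi3 z w in
  let p2 := h * (4 * t1 * t2 - 6 * t3) in let p3 := h * (6 * t1 * t3 - / 3 * t2 ^ 2) in
  6 * g 3 z * w ^ 5 / jac z w * p2 + - (4 * g 2 z * w ^ 3) / jac z w * p3 = h * w ^ 2 /\
  - (dg3 z * w ^ 6) / jac z w * p2 + dg2 z * w ^ 4 / jac z w * p3 = h * w * (t1 - g 1 z * w ^ 2).
Proof.
intros Hz Hw. cbv zeta. assert (J := jac_neq_0 z w Hz Hw).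
assert (E : forall x y, x = y * jac z w -> x / jac z w = y).
{ intros x y ->. field. exact J. }
split.
- transitivity ((6 * g 3 z * w ^ 5 * (h * (4 * t1 * Phi2 z w - 6 * Phi3 z w)) +
   - (4 * g 2 z * w ^ 3) * (h * (6 * t1 * Phi3 z w - / 3 * Phi2 z w ^ 2))) / jac z w).
  + field; Cnz; try exact J.
  + apply E. unfold jac, Dg, Phi2, Phi3. field; Cnz.
- transitivity ((- (dg3 z * w ^ 6) * (h * (4 * t1 * Phi2 z w - 6 * Phi3 z w)) +
   dg2 z * w ^ 4 * (h * (6 * t1 * Phi3 z w - / 3 * Phi2 z w ^ 2))) / jac z w).
  + field; Cnz; try exact J.
  + apply E. unfold jac, Dg, Phi2, Phi3, dg2, dg3. field; Cnz.
Qed.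

Lemma Cderiv_lincomb (x y : C) (f k : C -> C) (s a b : C) :
  Cderiv f s a -> Cderiv k s b -> Cderiv (fun s => x * f s + y * k s) s (x * a + y * b).
Proof.
intros Hf Hk. eapply Cderiv_val.
- apply Cderiv_plus; (apply Cderiv_mult; [apply Cderiv_const|]); [exact Hf|exact Hk].
- cbv beta. ring.
Qed.

Lemma chart_lift_deriv (zs ws t2 t3 : C -> C) (s t1 h : C) (K : R) :
  UpperHalfPlane (zs s) -> ws s <> 0 ->
  near0 (fun e => Phi2 (zs (s + e)) (ws (s + e)) = t2 (s + e) /\ Phi3 (zs (s + e)) (ws (s + e)) = t3 (s + e)) ->
  Cderiv t2 s (h * (4 * t1 * t2 s - 6 * t3 s)) -> Cderiv t3 s (h * (6 * t1 * t3 s - / 3 * t2 s ^ 2)) ->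
  near0 (fun h => (Cmod (zs (s + h)%C - zs s) + Cmod (ws (s + h)%C - ws s) <= K * Cmod h)%R) ->
  Cderiv zs s (h * ws s ^ 2) /\ Cderiv ws s (h * ws s * (t1 - g 1 (zs s) * ws s ^ 2)).
Proof.
intros Hz Hw HP H2 H3 HL.
assert (E := near0_0 _ HP). cbv beta in E. replace (s + 0) with s in E by ring. destruct E as [E2 E3].
destruct (lift_velocity (zs s) (ws s) t1 h Hz Hw) as [V1 V2]. rewrite E2, E3 in V1, V2.
split.
- apply Cderiv_ext with (fun s => 1 * zs s + 0 * ws s); [intros; ring|].
  eapply lift_deriv; [now apply strict_Px| |exact HL].
  rewrite <- V1. unfold Px.
  eapply Cderiv_ext_near; [|apply (Cderiv_lincomb _ _ t2 t3 s _ _ H2 H3)].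
  revert HP. apply near0_imp. intros e [-> ->]. reflexivity.
- apply Cderiv_ext with (fun s => 0 * zs s + 1 * ws s); [intros; ring|].
  eapply lift_deriv; [now apply strict_Py| |exact HL].
  rewrite <- V2. unfold Py.
  eapply Cderiv_ext_near; [|apply (Cderiv_lincomb _ _ t2 t3 s _ _ H2 H3)].
  revert HP. apply near0_imp. intros e [-> ->]. reflexivity.
Qed.

(** Lift gamma to (z, w) through the chart and read off c4 = (t1 - g_1 w^2) / w and c2 = c4 z - w from
    it; by chart_lift_deriv both have derivative 0.  Injectivity of the chart gives the uniqueness
    clause, which identifies these constants whenever a point of the curve is known to be of the
    form u (z, b2, b4). *)
Lemma lift (s0 : C) (rad : R) (gamma : C -> C3) (s1 z0 w0 : C) :
  tangent_disc Ra T s0 rad gamma -> (Cmod (s1 - s0) < rad)%R -> UpperHalfPlane z0 -> w0 <> 0 ->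
  Phi2 z0 w0 = pr2 (gamma s1) -> Phi3 z0 w0 = pr3 (gamma s1) ->
  exists (delta r : R) (c2 c4 : C), (0 < delta)%R /\ (0 < r)%R /\
  (forall s, (Cmod (s - s1) < delta)%R -> u_image c2 c4 (gamma s)) /\
  (forall s z b2 b4, (Cmod (s - s1) < delta)%R -> (Cmod (z - z0) < r)%R ->
     (Cmod (b4 * z - b2 - w0) < r)%R -> gamma s = u z b2 b4 -> b2 = c2 /\ b4 = c4).
Proof.
intros HT H1 Hz Hw E2 E3.
destruct (chart z0 w0 Hz Hw) as [r [d [L [Hr [Hd [HL [Ball [Inj Surj]]]]]]]].
assert (Hd2 : (0 < d / 2)%R) by lra.
assert (D0 : near0 (fun h => (Cmod (s1 + h - s0)%C < rad)%R /\
  (Cmod (pr2 (gamma (s1 + h)%C) - pr2 (gamma s1)) < d / 2)%R /\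
  (Cmod (pr3 (gamma (s1 + h)%C) - pr3 (gamma s1)) < d / 2)%R)).
{ destruct (HT s1 H1) as [_ [h [_ [_ [D2 D3]]]]].
  apply near0_and; [now apply near0_shift|].
  apply near0_and; [exact (Cderiv_cont _ _ _ D2 _ Hd2)|exact (Cderiv_cont _ _ _ D3 _ Hd2)]. }
destruct D0 as [delta [Hdelta D0]].
assert (D : forall s, (Cmod (s - s1) < delta)%R -> (Cmod (s - s0) < rad)%R /\
  (Cmod (pr2 (gamma s) - Phi2 z0 w0) + Cmod (pr3 (gamma s) - Phi3 z0 w0) < d)%R).
{ intros s Hs. specialize (D0 _ Hs). replace (s1 + (s - s1)) with s in D0 by ring.
  rewrite E2, E3. split; [easy|lra]. }
assert (X : forall s, exists p : C * C, (Cmod (s - s1) < delta)%R ->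
  (Cmod (fst p - z0) < r)%R /\ (Cmod (snd p - w0) < r)%R /\
  Phi2 (fst p) (snd p) = pr2 (gamma s) /\ Phi3 (fst p) (snd p) = pr3 (gamma s)).
{ intros s. destruct (Rlt_dec (Cmod (s - s1)) delta) as [Hs|Hs]; [|exists (RtoC 0, RtoC 0); lra].
  destruct (Surj _ _ (proj2 (D s Hs))) as [z [w P]]. now exists (z, w). }
set (zw := fun s => proj1_sig (constructive_indefinite_description _ (X s))).
assert (HX : forall s, (Cmod (s - s1) < delta)%R ->
  (Cmod (fst (zw s) - z0) < r)%R /\ (Cmod (snd (zw s) - w0) < r)%R /\
  Phi2 (fst (zw s)) (snd (zw s)) = pr2 (gamma s) /\ Phi3 (fst (zw s)) (snd (zw s)) = pr3 (gamma s)).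
{ intros s. exact (proj2_sig (constructive_indefinite_description _ (X s))). }
clearbody zw. clear X.
set (zs := fun s => fst (zw s)). set (ws := fun s => snd (zw s)).
assert (N : forall s, (Cmod (s - s1) < delta)%R -> UpperHalfPlane (zs s) /\ ws s <> 0).
{ intros s Hs. destruct (HX s Hs) as [A [B _]]. now apply Ball. }
assert (Dz : forall s, (Cmod (s - s1) < delta)%R -> exists h : C,
  let t1 := pr1 (gamma s) in
  Cderiv zs s (h * ws s ^ 2) /\ Cderiv ws s (h * ws s * (t1 - g 1 (zs s) * ws s ^ 2)) /\
  Cderiv (fun s => pr1 (gamma s)) s (h * (t1 ^ 2 - / 12 * (g 2 (zs s) * ws s ^ 4)))).
{ intros s Hs. destruct (HT s (proj1 (D s Hs))) as [_ [h [_ [D1 [D2 D3]]]]]. exists h. cbv zeta.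
  destruct (N s Hs) as [Nz Nw]. destruct (HX s Hs) as [A [B [C2 C3']]].
  assert (NS := near0_shift s s1 delta Hs).
  assert (LD : Cderiv zs s (h * ws s ^ 2) /\ Cderiv ws s (h * ws s * (pr1 (gamma s) - g 1 (zs s) * ws s ^ 2))).
  { eapply (chart_lift_deriv zs ws (fun s => pr2 (gamma s)) (fun s => pr3 (gamma s)));
      [exact Nz|exact Nw| |exact D2|exact D3|].
    - revert NS. apply near0_imp. intros e He. exact (proj2 (proj2 (HX _ He))).
    - generalize (near0_and _ _ NS (Cderiv_lip_pair _ _ s _ _ D2 D3)). apply near0_imp. intros e [He HLip].
      destruct (HX _ He) as [A' [B' [C2' C3'']]].
      eapply Rle_trans; [apply (Inj _ _ _ _ A' B' A B)|].
      rewrite C2, C3', C2', C3''.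
      eapply Rle_trans; [apply Rmult_le_compat_l; [exact HL|exact HLip]|].
      rewrite <- Rmult_assoc. apply Rle_refl. }
  split; [easy|]. split; [easy|].
  replace (g 2 (zs s) * ws s ^ 4) with (pr2 (gamma s)) by (symmetry; exact C2).
  exact D1. }
set (c4 := fun s => (pr1 (gamma s) - g 1 (zs s) * ws s ^ 2) / ws s).
set (c2 := fun s => c4 s * zs s - ws s).
assert (Dc4 : forall s, (Cmod (s - s1) < delta)%R -> Cderiv c4 s 0).
{ intros s Hs. destruct (N s Hs) as [Nz Nw]. destruct (Dz s Hs) as [h [P1 [P2 P3]]].
  eapply Cderiv_val.
  - unfold c4. apply Cderiv_div; [|exact P2|exact Nw].
    apply Cderiv_minus; [exact P3|]. apply Cderiv_mult; [|apply Cderiv_pow, P2].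
    apply (Cderiv_comp (g 1) zs); [now apply Cderiv_g1|exact P1].
  - cbv beta. simpl INR. simpl pred. rewrite RtoC_plus. field. Cnz. exact Nw. }
assert (Dc2 : forall s, (Cmod (s - s1) < delta)%R -> Cderiv c2 s 0).
{ intros s Hs. destruct (N s Hs) as [Nz Nw]. destruct (Dz s Hs) as [h [P1 [P2 P3]]].
  eapply Cderiv_val.
  - unfold c2. apply Cderiv_minus; [|exact P2]. apply Cderiv_mult; [now apply Dc4|exact P1].
  - unfold c4. field. exact Nw. }
assert (K4 := disc_constant c4 s1 delta Dc4). assert (K2 := disc_constant c2 s1 delta Dc2).
assert (G : forall s, (Cmod (s - s1) < delta)%R ->
  c4 s1 * zs s - c2 s1 = ws s /\ pr1 (gamma s) = g 1 (zs s) * ws s ^ 2 + c4 s1 * ws s).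
{ intros s Hs. rewrite <- (K4 s Hs), <- (K2 s Hs). split; [unfold c2; ring|].
  unfold c4. field. exact (proj2 (N s Hs)). }
exists delta, r, (c2 s1), (c4 s1). split; [exact Hdelta|]. split; [exact Hr|]. split.
- intros s Hs. destruct (G s Hs) as [G1 G2]. destruct (N s Hs) as [Nz Nw].
  destruct (HX s Hs) as [_ [_ [G3 G4]]].
  exists (zs s). split.
  + split; [exact Nz|]. rewrite G1. split; [|exact Nw].
    apply pair_neq. destruct (Ceq_dec (c2 s1) 0) as [Z2|Z2]; [|now left]. right.
    intros Z4. apply Nw. rewrite <- G1, Z2, Z4. ring.
  + unfold u. rewrite G1, <- G2.
    transitivity (pr1 (gamma s), pr2 (gamma s), pr3 (gamma s)).
    * now destruct (gamma s) as [[? ?] ?].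
    * apply C3_eq; [reflexivity|symmetry; exact G3|symmetry; exact G4].
- intros s z b2 b4 Hs Az Aw E. destruct (G s Hs) as [G1 G2]. destruct (N s Hs) as [Nz Nw].
  destruct (HX s Hs) as [A [B [G3 G4]]].
  set (w := b4 * z - b2) in *.
  assert (I := Inj z w (fst (zw s)) (snd (zw s)) Az Aw A B).
  rewrite G3, G4, E in I. change (pr2 (u z b2 b4)) with (Phi2 z w) in I. change (pr3 (u z b2 b4)) with (Phi3 z w) in I.
  replace (Phi2 z w - Phi2 z w) with (RtoC 0) in I by ring.
  replace (Phi3 z w - Phi3 z w) with (RtoC 0) in I by ring.
  rewrite Cmod_0 in I. pose proof (Cmod_ge_0 (z - fst (zw s))). pose proof (Cmod_ge_0 (w - snd (zw s))).
  assert (Iz : z = zs s).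
  { replace z with ((z - fst (zw s)) + fst (zw s)) by ring. rewrite (Cmod_eq_0 (z - fst (zw s))) by lra.
    unfold zs. ring. }
  assert (Iw : w = ws s).
  { replace w with ((w - snd (zw s)) + snd (zw s)) by ring. rewrite (Cmod_eq_0 (w - snd (zw s))) by lra.
    unfold ws. ring. }
  assert (E1 : pr1 (gamma s) = g 1 z * w ^ 2 + b4 * w) by (rewrite E; reflexivity).
  rewrite Iz, Iw, G2 in E1.
  assert (E4 : b4 = c4 s1).
  { replace b4 with ((g 1 (zs s) * ws s ^ 2 + b4 * ws s - g 1 (zs s) * ws s ^ 2) / ws s) by (field; exact Nw).
    rewrite <- E1. field. exact Nw. }
  split; [|exact E4].
  replace b2 with (b4 * z - w) by (unfold w; ring). rewrite E4, Iz, Iw, <- G1. ring.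
Qed.

(** * The images are saturated by leaves *)

Lemma Clim_near (v : nat -> C) (l : C) :
  (forall n, (Cmod (v n - l) < / INR (S n))%R) -> Clim v l.
Proof.
intros H e He. destruct (archimed_cor1 e He) as [N [HN Hpos]]. exists N. intros n Hn.
eapply Rlt_trans; [apply H|]. eapply Rle_lt_trans; [|exact HN].
apply Rinv_le_contravar; [now apply lt_0_INR|]. apply le_INR. lia.
Qed.

(** Otherwise points s_n and s'_n tending to s1 have images inside and outside the set.  The parameters of
    the former can be moved to the fundamental domain, where a subsequence of (z_n, w_n) converges
    to a point (z0, w0) over gamma s1.  The uniqueness clause of lift says that, for large n, the
    moved parameters are the constants of the lift through (z0, w0); these describe gamma on
    a whole neighbourhood, s'_n included. *)
Lemma image_locally_constant (s0 : C) (rad : R) (gamma : C -> C3) (s1 c2 c4 : C) :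
  tangent_disc Ra T s0 rad gamma -> (Cmod (s1 - s0) < rad)%R ->
  exists delta : R, (0 < delta)%R /\ forall s s',
    (Cmod (s - s1) < delta)%R -> (Cmod (s' - s1) < delta)%R ->
    u_image c2 c4 (gamma s) -> u_image c2 c4 (gamma s').
Proof.
intros HT H1. apply NNPP. intros HN.
assert (X : forall n : nat, exists q : C * C * (C * C * C),
  let '((s, s'), (z, b2, b4)) := q in
  (Cmod (s - s1) < / INR (S n))%R /\ (Cmod (s' - s1) < / INR (S n))%R /\
  ~ u_image c2 c4 (gamma s') /\ (forall t, u_image c2 c4 t <-> u_image b2 b4 t) /\
  U z b2 b4 /\ gamma s = u z b2 b4 /\ (Rabs (Re z) <= / 2)%R /\ (/ 2 <= Im z)%R).
{ intros n. apply NNPP. intros HC. apply HN. exists (/ INR (S n))%R.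
  split; [apply Rinv_0_lt_compat, lt_0_INR; lia|].
  intros s s' Hs Hs' [z [HU E]]. apply NNPP. intros Hns. apply HC.
  destruct (equiv_par_reduce z c2 c4 HU) as [z' [b2 [b4 [[HU' [E' HI]] HR]]]].
  exists ((s, s'), (z', b2, b4)). rewrite E, E'. repeat (split; auto); tauto. }
set (q := fun n => proj1_sig (constructive_indefinite_description _ (X n))).
assert (HQ := fun n => proj2_sig (constructive_indefinite_description _ (X n))). cbv beta in HQ.
change (forall n, let '((s, s'), (z, b2, b4)) := q n in
  (Cmod (s - s1) < / INR (S n))%R /\ (Cmod (s' - s1) < / INR (S n))%R /\
  ~ u_image c2 c4 (gamma s') /\ (forall t, u_image c2 c4 t <-> u_image b2 b4 t) /\
  U z b2 b4 /\ gamma s = u z b2 b4 /\ (Rabs (Re z) <= / 2)%R /\ (/ 2 <= Im z)%R) in HQ.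
clearbody q. clear X HN.
set (s := fun n => fst (fst (q n))). set (s' := fun n => snd (fst (q n))).
set (z := fun n => fst (fst (snd (q n)))). set (b2 := fun n => snd (fst (snd (q n)))).
set (b4 := fun n => snd (snd (q n))).
assert (HQ' : forall n, (Cmod (s n - s1) < / INR (S n))%R /\ (Cmod (s' n - s1) < / INR (S n))%R /\
  ~ u_image c2 c4 (gamma (s' n)) /\ (forall t, u_image c2 c4 t <-> u_image (b2 n) (b4 n) t) /\
  U (z n) (b2 n) (b4 n) /\ gamma (s n) = u (z n) (b2 n) (b4 n) /\
  (Rabs (Re (z n)) <= / 2)%R /\ (/ 2 <= Im (z n))%R).
{ intros n. specialize (HQ n). unfold s, s', z, b2, b4.
  destruct (q n) as [[x x'] [[y y2] y4]]. exact HQ. }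
clear HQ. clearbody s s' z b2 b4. clear q.
assert (Ls : Clim s s1) by (apply Clim_near; intros n; apply HQ').
assert (Ls' : Clim s' s1) by (apply Clim_near; intros n; apply HQ').
destruct (HT s1 H1) as [[HT1 _] [h [_ [_ [D2 D3]]]]].
destruct (fundamental_compact z (fun n => b4 n * z n - b2 n) (pr2 (gamma s1)) (pr3 (gamma s1)))
  as [phi [z0 [w0 [Hphi [Lz [Lw [Hz0 [Hw0 [E2 E3]]]]]]]]].
- intros n. destruct (HQ' n) as [_ [_ [_ [_ [[_ [_ Hw]] [_ [A B]]]]]]]. auto.
- apply Clim_ext with (fun n => pr2 (gamma (s n))).
  + intros n. destruct (HQ' n) as [_ [_ [_ [_ [_ [-> _]]]]]]. reflexivity.
  + exact (Clim_deriv _ _ _ s D2 Ls).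
- apply Clim_ext with (fun n => pr3 (gamma (s n))).
  + intros n. destruct (HQ' n) as [_ [_ [_ [_ [_ [-> _]]]]]]. reflexivity.
  + exact (Clim_deriv _ _ _ s D3 Ls).
- exact HT1.
- destruct (lift s0 rad gamma s1 z0 w0 HT H1 Hz0 Hw0 E2 E3) as [delta [r [a2 [a4 [Hd [Hr [Im Un]]]]]]].
  destruct (Clim_sub _ _ _ Ls Hphi delta Hd) as [N1 L1].
  destruct (Clim_sub _ _ _ Ls' Hphi delta Hd) as [N2 L2].
  destruct (Lz r Hr) as [N3 L3]. destruct (Lw r Hr) as [N4 L4].
  set (n := (N1 + N2 + N3 + N4)%nat).
  specialize (L1 n ltac:(unfold n; lia)). specialize (L2 n ltac:(unfold n; lia)).
  specialize (L3 n ltac:(unfold n; lia)). specialize (L4 n ltac:(unfold n; lia)).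
  destruct (HQ' (phi n)) as [_ [_ [Hno [HI [_ [E _]]]]]].
  destruct (Un _ _ _ _ L1 L3 L4 E) as [F2 F4].
  apply Hno, HI. rewrite F2, F4. now apply Im.
Qed.

Lemma interval_connected (P : R -> Prop) :
  (forall t, (0 <= t <= 1)%R -> exists d, (0 < d)%R /\ forall a b, (0 <= a <= 1)%R -> (0 <= b <= 1)%R ->
     (Rabs (a - t) < d)%R -> (Rabs (b - t) < d)%R -> P a -> P b) ->
  P 0%R -> P 1%R.
Proof.
intros HP H0.
destruct (completeness (fun t => (0 <= t <= 1)%R /\ P t)) as [m [Hub Hlub]].
- exists 1%R. intros t [Ht _]. lra.
- exists 0%R. split; [lra|exact H0].
- assert (M0 : (0 <= m)%R) by (apply Hub; split; [lra|exact H0]).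
  assert (M1 : (m <= 1)%R) by (apply Hlub; intros t [Ht _]; lra).
  destruct (HP m (conj M0 M1)) as [d [Hd H]].
  destruct (classic (exists a, (0 <= a <= 1)%R /\ P a /\ (m - d < a)%R)) as [[a [Ha [Pa Hma]]]|Hn].
  + assert (a <= m)%R by now apply Hub.
    set (b := Rmin 1 (m + d / 2)).
    assert (B1 : (b <= 1)%R) by apply Rmin_l. assert (B2 : (b <= m + d / 2)%R) by apply Rmin_r.
    assert (B3 : (m <= b)%R) by (apply Rmin_glb; lra).
    assert (Pb : P b).
    { apply (H a b); [exact Ha|lra|apply Rabs_def1; lra|apply Rabs_def1; lra|exact Pa]. }
    assert (b <= m)%R by (apply Hub; split; [lra|exact Pb]).
    replace 1%R with b; [exact Pb|].
    revert B2. unfold b in *. unfold Rmin in *. destruct (Rle_dec 1 (m + d / 2)); lra.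
  + exfalso. assert (m <= m - d)%R; [|lra].
    apply Hlub. intros t [Ht Pt]. apply Rnot_lt_le. intros Hlt. apply Hn. now exists t.
Qed.

(** Local constancy along the segment joining the two parameters. *)
Lemma plaque_image_imp (p q : C3) (c2 c4 : C) :
  on_common_plaque Ra T p q -> u_image c2 c4 p -> u_image c2 c4 q.
Proof.
intros [s0 [r [gamma [s1 [s2 [HT [H1 [H2 [<- <-]]]]]]]]] HI.
assert (S : forall t, (0 <= t <= 1)%R -> (Cmod (seg s1 s2 t - s0) < r)%R).
{ intros t Ht. replace (seg s1 s2 t - s0) with (RtoC (1 - t) * (s1 - s0) + RtoC t * (s2 - s0))
    by (rewrite RtoC_minus; ring).
  eapply Rle_lt_trans; [apply Cmod_triangle|]. rewrite !Cmod_mult, !Cmod_real by lra.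
  destruct (Req_dec t 0) as [->|Ht0]; [lra|].
  replace r with ((1 - t) * r + t * r)%R by ring.
  apply Rplus_le_lt_compat; [apply Rmult_le_compat_l|apply Rmult_lt_compat_l]; lra. }
replace s2 with (seg s1 s2 1) by ring.
apply (interval_connected (fun t => u_image c2 c4 (gamma (seg s1 s2 t)))).
- intros t Ht.
  destruct (image_locally_constant s0 r gamma (seg s1 s2 t) c2 c4 HT (S t Ht)) as [d [Hd H]].
  set (m := (Cmod (s2 - s1) + 1)%R). assert (Hm := Cmod_ge_0 (s2 - s1)).
  exists (d / m)%R. split; [apply Rdiv_lt_0_compat; unfold m; lra|].
  assert (B : forall a, (Rabs (a - t) < d / m)%R -> (Cmod (seg s1 s2 a - seg s1 s2 t) < d)%R).
  { intros a Ha. replace (seg s1 s2 a - seg s1 s2 t) with (RtoC (a - t) * (s2 - s1))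
      by (rewrite RtoC_minus; ring).
    rewrite Cmod_mult, Cmod_R. pose proof (Rabs_pos (a - t)).
    apply Rle_lt_trans with (Rabs (a - t) * m)%R; [apply Rmult_le_compat_l; unfold m; lra|].
    apply Rmult_lt_compat_r with (r := m) in Ha; [|unfold m; lra].
    replace (d / m * m)%R with d in Ha by (field; unfold m; lra). exact Ha. }
  intros a b _ _ Ha Hb. apply H; now apply B.
- replace (seg s1 s2 0) with s1 by ring. exact HI.
Qed.

Lemma plaque_sym (V : C3 -> C3) (W : C3 -> Prop) (p q : C3) :
  on_common_plaque V W p q -> on_common_plaque V W q p.
Proof.
intros [s0 [r [gamma [s1 [s2 [HT [H1 [H2 [E1 E2]]]]]]]]].
exists s0, r, gamma, s2, s1. auto.
Qed.

Lemma leaf_image (p q : C3) (c2 c4 : C) :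
  same_leaf Ra T p q -> (u_image c2 c4 p <-> u_image c2 c4 q).
Proof.
intros H. induction H as [p q H|p|p q _ IH|p q r _ IH1 _ IH2].
- split; apply plaque_image_imp; [exact H|now apply plaque_sym].
- easy.
- now symmetry.
- now transitivity (u_image c2 c4 q).
Qed.

(** * Each image lies in a leaf *)

(** A zero of Ra satisfies t2 = 12 t1^2 and t3 = 8 t1^3, so that 27 t3^2 = t2^3. *)
Lemma T_regular (t : C3) : T t -> regular Ra T t.
Proof.
intros H. split; [exact H|]. destruct t as [[t1 t2] t3]. unfold T in H. unfold Ra, pr1, pr2, pr3 in *. cbn [fst snd] in *.
intros E. assert (E1 := f_equal (fun x => fst (fst x)) E). assert (E2 := f_equal (fun x => snd (fst x)) E).
cbn [fst snd] in E1, E2. clear E.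
assert (F2 : t2 = 12 * t1 ^ 2).
{ replace t2 with (12 * t1 ^ 2 - 12 * (t1 ^ 2 - / 12 * t2)) by (field; Cnz). rewrite E1. ring. }
assert (F3 : t3 = 8 * t1 ^ 3).
{ replace t3 with (4 / 6 * t1 * t2 - / 6 * (4 * t1 * t2 - 6 * t3)) by (field; Cnz). rewrite E2, F2. field; Cnz. }
apply H. rewrite F2, F3. ring.
Qed.

(** By Ramanujan's equations, z -> u (z, c2, c4) has derivative Ra / w^2 with w = c4 z - c2. *)
Lemma u_tangent (f df : C -> C) (s0 c2 c4 : C) (r : R) :
  (forall s, (Cmod (s - s0) < r)%R -> U (f s) c2 c4 /\ Cderiv f s (df s) /\ df s <> 0) ->
  tangent_disc Ra T s0 r (fun s => u (f s) c2 c4).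
Proof.
intros H s Hs. destruct (H s Hs) as [HU [Hf Hdf]].
split; [now apply T_regular, u_in_T|]. destruct HU as [Hz [_ Hw]].
set (w := c4 * f s - c2) in *.
assert (Dw : Cderiv (fun s => c4 * f s - c2) s (c4 * df s)).
{ eapply Cderiv_val; [apply Cderiv_minus; [apply Cderiv_mult; [apply Cderiv_const|exact Hf]|apply Cderiv_const]|cbv beta; ring]. }
exists (df s / w ^ 2). split; [|split; [|split]].
- apply Cmult_neq_0; [exact Hdf|]. now apply Cinv_nz, Cpow_nz.
- unfold u, Ra, pr1, pr2, pr3. cbn [fst snd]. eapply Cderiv_val.
  + apply Cderiv_plus; [apply Cderiv_mult; [|apply Cderiv_pow, Dw]|apply Cderiv_mult; [apply Cderiv_const|exact Dw]].
    exact (Cderiv_comp (g 1) f _ _ _ (Cderiv_g1 _ Hz) Hf).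
  + cbv beta. fold w. simpl INR. simpl pred. rewrite RtoC_plus. field; Cnz; try exact Hw.
- unfold u, Ra, pr1, pr2, pr3. cbn [fst snd]. eapply Cderiv_val.
  + apply Cderiv_mult; [|apply Cderiv_pow, Dw].
    exact (Cderiv_comp (g 2) f _ _ _ (Cderiv_g2 _ Hz) Hf).
  + cbv beta. fold w. simpl INR. simpl pred. rewrite !RtoC_plus. field; Cnz; try exact Hw.
- unfold u, Ra, pr1, pr2, pr3. cbn [fst snd]. eapply Cderiv_val.
  + apply Cderiv_mult; [|apply Cderiv_pow, Dw].
    exact (Cderiv_comp (g 3) f _ _ _ (Cderiv_g3 _ Hz) Hf).
  + cbv beta. fold w. simpl INR. simpl pred. rewrite !RtoC_plus. field; Cnz; try exact Hw.
Qed.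

(** These discs, tangent to the real axis at 0, are contained in the upper half plane and exhaust it. *)
Lemma horodisc (Y : R) (z : C) : (0 < Y)%R ->
  (Cmod (z - (0%R, Y)) < Y)%R <-> (Re z ^ 2 + Im z ^ 2 < 2 * Y * Im z)%R.
Proof.
intros HY. destruct z as [x y]. unfold Cmod, Re, Im. simpl fst. simpl snd.
replace ((x + - 0) ^ 2 + (y + - Y) ^ 2)%R with (x ^ 2 + y ^ 2 - 2 * Y * y + Y ^ 2)%R by ring.
split.
- intros H. apply Rnot_le_lt. intros Hn. apply (Rlt_not_le _ _ H).
  rewrite <- (sqrt_pow2 Y) at 1 by lra. apply sqrt_le_1_alt. lra.
- intros H. apply Rlt_le_trans with (sqrt (Y ^ 2)); [|rewrite sqrt_pow2; lra].
  apply sqrt_lt_1_alt. split; [|lra].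
  replace (x ^ 2 + y ^ 2 - 2 * Y * y + Y ^ 2)%R with (x ^ 2 + (y - Y) ^ 2)%R by ring.
  pose proof (pow2_ge_0 x). pose proof (pow2_ge_0 (y - Y)). lra.
Qed.

(** Two points of the half plane lie in a common disc contained in it, since horodiscs exhaust it. *)
Lemma half_plane_plaque (f df : C -> C) (c2 c4 : C) :
  (forall z, UpperHalfPlane z -> U (f z) c2 c4 /\ Cderiv f z (df z) /\ df z <> 0) ->
  forall z1 z2, UpperHalfPlane z1 -> UpperHalfPlane z2 ->
  on_common_plaque Ra T (u (f z1) c2 c4) (u (f z2) c2 c4).
Proof.
intros H z1 z2 H1 H2. unfold UpperHalfPlane in H1, H2.
set (q := fun z => ((Re z ^ 2 + Im z ^ 2) / (2 * Im z))%R).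
assert (Q : forall z, (0 < Im z)%R -> (0 < q z)%R).
{ intros z Hz. apply Rdiv_lt_0_compat; [|lra]. pose proof (pow2_ge_0 (Re z)). pose proof (pow_lt _ 2 Hz). lra. }
set (Y := (q z1 + q z2 + 1)%R).
assert (Q1 := Q z1 H1). assert (Q2 := Q z2 H2).
assert (HY : (0 < Y)%R) by (unfold Y; lra).
assert (In : forall z, (0 < Im z)%R -> (q z < Y)%R -> (Cmod (z - (0%R, Y)) < Y)%R).
{ intros z Hz Hq. apply horodisc; [exact HY|].
  apply Rmult_lt_compat_r with (r := (2 * Im z)%R) in Hq; [|lra].
  unfold q in Hq. replace ((Re z ^ 2 + Im z ^ 2) / (2 * Im z) * (2 * Im z))%R with (Re z ^ 2 + Im z ^ 2)%R in Hq by (field; lra).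
  lra. }
exists (0%R, Y), Y, (fun s => u (f s) c2 c4), z1, z2. split; [|split; [|split]].
- apply u_tangent with df. intros s Hs. apply H. apply horodisc in Hs; [|exact HY].
  unfold UpperHalfPlane. pose proof (pow2_ge_0 (Re s)). pose proof (pow2_ge_0 (Im s)).
  apply Rnot_le_lt. intros Hn. nra.
- apply In; [exact H1|unfold Y; lra].
- apply In; [exact H2|unfold Y; lra].
- easy.
Qed.

Lemma closer_to_conj (p z : C) : UpperHalfPlane p ->
  (Cmod (z - p) < Cmod (z - Cconj p))%R <-> UpperHalfPlane z.
Proof.
unfold UpperHalfPlane. destruct p as [a b], z as [x y]. unfold Cmod, Cconj, Im. simpl fst. simpl snd. intros Hb.
split; intros H.
- apply sqrt_lt_0_alt in H. apply Rnot_le_lt. intros Hn. nra.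
- apply sqrt_lt_1_alt. split; [pose proof (pow2_ge_0 (x + - a)); pose proof (pow2_ge_0 (y + - b)); lra|nra].
Qed.

Lemma Cconj_neq (p : C) : UpperHalfPlane p -> p - Cconj p <> 0.
Proof.
unfold UpperHalfPlane. destruct p as [a b]. simpl. intros Hb E. apply (f_equal Im) in E. simpl in E. lra.
Qed.

(** The universal covering of the half plane punctured at p: the exponential, followed by the
    inverse Cayley transform taking 0 to p. *)
Definition puncture (p z : C) : C :=
  (p - Cconj p * Cexp (Ci * z)) / (1 - Cexp (Ci * z)).

Lemma Cmod_Cexp_Ci (z : C) : Cmod (Cexp (Ci * z)) = exp (- Im z).
Proof. rewrite Cmod_Cexp. f_equal. destruct z; simpl; ring. Qed.

Lemma one_minus_neq_0 (x : C) : (Cmod x < 1)%R -> 1 - x <> 0.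
Proof.
intros H E. assert (X : x = 1) by (replace x with (1 - (1 - x)) by ring; rewrite E; ring).
rewrite X, Cmod_1 in H. lra.
Qed.

Lemma puncture_image (p z : C) : UpperHalfPlane p -> UpperHalfPlane z ->
  UpperHalfPlane (puncture p z) /\ puncture p z <> p /\
  exists d, Cderiv (puncture p) z d /\ d <> 0.
Proof.
intros Hp Hz. assert (P := Cconj_neq p Hp).
assert (E0 := Cexp_neq_0 (Ci * z)).
assert (M : (Cmod (Cexp (Ci * z)) < 1)%R).
{ rewrite Cmod_Cexp_Ci, <- exp_0. apply exp_increasing. unfold UpperHalfPlane in Hz. lra. }
assert (N := one_minus_neq_0 _ M).
assert (F1 : puncture p z - p = Cexp (Ci * z) * ((p - Cconj p) / (1 - Cexp (Ci * z)))).
{ unfold puncture. field. exact N. }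
assert (F2 : puncture p z - Cconj p = (p - Cconj p) / (1 - Cexp (Ci * z))).
{ unfold puncture. field. exact N. }
assert (G : (p - Cconj p) / (1 - Cexp (Ci * z)) <> 0) by (apply Cmult_neq_0; [exact P|now apply Cinv_nz]).
split; [|split].
- apply (closer_to_conj p _ Hp). rewrite F1, F2, Cmod_mult.
  apply Cmod_gt_0 in G. nra.
- intros E. rewrite E in F1. replace (p - p) with (RtoC 0) in F1 by ring.
  symmetry in F1. revert F1. now apply Cmult_neq_0.
- exists (Cexp (Ci * z) * Ci * (p - Cconj p) / (1 - Cexp (Ci * z)) ^ 2). split.
  + assert (DE : Cderiv (fun z => Cexp (Ci * z)) z (Cexp (Ci * z) * Ci)).
    { apply (Cderiv_comp Cexp (fun z => Ci * z)); [apply Cderiv_Cexp|].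
      eapply Cderiv_val; [apply Cderiv_mult; [apply Cderiv_const|apply Cderiv_id]|cbv beta; ring]. }
    eapply Cderiv_val.
    * unfold puncture. apply Cderiv_div; [| |exact N].
      -- apply Cderiv_minus; [apply Cderiv_const|apply Cderiv_mult; [apply Cderiv_const|exact DE]].
      -- apply Cderiv_minus; [apply Cderiv_const|exact DE].
    * cbv beta. field. exact N.
  + apply Cmult_neq_0; [apply Cmult_neq_0; [apply Cmult_neq_0; [exact E0|]|exact P]|now apply Cinv_nz, Cpow_nz].
    intros E. apply (f_equal Im) in E. simpl in E. lra.
Qed.

Lemma puncture_surj (p y : C) : UpperHalfPlane p -> UpperHalfPlane y -> y <> p ->
  exists z, UpperHalfPlane z /\ puncture p z = y.
Proof.
intros Hp Hy Hyp. assert (P := Cconj_neq p Hp).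
assert (Cl := proj2 (closer_to_conj p y Hp) Hy).
assert (A : y - p <> 0).
{ intros E. apply Hyp. replace y with ((y - p) + p) by ring. rewrite E. ring. }
assert (B : y - Cconj p <> 0).
{ intros E. rewrite E, Cmod_0 in Cl. pose proof (Cmod_ge_0 (y - p)). lra. }
destruct (Cexp_surj ((y - p) / (y - Cconj p))) as [s Hs].
{ apply Cmult_neq_0; [exact A|now apply Cinv_nz]. }
exists (- Ci * s).
assert (Es : Ci * (- Ci * s) = s) by (destruct s; unfold Ci; apply injective_projections; simpl; ring).
assert (M : Cmod (Cexp s) = exp (Re s)) by apply Cmod_Cexp.
rewrite Hs in M. unfold Cdiv in M. rewrite Cmod_mult, Cmod_inv in M by exact B.
assert (PB := proj1 (Cmod_gt_0 _) B).
split.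
- assert (L : (exp (Re s) < exp 0)%R).
  { rewrite <- M, exp_0. apply Rmult_lt_reg_r with (1 := PB).
    rewrite Rmult_assoc, Rinv_l by lra. lra. }
  apply exp_lt_inv in L. unfold UpperHalfPlane. destruct s; simpl in *. lra.
- unfold puncture. rewrite Es, Hs. field. split; [exact B|].
  replace (y - Cconj p - (y - p)) with (p - Cconj p) by ring. exact P.
Qed.

(** The parameter z ranges over the half plane, punctured if c4 z - c2 vanishes there.  Without puncture
    the plaque is parametrized by z itself, otherwise by the universal covering. *)
Lemma image_plaque (z1 z2 c2 c4 : C) : U z1 c2 c4 -> U z2 c2 c4 ->
  on_common_plaque Ra T (u z1 c2 c4) (u z2 c2 c4).
Proof.
intros [H1 [Hc W1]] [H2 [_ W2]].
destruct (classic (exists p, UpperHalfPlane p /\ c4 * p - c2 = 0)) as [[p [Hp Ep]]|Hn].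
- assert (Off : forall z, c4 * z - c2 <> 0 <-> z <> p).
  { assert (N4 : c4 <> 0).
    { intros E. apply Hc. rewrite E in *. f_equal.
      replace c2 with (- (0 * p - c2)) by ring. rewrite Ep. ring. }
    intros z. replace (c4 * z - c2) with (c4 * (z - p)) by (transitivity (c4 * z - c2 - (c4 * p - c2)); [ring|rewrite Ep; ring]).
    split.
    - intros H E. apply H. rewrite E. ring.
    - intros H. apply Cmult_neq_0; [exact N4|]. intros E. apply H.
      replace z with ((z - p) + p) by ring. rewrite E. ring. }
  destruct (puncture_surj p z1 Hp H1 (proj1 (Off _) W1)) as [y1 [Y1 <-]].
  destruct (puncture_surj p z2 Hp H2 (proj1 (Off _) W2)) as [y2 [Y2 <-]].
  assert (D : forall z, exists d, UpperHalfPlane z -> Cderiv (puncture p) z d /\ d <> 0).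
  { intros z. destruct (classic (UpperHalfPlane z)) as [Hz|Hz]; [|now exists 0].
    destruct (puncture_image p z Hp Hz) as [_ [_ [d Hd]]]. now exists d. }
  apply (half_plane_plaque (puncture p) (fun z => proj1_sig (constructive_indefinite_description _ (D z)))); [|exact Y1|exact Y2].
  intros z Hz. destruct (puncture_image p z Hp Hz) as [A [B _]]. split.
  + split; [exact A|]. split; [exact Hc|]. now apply Off.
  + exact (proj2_sig (constructive_indefinite_description _ (D z)) Hz).
- apply (half_plane_plaque (fun z => z) (fun _ => 1)); [|exact H1|exact H2].
  intros z Hz. split; [|split; [apply Cderiv_id|]].
  + split; [exact Hz|]. split; [exact Hc|]. intros E. apply Hn. now exists z.
  + intros E. apply RtoC_inj in E. lra.
Qed.

(** An affine function that is not zero cannot vanish at both i and 2 i. *)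
Lemma U_nonempty (c2 c4 : C) : (c2, c4) <> (RtoC 0, RtoC 0) -> exists z, U z c2 c4.
Proof.
intros Hc. assert (Hi : UpperHalfPlane Ci) by (unfold UpperHalfPlane; simpl; lra).
destruct (Ceq_dec (c4 * Ci - c2) 0) as [E|E]; [|exists Ci; repeat split; auto].
exists (2 * Ci). split; [unfold UpperHalfPlane; simpl; lra|]. split; [exact Hc|].
intros E'. apply Hc.
assert (X : c4 * Ci = 0).
{ transitivity ((c4 * (2 * Ci) - c2) - (c4 * Ci - c2)); [ring|]. rewrite E, E'. ring. }
assert (E4 : c4 = 0).
{ destruct (Cmult_integral _ _ X) as [Z|Z]; [exact Z|]. apply (f_equal Im) in Z. simpl in Z. lra. }
f_equal; [|exact E4]. rewrite E4 in E. replace c2 with (- (0 * Ci - c2)) by ring. rewrite E. ring.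
Qed.

Lemma image_is_leaf (z c2 c4 : C) (q : C3) : U z c2 c4 ->
  (u_image c2 c4 q <-> same_leaf Ra T (u z c2 c4) q).
Proof.
intros HU. split.
- intros [z' [HU' ->]]. apply rst_step. now apply image_plaque.
- intros H. apply (leaf_image _ _ c2 c4 H). now exists z.
Qed.

Theorem proposition4 :
  (forall z c2 c4 : C, U z c2 c4 -> T (u z c2 c4)) /\
  (forall c2 c4 : C, (c2, c4) <> (RtoC 0, RtoC 0) ->
     is_leaf Ra T (u_image c2 c4)) /\
  (forall L : C3 -> Prop, is_leaf Ra T L ->
     exists c2 c4 : C, (c2, c4) <> (RtoC 0, RtoC 0) /\
       forall t : C3, L t <-> u_image c2 c4 t).
Proof.
split; [exact u_in_T|split].
- intros c2 c4 Hc. destruct (U_nonempty c2 c4 Hc) as [z HU].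
  exists (u z c2 c4). split; [now apply T_regular, u_in_T|].
  intros q. now apply image_is_leaf.
- intros L [p [[Hp _] HL]]. destruct (u_surj p Hp) as [z [c2 [c4 [HU ->]]]].
  exists c2, c4. split; [apply HU|].
  intros t. rewrite HL. symmetry. now apply image_is_leaf.
Qed.
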